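(* The Offensive Alliance problem is W[1]-hard when parameterized by the size of a vertex deletion set into trees of height at most 7.
   Context: All graphs are finite, simple and undirected. For $S\subseteq V(G)$, $N(S)$ is the open neighbourhood of $S$ (vertices not in $S$ adjacent to a vertex of $S$), $S^c=V(G)\setminus S$, and $d_S(v)$ is the number of neighbours of $v$ in $S$. A non-empty set $S\subseteq V(G)$ is an offensive alliance if $d_S(v)\ge d_{S^c}(v)+1$ for every $v\in N(S)$. Offensive Alliance: Input: a graph $G$ and an integer $r\ge 1$. Question: is there an offensive alliance $S$ with $1\le |S|\le r$? A vertex deletion set into trees of height at most $h$ is a set $D\subseteq V(G)$ such that every connected component of $G-D$ is a tree of height at most $h$; the parameter is the size of such a set. *)

(* Defs.v *)
From mathcomp Require Import all_boot.
From mathcomp Require Import boolp.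

Set Implicit Arguments.
Unset Strict Implicit.
Unset Printing Implicit Defensive.

(** * Deterministic multi-tape Turing machines *)

(* Tapes are infinite in both directions; [None] is the blank symbol. *)
Definition symbol : Type := option bool.

Inductive move := MoveLeft | MoveRight | Stay.

(* The cells to the left of the head (nearest first), the scanned cell, and the
   cells to the right of the head; cells not listed are blank. *)
Definition tape : Type := (seq symbol * symbol * seq symbol)%type.

Definition tape_read (t : tape) : symbol := t.1.2.

Definition tape_write (a : symbol) (t : tape) : tape := (t.1.1, a, t.2).

Definition tape_move (m : move) (t : tape) : tape :=
  let: (l, a, r) := t in
  match m with
  | MoveLeft => (behead l, head None l, a :: r)
  | MoveRight => (a :: l, head None r, behead r)
  | Stay => t
  end.

Definition blank_tape : tape := ([::], None, [::]).

Definition tape_of_word (w : seq bool) : tape :=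
  if w is b :: w' then ([::], Some b, map Some w') else blank_tape.

(* The bits from the head rightwards up to the first blank. *)
Fixpoint leading_bits (s : seq symbol) : seq bool :=
  if s is Some b :: s' then b :: leading_bits s' else [::].

Definition word_of_tape (t : tape) : seq bool :=
  leading_bits (tape_read t :: t.2).

Record turing_machine := TuringMachine {
  tm_tapes : nat;  (* there are [tm_tapes.+1] tapes *)
  tm_state : finType;
  tm_start : tm_state;
  tm_halt : pred tm_state;
  tm_delta : tm_state -> {ffun 'I_tm_tapes.+1 -> symbol} ->
             tm_state * {ffun 'I_tm_tapes.+1 -> symbol * move} }.

Definition tm_config (M : turing_machine) : Type :=
  (tm_state M * {ffun 'I_(tm_tapes M).+1 -> tape})%type.

(* Tape [ord0] is both the input and the output tape. *)
Definition tm_init (M : turing_machine) (w : seq bool) : tm_config M :=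
  (tm_start M, [ffun i => if i == ord0 then tape_of_word w else blank_tape]).

Definition tm_step (M : turing_machine) (c : tm_config M) : tm_config M :=
  if tm_halt c.1 then c else
  let: (q, act) := tm_delta c.1 [ffun i => tape_read (c.2 i)] in
  (q, [ffun i => tape_move (act i).2 (tape_write (act i).1 (c.2 i))]).

Definition tm_computes_within (M : turing_machine) (w : seq bool) (t : nat)
    (v : seq bool) : Prop :=
  let c := iter t (@tm_step M) (tm_init M w) in
  tm_halt c.1 /\ word_of_tape (c.2 ord0) = v.

Definition computable (f : nat -> nat) : Prop :=
  exists M : turing_machine, forall n : nat, exists t : nat,
    tm_computes_within M (nseq n true) t (nseq (f n) true).

(** * Parameterized problems, fpt-reductions and the W-hierarchy *)

(* As with Flum and Grohe, the parameter is a function of the instance.  A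
   problem given as a language of bit strings has [instance := seq bool] and
   [encode := id]. *)
Record param_problem := ParamProblem {
  instance : Type;
  encode : instance -> seq bool;
  yes : instance -> Prop;
  param : instance -> nat }.

Definition fpt_reducible (P Q : param_problem) : Prop :=
  exists R : instance P -> instance Q,
  [/\ forall x, yes x <-> yes (R x),
      exists M : turing_machine, exists f : nat -> nat, exists c : nat,
        computable f /\
        forall x, exists2 t : nat,
          t <= f (param x) * (size (encode x)).+1 ^ c &
          tm_computes_within M (encode x) t (encode (R x))
    & exists2 g : nat -> nat, computable g &
        forall x, param (R x) <= g (param x)].

(* A circuit lists its nodes in a topological order and a gate refers to its
   in-neighbours by their positions; the output node is the last one. *)
Inductive gate :=
  | Input
  | Not of nat
  | And of seq nat
  | Or of seq nat.

Definition circuit : Type := seq gate.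

Definition is_input (g : gate) : bool := if g is Input then true else false.

Definition gate_args (g : gate) : seq nat :=
  match g with
  | Input => [::]
  | Not i => [:: i]
  | And s | Or s => s
  end.

Definition circuit_wf (C : circuit) : bool :=
  [&& 0 < size C,
      [forall i : 'I_(size C),
         let g := nth Input C i in
         [&& all (fun j => j < i) (gate_args g), uniq (gate_args g)
           & is_input g || (gate_args g != [::])]]
    & [forall i : 'I_(size C), (i.+1 < size C) ==>
         [exists j : 'I_(size C), (i : nat) \in gate_args (nth Input C j)]]].

(* [F s g] is the value of the node [g] standing at position [size s], where
   [s] lists the values of the nodes preceding it. *)
Definition circuit_values (A : Type) (F : seq A -> gate -> A) (C : circuit) :
    seq A :=
  foldl (fun s g => rcons s (F s g)) [::] C.

Definition gate_value (a : nat -> bool) (s : seq bool) (g : gate) : bool :=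
  match g with
  | Input => a (size s)
  | Not i => ~~ nth false s i
  | And l => all (nth false s) l
  | Or l => has (nth false s) l
  end.

Definition circuit_eval (a : nat -> bool) (C : circuit) : bool :=
  last false (circuit_values (gate_value a) C).

Definition assignment_weight (a : nat -> bool) (C : circuit) : nat :=
  #|[set i : 'I_(size C) | is_input (nth Input C i) && a i]|.

(* In a well-formed circuit every node lies on a path to the output node, so
   the maxima over all paths ending at the last node are those defining the
   depth and the weft. *)
Definition gate_depth (s : seq nat) (g : gate) : nat :=
  if is_input g then 0 else (\max_(i <- gate_args g) nth 0 s i).+1.

Definition circuit_depth (C : circuit) : nat :=
  last 0 (circuit_values gate_depth C).

Definition gate_weft (s : seq nat) (g : gate) : nat :=
  (2 < size (gate_args g)) + \max_(i <- gate_args g) nth 0 s i.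

Definition circuit_weft (C : circuit) : nat :=
  last 0 (circuit_values gate_weft C).

(* Unary and self-delimiting.  This is polynomially equivalent to binary here:
   node indices are smaller than the size of the circuit, and a target size
   exceeding the number of nodes or vertices makes the question trivial. *)
Definition encode_nat (n : nat) : seq bool := rcons (nseq n true) false.

Definition encode_seq_nat (s : seq nat) : seq bool :=
  encode_nat (size s) ++ flatten (map encode_nat s).

Definition encode_gate (g : gate) : seq bool :=
  match g with
  | Input => encode_nat 0
  | Not i => encode_nat 1 ++ encode_nat i
  | And l => encode_nat 2 ++ encode_seq_nat l
  | Or l => encode_nat 3 ++ encode_seq_nat l
  end.

Definition encode_circuit (C : circuit) : seq bool :=
  encode_nat (size C) ++ flatten (map encode_gate C).

Record wcs_instance (t d : nat) := WcsInstance {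
  wcs_circuit : circuit;
  wcs_weight : nat;
  _ : circuit_wf wcs_circuit;
  _ : circuit_weft wcs_circuit <= t;
  _ : circuit_depth wcs_circuit <= d }.

(* Weighted circuit satisfiability for circuits of weft at most [t] and depth
   at most [d], parameterized by the weight. *)
Definition weighted_circuit_sat (t d : nat) : param_problem :=
  @ParamProblem (wcs_instance t d)
    (fun x => encode_nat (wcs_weight x) ++ encode_circuit (wcs_circuit x))
    (fun x => exists a : nat -> bool,
       circuit_eval a (wcs_circuit x) /\
       assignment_weight a (wcs_circuit x) = wcs_weight x)
    (fun x => wcs_weight x).

Definition in_W (t : nat) (P : param_problem) : Prop :=
  exists d : nat, fpt_reducible P (weighted_circuit_sat t d).

Definition W_hard (t : nat) (P : param_problem) : Prop :=
  forall Q : param_problem, in_W t Q -> fpt_reducible Q P.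

(** * Graphs *)

Record sgraph (V : finType) := SGraph {
  adj :> rel V;
  adj_sym : symmetric adj;
  adj_irrefl : irreflexive adj }.

Definition open_nbh (V : finType) (G : sgraph V) (S : {set V}) : {set V} :=
  [set v | (v \notin S) && [exists u in S, G u v]].

Definition deg_in (V : finType) (G : sgraph V) (S : {set V}) (v : V) : nat :=
  #|[set u in S | G v u]|.

Definition offensive_alliance (V : finType) (G : sgraph V) (S : {set V}) :
    Prop :=
  S != set0 /\
  forall v, v \in open_nbh G S -> deg_in G (~: S) v + 1 <= deg_in G S v.

Definition induced (V : finType) (G : sgraph V) (A : {set V}) : rel V :=
  [rel u v | [&& u \in A, v \in A & G u v]].

Definition component (V : finType) (G : sgraph V) (A : {set V}) (v : V) :
    {set V} :=
  [set u | connect (induced G A) v u].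

Definition is_tree (V : finType) (G : sgraph V) (A : {set V}) : Prop :=
  [/\ A != set0,
      {in A &, forall u v, connect (induced G A) u v}
    & forall c : seq V, 2 < size c -> ~~ ucycleb (induced G A) c].

(* For a tree [A]: it can be rooted so that every root-to-leaf path has at most
   [h] edges. *)
Definition height_at_most (V : finType) (G : sgraph V) (h : nat)
    (A : {set V}) : Prop :=
  exists2 r, r \in A & forall v, v \in A ->
    exists p : seq V,
      [/\ path (induced G A) r p, last r p = v & size p <= h].

Definition tree_deletion_set (V : finType) (G : sgraph V) (h : nat)
    (D : {set V}) : Prop :=
  forall v, v \in ~: D ->
    is_tree G (component G (~: D) v) /\
    height_at_most G h (component G (~: D) v).

(* [setT] is always such a set, so this is a genuine minimum. *)
Definition tree_deletion_number (V : finType) (G : sgraph V) (h : nat) : nat :=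
  #|[arg min_(D < [set: V] | `[< tree_deletion_set G h D >]) #|D| ]|.

(** * The problem Offensive Alliance *)

Record alliance_instance := AllianceInstance {
  oa_order : nat;
  oa_graph : sgraph 'I_oa_order;
  oa_bound : nat;
  _ : 1 <= oa_bound }.

Definition encode_graph (n : nat) (G : sgraph 'I_n) : seq bool :=
  encode_nat n ++ [seq G u v | u <- enum 'I_n, v <- enum 'I_n].

(* Parameterized by the size of a smallest vertex deletion set into trees of
   height at most [h]. *)
Definition offensive_alliance_problem (h : nat) : param_problem :=
  @ParamProblem alliance_instance
    (fun x => encode_nat (oa_bound x) ++ encode_graph (oa_graph x))
    (fun x => exists S : {set 'I_(oa_order x)},
       offensive_alliance (oa_graph x) S /\ 1 <= #|S| <= oa_bound x)
    (fun x => tree_deletion_number (oa_graph x) h).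

(* Main.v *)
From mathcomp Require Import all_boot all_order all_algebra zify.
From mathcomp Require Import boolp.
Require Import Defs.

(* From a circuit of weft 1, depth at most d and a weight k, one builds in
   polynomial time (k is written in unary) an instance of Offensive Alliance whose
   deletion number is bounded in k.

   Let q > 2 ^ d.  Along the small gates, the output is a Boolean combination of at
   most 2 ^ d atoms, which are inputs or gates of large fan-in.  The number of true
   arguments of such a gate is a sum of functions of at most q inputs, hence a
   polynomial of degree at most q; at the assignment a_1 < ... < a_k its value is
   its Newton expansion, a sum over the increasing tuples tau of at most q indices
   of weights depending only on (a_i), i in tau.  So satisfiability with weight k
   says that one can choose, for each of the (k + 1) ^ q tuples tau, a tuple of
   inputs, subject to linear equations: the chosen tuples are consistent, and the
   weights sum to the numbers of true arguments, which are guessed by the item of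
   the zero tuple and from which the output is computed.

   These equations ask for at most G item vectors, with positive entries, whose sum
   is at least t in each of L coordinates, L depending on k only.  In the graph,
   each item is a tree of height 2 with a centre having many pendant vertices: once
   it meets a small alliance, it costs the same number of vertices, and it
   contributes its vector to the degrees of L common vertices u_i.  A further item
   balances the items that are not chosen, and a tree too expensive to be chosen
   keeps the u_i outside of every small alliance and sets the threshold.  Deleting
   the u_i leaves trees of height 2.

   Polynomial time is obtained from a small language of arithmetic expressions over
   the input word (bounded sums and capped iterations of unary numbers), in which
   every expression compiles to a polynomial-time multi-tape machine. *)

Set Implicit Arguments.
Unset Strict Implicit.
Unset Printing Implicit Defensive.

(** * Stack programs on Turing machines *)

(** Linear equations cannot multiply the values of separately chosen inputs. An item standing for a
    whole tuple carries its Newton coefficient as a constant, which makes the expansion linear in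
    the choice; the price, [k.+1 ^ q] groups, depends on the parameter alone because [q] depends on
    [d] only. An alliance yields only lower bounds at the u_i, so an equation becomes two opposite
    inequalities. A common offset added to every entry makes the entries positive, so that any tree
    of the alliance touches every u_i and activates its condition; as exactly one item per group is
    forced, the offsets contribute a known amount to each sum. The counts are guessed because the
    output is a Boolean, not a linear, function of them: it is checked by the validity of the item
    of the zero tuple. *)

Lemma word_of_tape_push b t :
  word_of_tape (tape_write (Some b) (tape_move MoveLeft t)) = b :: word_of_tape t.
Proof. by case: t => [[l a] r]. Qed.

Lemma word_of_tape_pop b s t :
  word_of_tape t = b :: s -> word_of_tape (tape_move MoveRight t) = s.
Proof.
case: t => [[l [a|]] r] //=; rewrite /word_of_tape /= => -[_ <-].
by case: r.
Qed.

Lemma tape_read_word t : tape_read t = ohead (word_of_tape t).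
Proof. by case: t => [[l [a|]] r]. Qed.

Lemma tape_write_read t : tape_write (tape_read t) t = t.
Proof. by case: t => [[l a] r]. Qed.

(** The number of tapes is a parameter, so that fragments working on the same tapes can be
    composed. *)
Record frag (N : nat) := Frag {
  fr_state : finType;
  fr_start : fr_state;
  fr_halt : pred fr_state;
  fr_delta : fr_state -> {ffun 'I_N.+1 -> symbol} ->
             fr_state * {ffun 'I_N.+1 -> symbol * move} }.

Definition machine N (F : frag N) : turing_machine :=
  @TuringMachine N (fr_state F) (fr_start F) (@fr_halt N F) (@fr_delta N F).

Definition tapes N := {ffun 'I_N.+1 -> tape}.

Definition fstep N (F : frag N) : fr_state F * tapes N -> fr_state F * tapes N :=
  @tm_step (machine F).

Definition reads N (T : tapes N) : {ffun 'I_N.+1 -> symbol} :=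
  [ffun i => tape_read (T i)].

Definition act_on N (act : {ffun 'I_N.+1 -> symbol * move}) (T : tapes N) : tapes N :=
  [ffun i => tape_move (act i).2 (tape_write (act i).1 (T i))].

Definition noop N (rd : {ffun 'I_N.+1 -> symbol}) : {ffun 'I_N.+1 -> symbol * move} :=
  [ffun i => (rd i, Stay)].

Lemma act_noop N (T : tapes N) : act_on (noop (reads T)) T = T.
Proof.
by apply/ffunP => i; rewrite !ffunE /= tape_write_read; case: (T i) => [[]].
Qed.

Lemma fstepE N (F : frag N) q T : fr_halt q = false ->
  fstep (F := F) (q, T) =
  ((fr_delta q (reads T)).1, act_on (fr_delta q (reads T)).2 T).
Proof.
by move=> hq; rewrite /fstep /tm_step /= hq -/(reads T); case: (fr_delta _ _).
Qed.

Lemma fstep_halt N (F : frag N) q T : @fr_halt N F q ->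
  fstep (F := F) (q, T) = (q, T).
Proof. by move=> hq; rewrite /fstep /tm_step /= hq. Qed.

(** Each step of [F] before halting is one step of [G]. Steps that [F] spends idling after it has
    halted are not copied, since [G] may go on from there; hence [t' <= t]. *)
Lemma embed_run N (F G : frag N) (inj : fr_state F -> fr_state G) :
  (forall q, ~~ fr_halt q -> fr_halt (inj q) = false) ->
  (forall q rd, ~~ fr_halt q ->
     fr_delta (inj q) rd = (inj (fr_delta q rd).1, (fr_delta q rd).2)) ->
  forall t q T q' T', iter t (@fstep N F) (q, T) = (q', T') -> fr_halt q' ->
  exists2 t', t' <= t & iter t' (@fstep N G) (inj q, T) = (inj q', T').
Proof.
move=> hh hd; elim=> [|t IH] q T q' T'.
  by move=> [-> ->] _; exists 0.
rewrite iterSr; case hq: (fr_halt q).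
  rewrite fstep_halt // => e h'.
  have [t' le e'] := IH _ _ _ _ e h'.
  by exists t' => //; lia.
rewrite fstepE // => e h'.
have [t' le e'] := IH _ _ _ _ e h'.
exists t'.+1 => //; rewrite iterSr fstepE ?hh ?hq //.
by rewrite hd ?hq //= e'.
Qed.

Definition runs N (F : frag N) (T T' : tapes N) (t : nat) : Prop :=
  exists2 t', t' <= t & exists2 q', fr_halt q' &
    iter t' (@fstep N F) (fr_start F, T) = (q', T').

Definition seq_frag N (F1 F2 : frag N) : frag N :=
  @Frag N (fr_state F1 + fr_state F2)%type (inl (fr_start F1))
    (fun q => if q is inr q2 then fr_halt q2 else false)
    (fun q rd => match q with
     | inl q1 => if fr_halt q1 then (inr (fr_start F2), noop rd)
                 else (inl (fr_delta q1 rd).1, (fr_delta q1 rd).2)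
     | inr q2 => (inr (fr_delta q2 rd).1, (fr_delta q2 rd).2)
     end).

Lemma runs_seq N (F1 F2 : frag N) T T1 T2 t1 t2 :
  runs F1 T T1 t1 -> runs F2 T1 T2 t2 -> runs (seq_frag F1 F2) T T2 (t1 + t2).+1.
Proof.
move=> [s1 le1 [q1 h1 e1]] [s2 le2 [q2 h2 e2]].
have [u1 v1 f1] := @embed_run N F1 (seq_frag F1 F2) inl (fun _ _ => erefl)
  (fun q rd h => ltac:(by rewrite /= (negbTE h))) _ _ _ _ _ e1 h1.
have [u2 v2 f2] := @embed_run N F2 (seq_frag F1 F2) inr
  (fun q h => negbTE h) (fun q rd h => erefl) _ _ _ _ _ e2 h2.
exists (u2 + (1 + u1)); first by lia.
exists (inr q2) => //.
rewrite iterD (iterD 1) f1 /= fstepE //= h1 act_noop; exact: f2.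
Qed.

Definition if_frag N (i : 'I_N.+1) (p : symbol -> bool) (F1 F2 : frag N) : frag N :=
  @Frag N (option (fr_state F1 + fr_state F2)) None
    (fun q => match q with
     | None => false | Some (inl q1) => fr_halt q1 | Some (inr q2) => fr_halt q2 end)
    (fun q rd => match q with
     | None => (Some (if p (rd i) then inl (fr_start F1) else inr (fr_start F2)), noop rd)
     | Some (inl q1) => (Some (inl (fr_delta q1 rd).1), (fr_delta q1 rd).2)
     | Some (inr q2) => (Some (inr (fr_delta q2 rd).1), (fr_delta q2 rd).2)
     end).

Lemma runs_if N (i : 'I_N.+1) (p : symbol -> bool) (F1 F2 : frag N) (T T' : tapes N) t :
  (if p (tape_read (T i)) then runs F1 T T' t else runs F2 T T' t) ->
  runs (if_frag i p F1 F2) T T' t.+1.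
Proof.
case: ifP => hp [s le [q h e]].
  have [u v f] := @embed_run N F1 (if_frag i p F1 F2) (fun q => Some (inl q))
    (fun q h => negbTE h) (fun q rd h => erefl) _ _ _ _ _ e h.
  exists u.+1; [lia | exists (Some (inl q) : fr_state (if_frag i p F1 F2)) => //].
  by rewrite iterSr fstepE //= ffunE hp act_noop.
have [u v f] := @embed_run N F2 (if_frag i p F1 F2) (fun q => Some (inr q))
    (fun q h => negbTE h) (fun q rd h => erefl) _ _ _ _ _ e h.
exists u.+1; [lia | exists (Some (inr q) : fr_state (if_frag i p F1 F2)) => //].
by rewrite iterSr fstepE //= ffunE hp act_noop.
Qed.

(** [None] performs the test, [Some None] is the exit, and [Some (Some q)] runs the body. *)
Definition while_frag N (i : 'I_N.+1) (p : symbol -> bool) (F : frag N) : frag N :=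
  @Frag N (option (option (fr_state F))) None
    (fun q => if q is Some None then true else false)
    (fun q rd => match q with
     | None => (Some (if p (rd i) then Some (fr_start F) else None), noop rd)
     | Some None => (None, noop rd)
     | Some (Some q1) => if fr_halt q1 then (None, noop rd)
                 else (Some (Some (fr_delta q1 rd).1), (fr_delta q1 rd).2)
     end).

Lemma runs_while_done N (i : 'I_N.+1) (p : symbol -> bool) (F : frag N) (T : tapes N) :
  ~~ p (tape_read (T i)) -> runs (while_frag i p F) T T 1.
Proof.
move=> /negbTE hp; exists 1 => //; exists (Some None) => //.
by rewrite /= fstepE //= ffunE hp act_noop.
Qed.

Lemma runs_while_step N (i : 'I_N.+1) (p : symbol -> bool) (F : frag N) (T T1 T2 : tapes N) t1 t2 :
  p (tape_read (T i)) -> runs F T T1 t1 -> runs (while_frag i p F) T1 T2 t2 ->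
  runs (while_frag i p F) T T2 (t1 + t2).+2.
Proof.
move=> hp [s le [q h e]] [s2 le2 [q2 h2 e2]].
have [u v f] := @embed_run N F (while_frag i p F) (fun q => Some (Some q))
  (fun q h => erefl) (fun q rd h => ltac:(by rewrite /= (negbTE h))) _ _ _ _ _ e h.
exists (s2 + (1 + (u + 1))); first by lia.
exists q2 => //.
rewrite iterD (iterD 1) (iterD u).
have -> : iter 1 (@fstep N (while_frag i p F)) (fr_start (while_frag i p F), T) =
          (Some (Some (fr_start F)), T).
  by rewrite /= fstepE //= ffunE hp act_noop.
by rewrite f /= fstepE //= h act_noop.
Qed.

(** A step writes before it moves, so a push takes two steps: move left off the old top, then
    write. *)
Definition push_frag N (i : 'I_N.+1) (b : bool) : frag N :=
  @Frag N (option bool) None (fun q => q == Some true)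
    (fun q rd => match q with
     | None => (Some false, [ffun j => (rd j, if j == i then MoveLeft else Stay)])
     | Some _ => (Some true, [ffun j => (if j == i then Some b else rd j, Stay)])
     end).

Lemma runs_push N (i : 'I_N.+1) b (T : tapes N) :
  runs (push_frag i b) T
    [ffun j => if j == i then tape_write (Some b) (tape_move MoveLeft (T j)) else T j] 2.
Proof.
exists 2 => //; exists (Some true) => //=.
rewrite [fstep (_, T)]fstepE //= fstepE //=; congr (_, _).
apply/ffunP => j; rewrite !ffunE /=.
case: eqP => _ /=; rewrite ?tape_write_read //.
by case: (T j) => [[]].
Qed.

Definition pop_frag N (i : 'I_N.+1) : frag N :=
  @Frag N bool false id
    (fun q rd => (true, [ffun j => (rd j, if j == i then MoveRight else Stay)])).

Lemma runs_pop N (i : 'I_N.+1) (T : tapes N) :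
  runs (pop_frag i) T [ffun j => if j == i then tape_move MoveRight (T j) else T j] 1.
Proof.
exists 1 => //; exists true => //=.
rewrite fstepE //=; congr (_, _).
apply/ffunP => j; rewrite !ffunE /= tape_write_read.
by case: eqP => _; case: (T j) => [[]].
Qed.

(* A tape is used as the stack [word_of_tape]: pushing moves left and then writes,
   popping moves right, and nothing to the left of the head matters. *)
Definition store := nat -> seq bool.

Definition upd A (s : nat -> A) (r : nat) (x : A) : nat -> A :=
  fun j => if j == r then x else s j.

Inductive cmd :=
  | Push of nat & bool
  | Pop of nat
  | Seq of cmd & cmd
  | If of nat & (symbol -> bool) & cmd & cmd
  | While of nat & (symbol -> bool) & cmd.

(** The number is an upper bound on the machine steps. [EPop] demands a nonempty stack: beyond a
    blank the tape may hold symbols that do not belong to the stack, and moving there would expose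
    them. *)
Inductive exec : cmd -> store -> store -> nat -> Prop :=
  | EPush r b s : exec (Push r b) s (upd s r (b :: s r)) 2
  | EPop r b w s : s r = b :: w -> exec (Pop r) s (upd s r w) 1
  | ESeq c1 c2 s s1 s2 t1 t2 : exec c1 s s1 t1 -> exec c2 s1 s2 t2 ->
      exec (Seq c1 c2) s s2 (t1 + t2).+1
  | EIf r (p : symbol -> bool) c1 c2 s s' t :
      exec (if p (ohead (s r)) then c1 else c2) s s' t ->
      exec (If r p c1 c2) s s' t.+1
  | EWhileDone r (p : symbol -> bool) c s : ~~ p (ohead (s r)) -> exec (While r p c) s s 1
  | EWhileStep r (p : symbol -> bool) c s s1 s2 t1 t2 : p (ohead (s r)) -> exec c s s1 t1 ->
      exec (While r p c) s1 s2 t2 -> exec (While r p c) s s2 (t1 + t2).+2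
  | EWeak c s s' t t' : exec c s s' t -> t <= t' -> exec c s s' t'.

Fixpoint max_reg (c : cmd) : nat :=
  match c with
  | Push r _ | Pop r => r
  | Seq c1 c2 => maxn (max_reg c1) (max_reg c2)
  | If r _ c1 c2 => maxn r (maxn (max_reg c1) (max_reg c2))
  | While r _ c => maxn r (max_reg c)
  end.

Section Compile.
Variables (N m : nat) (tp : nat -> 'I_N.+1).
Hypothesis tp_inj : forall i j, i <= m -> j <= m -> tp i = tp j -> i = j.

Definition rep (s : store) (T : tapes N) :=
  forall j, j <= m -> word_of_tape (T (tp j)) = s j.

Definition sound (c : cmd) (F : frag N) :=
  forall s s' t, exec c s s' t -> forall T, rep s T ->
  exists2 T', rep s' T' & runs F T T' t.

Lemma runs_weak (F : frag N) T T' t t' : runs F T T' t -> t <= t' -> runs F T T' t'.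
Proof. by case=> u le h le'; exists u => //; lia. Qed.

Lemma tp_eq i j : i <= m -> j <= m -> (tp i == tp j) = (i == j).
Proof. by move=> hi hj; apply/eqP/eqP => [|->] //; exact: tp_inj. Qed.

(** Induction on the derivation rather than inversion, as uses of [EWeak] may be nested. *)
Lemma sound_push r b : r <= m -> sound (Push r b) (push_frag (tp r) b).
Proof.
move=> hr s s' t.
move ec: (Push r b) => c ex.
elim: ex ec => {c s s' t} //.
  move=> _ _ s [<- <-] T h.
  exists [ffun j => if j == tp r then tape_write (Some b) (tape_move MoveLeft (T j)) else T j];
    last exact: runs_push.
  move=> j hj; rewrite ffunE /upd tp_eq //; case: eqP => [->|_]; last exact: h.
  by rewrite word_of_tape_push h.
move=> c s s' t t' _ IH le ec T h; have [T' h' r'] := IH ec T h.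
by exists T' => //; apply: runs_weak r' le.
Qed.

Lemma sound_pop r : r <= m -> sound (Pop r) (pop_frag (tp r)).
Proof.
move=> hr s s' t.
move ec: (Pop r) => c ex.
elim: ex ec => {c s s' t} //.
  move=> r0 b w s e [er] T h; subst r0.
  exists [ffun j => if j == tp r then tape_move MoveRight (T j) else T j];
    last exact: runs_pop.
  move=> j hj; rewrite ffunE /upd tp_eq //; case: eqP => [->|_]; last exact: h.
  by rewrite (@word_of_tape_pop b w) // h.
move=> c s s' t t' _ IH le ec T h; have [T' h' r'] := IH ec T h.
by exists T' => //; apply: runs_weak r' le.
Qed.

Lemma sound_seq c1 c2 F1 F2 : sound c1 F1 -> sound c2 F2 ->
  sound (Seq c1 c2) (seq_frag F1 F2).
Proof.
move=> S1 S2 s s' t.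
move ec: (Seq c1 c2) => c ex.
elim: ex ec => {c s s' t} //.
  move=> c1' c2' s s1 s2 t1 t2 e1 _ e2 _ [? ?] T h; subst c1' c2'.
  have [T1 h1 r1] := S1 _ _ _ e1 T h; have [T2 h2 r2] := S2 _ _ _ e2 T1 h1.
  by exists T2 => //; apply: runs_seq r1 r2.
move=> c s s' t t' _ IH le ec T h; have [T' h' r'] := IH ec T h.
by exists T' => //; apply: runs_weak r' le.
Qed.

Lemma sound_if r p c1 c2 F1 F2 : r <= m -> sound c1 F1 -> sound c2 F2 ->
  sound (If r p c1 c2) (if_frag (tp r) p F1 F2).
Proof.
move=> hr S1 S2 s s' t.
move ec: (If r p c1 c2) => c ex.
elim: ex ec => {c s s' t} //.
  move=> r' p' c1' c2' s s' t ex _ [? ? ? ?] T h; subst r' p' c1' c2'.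
  have : exists2 T', rep s' T' & if p (ohead (s r)) then runs F1 T T' t else runs F2 T T' t.
    by case: ifP ex => _ ex; [apply: S1 ex _ h | apply: S2 ex _ h].
  case=> T' h' rr; exists T' => //; apply: runs_if.
  by rewrite tape_read_word h.
move=> c s s' t t' _ IH le ec T h; have [T' h' r'] := IH ec T h.
by exists T' => //; apply: runs_weak r' le.
Qed.

Lemma sound_while r p c1 F1 : r <= m -> sound c1 F1 ->
  sound (While r p c1) (while_frag (tp r) p F1).
Proof.
move=> hr S1 s s' t.
move ec: (While r p c1) => c ex.
elim: ex ec => {c s s' t} //.
- move=> r' p' c' s np [? ? ?] T h; subst r' p' c'; exists T => //.
  by apply: runs_while_done; rewrite tape_read_word h.
- move=> r' p' c' s s1 s2 t1 t2 hp e1 _ _ IH [? ? ?] T h; subst r' p' c'.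
  have [T1 h1 r1] := S1 _ _ _ e1 T h; have [T2 h2 r2] := IH erefl T1 h1.
  exists T2 => //; apply: runs_while_step r1 r2.
  by rewrite tape_read_word h.
move=> c s s' t t' _ IH le ec T h; have [T' h' r'] := IH ec T h.
by exists T' => //; apply: runs_weak r' le.
Qed.

Lemma compile_sound c : max_reg c <= m -> exists F, sound c F.
Proof.
elim: c => [r b|r|c1 IH1 c2 IH2|r p c1 IH1 c2 IH2|r p c1 IH1] /=;
  rewrite ?geq_max.
- by move=> h; exists (push_frag (tp r) b); exact: sound_push.
- by move=> h; exists (pop_frag (tp r)); exact: sound_pop.
- case/andP=> /IH1 [F1 S1] /IH2 [F2 S2].
  by exists (seq_frag F1 F2); exact: sound_seq.
- case/and3P=> h /IH1 [F1 S1] /IH2 [F2 S2].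
  by exists (if_frag (tp r) p F1 F2); exact: sound_if.
- case/andP=> h /IH1 [F1 S1].
  by exists (while_frag (tp r) p F1); exact: sound_while.
Qed.

End Compile.

(** * Adding blank tapes to a machine *)

Section Widen.
Variables (M : turing_machine) (m : nat).
Let n := tm_tapes M.

Definition widen_frag : frag (n + m) :=
  @Frag (n + m) (tm_state M) (tm_start M) (@tm_halt M)
    (fun q rd =>
       let r := tm_delta q [ffun i : 'I_n.+1 => rd (lshift m i)] in
       (r.1, [ffun i : 'I_(n.+1 + m) =>
                match split i with inl j => r.2 j | inr _ => (rd i, Stay) end])).

Definition widen_tapes (T : tapes n) : tapes (n + m) :=
  [ffun i : 'I_(n.+1 + m) => match split i with inl j => T j | inr _ => blank_tape end].

Lemma widen_step q T :
  fstep (F := widen_frag) (q, widen_tapes T) =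
  ((tm_step ((q, T) : tm_config M)).1, widen_tapes (tm_step ((q, T) : tm_config M)).2).
Proof.
rewrite /tm_step /=; case hq: (tm_halt q); first by rewrite fstep_halt.
rewrite fstepE //=.
have -> : [ffun i : 'I_n.+1 => reads (widen_tapes T) (lshift m i)] =
          [ffun i => tape_read (T i)].
  apply/ffunP => i; rewrite !ffunE.
  by case: split_ordP => j /eqP; rewrite ?eq_lshift ?eq_lrshift // => /eqP ->.
case: (tm_delta q _) => q' a /=; congr (_, _).
apply/ffunP => i; rewrite !ffunE.
by case: split_ordP => j e //; rewrite ffunE; case: (T j) => [[]]; case: (a j) => ? [] .
Qed.

Lemma widen_iter t q T :
  iter t (@fstep _ widen_frag) (q, widen_tapes T) =
  ((iter t (@tm_step M) (q, T)).1, widen_tapes (iter t (@tm_step M) (q, T)).2).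
Proof.
elim: t => //= t ->; rewrite widen_step.
by case: (iter _ _ _).
Qed.

End Widen.

Definition only_word (v : seq bool) : store := fun j => if j is 0 then v else [::].

(** Register 0 is the output tape of [M1] and the other registers are fresh blank tapes. What [M1]
    leaves on its remaining tapes is never looked at. *)
Lemma run_after (M1 : turing_machine) (c : cmd) :
  exists M : turing_machine, forall w t1 v, tm_computes_within M1 w t1 v ->
  forall s' t, exec c (only_word v) s' t ->
  tm_computes_within M w (t1 + t).+1 (s' 0).
Proof.
set m := max_reg c; set n := tm_tapes M1.
pose tp (j : nat) : 'I_(n + m).+1 := if j is 0 then ord0 else inord (n + j).
have tp_val j : j <= m -> tp j = (if j == 0 then 0 else n + j) :> nat.
  by case: j => // j hj; rewrite /= inordK //; lia.
have tp_inj i j : i <= m -> j <= m -> tp i = tp j -> i = j.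
  move=> hi hj /(congr1 val) /=; rewrite !tp_val //.
  by case: eqP; case: eqP; lia.
have [F2 S2] := compile_sound tp_inj (leqnn m).
pose M := machine (seq_frag (widen_frag M1 m) F2); exists M => w t1 v [h1 e1] s' t ex.
set c1 := iter t1 _ _ in h1 e1.
have w0 : (tm_init M w).2 = widen_tapes m (tm_init M1 w).2.
  apply/ffunP => i; rewrite !ffunE /=.
  case: split_ordP => j e.
    rewrite ffunE; congr (if _ then _ else _).
    by rewrite e -!(inj_eq val_inj).
  by rewrite e -(inj_eq val_inj).
have r1 : runs (widen_frag M1 m) (tm_init M w).2 (widen_tapes m c1.2) t1.
  exists t1 => //; exists c1.1 => //.
  by rewrite w0 widen_iter; rewrite /c1 /tm_init.
have rp : rep m tp (only_word v) (widen_tapes m c1.2).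
  move=> j hj; rewrite ffunE.
  case: split_ordP => i e; move: (tp_val j hj); rewrite e /=.
    case: j {e} hj => [|j] hj /= ei; last first.
      by have := ltn_ord i; rewrite -/n ei ltnS -{2}[n]addn0 leq_add2l.
    have -> : i = ord0 by apply: val_inj.
    exact: e1.
  by case: j {e} hj => [|j].
have [T' rT r2] := S2 _ _ _ ex _ rp.
have [u le [q hq eq]] := runs_seq r1 r2.
(* [tm_computes_within] speaks of the configuration after exactly the given number of steps; a
   halted configuration is stable, so the overestimate is harmless. *)
have hit : forall a, u <= a -> iter a (@tm_step M) (tm_init M w) = (q, T').
  move=> a le'; rewrite -(subnK le') iterD.
  rewrite (_ : iter u _ _ = (q, T')); last exact: eq.
  by elim: (a - u) => //= b ->; exact: (@fstep_halt _ (seq_frag (widen_frag M1 m) F2)).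
rewrite /tm_computes_within hit //=; split => //.
by have := rT 0 isT.
Qed.

Definition tape_size (t : tape) := size t.1.1 + size t.2.

Lemma word_of_tape_size t : size (word_of_tape t) <= (tape_size t).+1.
Proof.
have lb s : size (leading_bits s) <= size s by elim: s => [|[b|] s IH].
case: t => [[l a] r]; rewrite /word_of_tape /tape_size /=.
case: a => // b /=; have := lb r; lia.
Qed.

(** A step lengthens the listed part of a tape by at most one cell. *)
Lemma computes_size M w t v : tm_computes_within M w t v ->
  size v <= size w + t + 1.
Proof.
case=> _ <-; set cf := iter _ _ _.
have H : forall i, tape_size (cf.2 i) <= size w + t.
  rewrite /cf; elim: t {cf} => [|t IH] i /=.
    rewrite /tm_init ffunE; case: eqP => // _; case: (w) => //= b s.
    by rewrite /tape_size /= size_map; lia.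
  rewrite /tm_step; case: ifP => _; first by apply: (leq_trans (IH i)); rewrite addnS.
  case: (tm_delta _ _) => q a; rewrite ffunE.
  have := IH i; set T := (X in tape_size X) => hT.
  rewrite -[X in tape_write _ X]/T.
  by move: T hT => [[l b] r]; case: (a i) => x [] /=;
    rewrite /tape_size /= ?size_behead; lia.
have := H ord0; have := word_of_tape_size (cf.2 ord0); lia.
Qed.

(** * Arithmetic expressions and their compilation *)

(* Environments are lists, the innermost variable first; [EWk] skips it.  [ESum] and
   [EIter] bind one variable; capping the values of [EIter] keeps all expressions
   polynomially bounded. *)
Inductive expr :=
  | EConst of nat
  | EHead
  | EWk of expr
  | ELen
  | EBit of expr
  | EAdd of expr & expr
  | ESub of expr & expr
  | ESum of expr & expr
  | EIter of expr & expr & expr & expr.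

Fixpoint ev (e : expr) (v : seq bool) (s : seq nat) : nat :=
  match e with
  | EConst n => n
  | EHead => head 0 s
  | EWk e => ev e v (behead s)
  | ELen => size v
  | EBit e => nth false v (ev e v s)
  | EAdd e1 e2 => ev e1 v s + ev e2 v s
  | ESub e1 e2 => ev e1 v s - ev e2 v s
  | ESum e1 e2 => \sum_(0 <= j < ev e1 v s) ev e2 v (j :: s)
  | EIter e1 e2 e3 e4 =>
      iter (ev e1 v s) (fun x => minn (ev e2 v s) (ev e4 v (x :: s))) (ev e3 v s)
  end.

(* Registers: the output, the unread part of the input, its part already read in
   reverse order, and numbers in unary. *)
Definition st (o v w : seq bool) (rho : nat -> nat) : store := fun r =>
  match r with 0 => o | 1 => v | 2 => w | r.+3 => nseq (rho r) true end.

Lemma exec_eq c s s' t s1 s1' t1 :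
  exec c s s' t -> s = s1 -> s' = s1' -> t <= t1 -> exec c s1 s1' t1.
Proof. by move=> h <- <- le; apply: EWeak h le. Qed.

Definition skip := While 0 (fun _ => false) (Pop 0).

Lemma exec_skip s : exec skip s s 1.
Proof. exact: EWhileDone. Qed.

Definition nonempty (a : symbol) : bool := isSome a.

Definition loop r body := While r nonempty (Seq (Pop r) body).

(** [S j] is the store at the start of round [j]. The counter is popped before the body runs, hence
    [n - j.+1]; the 4 extra steps pay for the pop, the sequencing and the test. *)
Lemma exec_loop r body (S : nat -> store) n T :
  (forall j, j <= n -> S j r = nseq (n - j) true) ->
  (forall j, j < n -> exec body (upd (S j) r (nseq (n - j.+1) true)) (S j.+1) T) ->
  exec (loop r body) (S 0) (S n) (n * (T + 4) + 1).
Proof.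
move=> h1 h2.
have H k : k <= n -> exec (loop r body) (S (n - k)) (S n) (k * (T + 4) + 1).
  elim: k => [|k IH] le.
    by rewrite subn0; apply: EWhileDone; rewrite h1 // subnn.
  apply: (@EWeak _ _ _ ((1 + T).+1 + (k * (T + 4) + 1)).+2); last by lia.
  apply: EWhileStep (IH (ltnW le)); first by rewrite h1 ?leq_subr // subKn.
  apply: ESeq.
    by apply: (@EPop _ true (nseq k true)); rewrite h1 ?leq_subr // subKn.
  have := h2 (n - k.+1); rewrite -subSn // subSS subKn ?(ltnW le) //; apply; lia.
by have := H n (leqnn n); rewrite subnn.
Qed.

Definition inc a := Push a.+3 true.
Definition dec a := Pop a.+3.

Lemma st_upd o v w rho a x :
  upd (st o v w rho) a.+3 (nseq x true) = st o v w (upd rho a x).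
Proof.
by apply/funext => -[|[|[|j]]] //; rewrite /upd /= !eqSS; case: eqP.
Qed.

Lemma exec_inc o v w rho a :
  exec (inc a) (st o v w rho) (st o v w (upd rho a (rho a).+1)) 2.
Proof. by rewrite -st_upd; exact: EPush. Qed.

Lemma exec_dec o v w rho a : 0 < rho a ->
  exec (dec a) (st o v w rho) (st o v w (upd rho a (rho a).-1)) 1.
Proof. by move=> h; rewrite -st_upd; apply: (@EPop _ true); rewrite /=; case: (rho a) h. Qed.

Lemma exec_loop_env o v w a body (E : nat -> nat -> nat) n T :
  (forall j, j <= n -> E j a = n - j) ->
  (forall j, j < n ->
     exec body (st o v w (upd (E j) a (n - j.+1))) (st o v w (E j.+1)) T) ->
  exec (loop a.+3 body) (st o v w (E 0)) (st o v w (E n)) (n * (T + 4) + 1).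
Proof.
move=> h1 h2; apply: (@exec_loop _ _ (fun j => st o v w (E j))) => j hj.
  by rewrite /= h1.
by rewrite st_upd; exact: h2.
Qed.

Ltac st_eq := apply: (f_equal (st _ _ _)); apply/funext => ?; rewrite /upd;
  repeat (case: eqP => ? //=; try subst); try lia.

Lemma exec_clear o v w rho a :
  exec (loop a.+3 skip) (st o v w rho) (st o v w (upd rho a 0)) (rho a * 5 + 1).
Proof.
apply: (exec_eq (@exec_loop_env o v w a skip (fun j => upd rho a (rho a - j)) (rho a) 1 _ _)).
- by move=> j hj; rewrite /upd eqxx.
- by move=> j hj; apply: (exec_eq (exec_skip _)) => //; st_eq.
- by st_eq.
- by st_eq.
- by lia.
Qed.

Definition move_add x y := loop x.+3 (inc y).

Lemma exec_move_add o v w rho x y : x != y ->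
  exec (move_add x y) (st o v w rho) (st o v w (upd (upd rho y (rho y + rho x)) x 0))
    (rho x * 6 + 1).
Proof.
move=> /eqP nxy.
apply: (exec_eq (@exec_loop_env o v w x (inc y)
  (fun j => upd (upd rho y (rho y + j)) x (rho x - j)) (rho x) 2 _ _)).
- by move=> j hj; rewrite /upd eqxx.
- by move=> j hj; apply: (exec_eq (exec_inc _ _ _ _ _)) => //; st_eq.
- by st_eq.
- by st_eq.
- by lia.
Qed.

(** Reading a unary register empties it; [z] keeps a second copy that is moved back. *)
Definition copy x y z := Seq (loop x.+3 (Seq (inc y) (inc z))) (move_add z x).

Lemma exec_copy o v w rho x y z : x != y -> x != z -> y != z -> rho z = 0 ->
  exec (copy x y z) (st o v w rho) (st o v w (upd rho y (rho y + rho x)))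
    (rho x * 20 + 3).
Proof.
move=> /eqP nxy /eqP nxz /eqP nyz z0.
apply: (@EWeak _ _ _ (((rho x) * 9 + 1) + ((rho x) * 6 + 1)).+1); last by lia.
apply: ESeq.
  apply: (exec_eq (@exec_loop_env o v w x (Seq (inc y) (inc z))
    (fun j => upd (upd (upd rho y (rho y + j)) z j) x (rho x - j)) (rho x) 5 _ _)).
  - by move=> j hj; rewrite /upd eqxx.
  - move=> j hj; apply: (exec_eq (ESeq (exec_inc _ _ _ _ _) (exec_inc _ _ _ _ _))) => //.
    by st_eq.
  - by st_eq.
  - reflexivity.
  - by [].
apply: (exec_eq (exec_move_add _ _ _ _ _)); first by apply/eqP => e; subst.
- by [].
- by st_eq.
- by rewrite /upd; repeat (case: eqP => ? //=; try subst); lia.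
Qed.

Definition is_true_symbol (a : symbol) : bool := a == Some true.

Definition shift_bit x y :=
  If x is_true_symbol (Seq (Pop x) (Push y true)) (Seq (Pop x) (Push y false)).

Lemma exec_shift_bit x y s b w : s x = b :: w ->
  exec (shift_bit x y) s (upd (upd s x w) y (b :: upd s x w y)) 5.
Proof.
move=> e; apply: (@EIf _ _ _ _ _ _ 4); rewrite e.
by case: b e => e; apply: ESeq (EPop e) (EPush _ _ _).
Qed.

Lemma exec_shift12 o b v w rho :
  exec (shift_bit 1 2) (st o (b :: v) w rho) (st o v (b :: w) rho) 5.
Proof.
apply: (exec_eq (@exec_shift_bit 1 2 (st o (b :: v) w rho) b v erefl)) => //.
by apply/funext => -[|[|[|j]]].
Qed.

Lemma exec_shift21 o b v w rho :
  exec (shift_bit 2 1) (st o v (b :: w) rho) (st o (b :: v) w rho) 5.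
Proof.
apply: (exec_eq (@exec_shift_bit 2 1 (st o v (b :: w) rho) b w erefl)) => //.
by apply/funext => -[|[|[|j]]].
Qed.

Definition restore := While 2 nonempty (shift_bit 2 1).

Lemma exec_restore o v w rho :
  exec restore (st o v w rho) (st o (catrev w v) [::] rho) (size w * 7 + 1).
Proof.
elim: w v => [|b w IH] v; first by apply: EWhileDone.
apply: (@EWeak _ _ _ (5 + (size w * 7 + 1)).+2); last by rewrite /=; lia.
exact: EWhileStep (exec_shift21 _ _ _ _ _) (IH _).
Qed.

Definition len_prog a :=
  Seq (While 1 nonempty (Seq (shift_bit 1 2) (inc a))) restore.

Lemma exec_len o v rho a :
  exec (len_prog a) (st o v [::] rho) (st o v [::] (upd rho a (rho a + size v)))
    (size v * 17 + 3).
Proof.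
have H : forall v w rho,
  exec (While 1 nonempty (Seq (shift_bit 1 2) (inc a))) (st o v w rho)
   (st o [::] (catrev v w) (upd rho a (rho a + size v))) (size v * 10 + 1).
  elim=> [|b {}v IH] w {}rho.
    rewrite /= addn0 (_ : upd rho a (rho a) = rho); last first.
      by apply/funext => i; rewrite /upd; case: eqP => [->|].
    exact: EWhileDone.
  apply: (@EWeak _ _ _ (8 + (size v * 10 + 1)).+2); last by rewrite /=; lia.
  apply: EWhileStep => //.
    exact: ESeq (exec_shift12 _ _ _ _ _) (exec_inc _ _ _ _ _).
  by apply: (exec_eq (IH _ _)) => //; rewrite /=; st_eq.
apply: (exec_eq (ESeq (H v [::] rho) (exec_restore _ _ _ _))) => //.
  by rewrite -[catrev v [::]]/(rev v) -/(rev (rev v)) revK.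
rewrite size_rev; lia.
Qed.

(** The input is shifted until the wanted bit is on top, then rebuilt. A position past the end meets
    an empty stack, which counts as [false]. *)
Definition bit_prog a :=
  Seq (loop a.+3 (If 1 nonempty (shift_bit 1 2) skip))
  (Seq (If 1 is_true_symbol (inc a) skip) restore).

Lemma exec_bit o v rho a :
  exec (bit_prog a) (st o v [::] rho)
    (st o v [::] (upd rho a (nth false v (rho a)))) (rho a * 17 + 8).
Proof.
set n := rho a.
have cr w1 w2 : catrev (rev w1) w2 = w1 ++ w2 by rewrite catrevE revK.
apply: (@EWeak _ _ _ ((n * 10 + 1) + (3 + (size (rev (take n v)) * 7 + 1)).+1).+1); last first.
  by rewrite size_rev size_take -/n; move: (n) => m; case: (ltnP m (size v)) => ?; lia.
apply: (@ESeq _ _ _ (st o (drop n v) (rev (take n v)) (upd rho a 0))).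
  apply: (exec_eq (@exec_loop _ _ (fun j => st o (drop j v) (rev (take j v))
     (upd rho a (n - j))) n 6 _ _)).
  - by move=> j hj; rewrite /= /upd eqxx.
  - move=> j hj; rewrite st_upd; apply: EIf => /=.
    have -> : (upd (upd rho a (n - j)) a (n - j.+1)) = upd rho a (n - j.+1).
      by apply/funext => i; rewrite /upd; case: eqP.
    case: (ltnP j (size v)) => hs.
      rewrite (drop_nth false) //= (take_nth false) // rev_rcons.
      exact: exec_shift12.
    rewrite !drop_oversize ?take_oversize //=; try lia.
    by apply: EWeak (exec_skip _) _.
  - rewrite drop0 take0 subn0; st_eq.
  - by rewrite subnn.
  - lia.
apply: (@ESeq _ _ _ (st o (drop n v) (rev (take n v)) (upd rho a (nth false v n)))).
  apply: EIf => /=.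
  case: (ltnP n (size v)) => hs; last first.
    rewrite nth_default // drop_oversize //=.
    by apply: EWeak (exec_skip _) _.
  rewrite (drop_nth false) //=; case: (nth false v n) => /=.
    apply: (exec_eq (exec_inc _ _ _ _ _)) => //; st_eq.
  by apply: EWeak (exec_skip _) _.
by apply: (exec_eq (exec_restore _ _ _ _)) => //; rewrite cr cat_take_drop.
Qed.

(** The added 2 makes this a base of at least 2, so that constant factors are absorbed by the
    exponent and a single exponent can bound both value and time. *)
Definition insize (v : seq bool) (s : seq nat) := size v + sumn s + 2.

(* The variables of [e] live in the registers [locs], registers from [a] on are free,
   and the value of [e] is left in [a]. *)
Definition poly_ok (e : expr) (c : nat) : Prop :=
  (forall v s, ev e v s <= insize v s ^ c) /\
  (forall locs a, all (fun l => l < a) locs -> exists p, forall o v rho,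
     (forall j, a <= j -> rho j = 0) ->
     exec p (st o v [::] rho) (st o v [::] (upd rho a (ev e v (map rho locs))))
       (insize v (map rho locs) ^ c)).

Lemma insize_ge2 v s : 2 <= insize v s.
Proof. by rewrite /insize; lia. Qed.

Lemma insize_exp_gt0 v s c : 0 < insize v s ^ c.
Proof. by rewrite expn_gt0; have := insize_ge2 v s; case: (insize v s). Qed.

Lemma leq_mul_exp M K C : 2 <= M -> K * M ^ C <= M ^ (C + K).
Proof.
move=> hM; rewrite expnD mulnC leq_mul2l; apply/orP; right.
apply: ltnW; apply: leq_trans (ltn_expl K (isT : 1 < 2)) _.
by case: K => [|K]; [rewrite !expn0 | rewrite leq_exp2r].
Qed.

Lemma leq_exp_r M a b : 2 <= M -> a <= b -> M ^ a <= M ^ b.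
Proof. by move=> hM hab; rewrite leq_exp2l. Qed.

Lemma poly_ok_mono e c c' : c <= c' -> poly_ok e c -> poly_ok e c'.
Proof.
move=> le [h1 h2]; split=> [v s|locs a hl].
  by apply: leq_trans (h1 v s) _; apply: leq_exp_r => //; exact: insize_ge2.
have [p hp] := h2 locs a hl; exists p => o v rho h0.
by apply: EWeak (hp o v rho h0) _; apply: leq_exp_r => //; exact: insize_ge2.
Qed.

Lemma map_upd (rho : nat -> nat) a x (locs : seq nat) : all (fun l => l < a) locs ->
  map (upd rho a x) locs = map rho locs.
Proof.
move=> /allP h; apply/eq_in_map => l /h hl.
by rewrite /upd; case: eqP hl => // ->; rewrite ltnn.
Qed.

Lemma upd_same (A : Type) (rho : nat -> A) a x : upd rho a x a = x.
Proof. by rewrite /upd eqxx. Qed.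

Lemma upd_upd (A : Type) (rho : nat -> A) a x y : upd (upd rho a x) a y = upd rho a y.
Proof. by apply/funext => j; rewrite /upd; case: eqP. Qed.

Lemma all_lt_weak a b (locs : seq nat) : a <= b -> all (fun l => l < a) locs ->
  all (fun l => l < b) locs.
Proof. by move=> le; apply: sub_all => l; lia. Qed.

Lemma poly_const n : exists c, poly_ok (EConst n) c.
Proof.
exists (0 + (n * 3 + 1)); split=> [v s|locs a hl].
  apply: leq_trans (leq_mul_exp _ _ (insize_ge2 v s)); rewrite expn0 /=; lia.
suff [p hp] : exists p, forall o v rho, exec p (st o v [::] rho)
    (st o v [::] (upd rho a (rho a + n))) (n * 3 + 1).
  exists p => o v rho h0; apply: (exec_eq (hp o v rho)) => //.
    by rewrite /= h0.
  by apply: leq_trans (leq_mul_exp _ _ (insize_ge2 _ _)); rewrite expn0 muln1.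
elim: n => [|n [p hp]].
  exists skip => o v rho; apply: (exec_eq (exec_skip _)) => //; st_eq.
exists (Seq p (inc a)) => o v rho.
apply: (exec_eq (ESeq (hp o v rho) (exec_inc _ _ _ _ _))) => //; last by lia.
st_eq.
Qed.

Lemma poly_head : exists c, poly_ok EHead c.
Proof.
exists (1 + 20); split=> [v s|locs a hl].
  apply: leq_trans (leq_mul_exp _ _ (insize_ge2 v s)); rewrite expn1 /insize /=.
  by case: s => //= x s; lia.
case: locs hl => [_|l locs /= /andP[hl _]].
  exists skip => o v rho h0.
  apply: (exec_eq (exec_skip _)) => //=; first by st_eq; rewrite h0.
  exact: insize_exp_gt0.
exists (copy l a a.+1) => o v rho h0.
have n1 : l != a by lia.
have n2 : l != a.+1 by lia.
have n3 : a != a.+1 by lia.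
apply: (exec_eq (exec_copy o v [::] n1 n2 n3 (h0 _ (leqnSn a)))) => //.
  by rewrite (h0 a).
apply: leq_trans (leq_mul_exp _ _ (insize_ge2 _ _)).
rewrite expn1 /insize /=; lia.
Qed.

Lemma poly_wk e : (exists c, poly_ok e c) -> exists c, poly_ok (EWk e) c.
Proof.
have le v s : insize v (behead s) <= insize v s by rewrite /insize; case: s => //= x s; lia.
have lec v s c : insize v (behead s) ^ c <= insize v s ^ c.
  by case: c => // c; rewrite leq_exp2r.
move=> [c [h1 h2]]; exists c; split=> [v s|locs a hl].
  exact: leq_trans (h1 v (behead s)) _.
have [p hp] := h2 (behead locs) a (ltac:(by case: (locs) hl => //= x l /andP[])).
exists p => o v rho h0.
by apply: (exec_eq (hp o v rho h0)); rewrite //= -behead_map.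
Qed.

Lemma poly_len : exists c, poly_ok ELen c.
Proof.
exists (1 + 17); split=> [v s|locs a hl].
  apply: leq_trans (leq_mul_exp _ _ (insize_ge2 v s)); rewrite expn1 /insize /=; lia.
exists (len_prog a) => o v rho h0.
apply: (exec_eq (exec_len _ _ _ _)) => //=; first by rewrite h0.
apply: leq_trans (leq_mul_exp _ _ (insize_ge2 _ _)).
rewrite expn1 /insize /=; lia.
Qed.

Lemma poly_bit e : (exists c, poly_ok e c) -> exists c, poly_ok (EBit e) c.
Proof.
move=> [c [h1 h2]]; exists (c + 40); split=> [v s|locs a hl].
  by apply: leq_trans (insize_exp_gt0 _ _ _); rewrite /=; case: (nth _ _ _).
have [p hp] := h2 locs a hl; exists (Seq p (bit_prog a)) => o v rho h0.
apply: (exec_eq (ESeq (hp o v rho h0) (exec_bit _ _ _ _))) => //.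
  by rewrite upd_same upd_upd.
rewrite upd_same.
apply: leq_trans (leq_mul_exp _ _ (insize_ge2 _ _)).
have := h1 v (map rho locs); have := insize_exp_gt0 v (map rho locs) c.
set X := _ ^ c; lia.
Qed.

Lemma poly_add e1 e2 : (exists c, poly_ok e1 c) -> (exists c, poly_ok e2 c) ->
  exists c, poly_ok (EAdd e1 e2) c.
Proof.
move=> [c1 k1] [c2 k2].
have [h1 h2] := poly_ok_mono (leq_maxl c1 c2) k1.
have [g1 g2] := poly_ok_mono (leq_maxr c1 c2) k2.
set c := maxn c1 c2 in h1 h2 g1 g2.
exists (c + 20); split=> [v s|locs a hl].
  apply: leq_trans (leq_mul_exp _ _ (insize_ge2 _ _)) => /=.
  by have := h1 v s; have := g1 v s; lia.
have [p1 hp1] := h2 locs a hl.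
have [p2 hp2] := g2 locs a.+1 (all_lt_weak (leqnSn a) hl).
exists (Seq (Seq p1 p2) (move_add a.+1 a)) => o v rho h0.
have h0' x j : a.+1 <= j -> upd rho a x j = 0.
  by move=> hj; rewrite /upd; case: eqP => [e|_]; [lia|apply: h0; lia].
apply: (exec_eq (ESeq (ESeq (hp1 o v rho h0) (hp2 o v _ (h0' _)))
  (exec_move_add _ _ _ _ (negbT (gtn_eqF (ltnSn a)))))) => //.
  rewrite /= !map_upd //. st_eq; rewrite h0 //; lia.
rewrite !map_upd // upd_same.
apply: leq_trans (leq_mul_exp _ _ (insize_ge2 _ _)).
have := g1 v (map rho locs); have := insize_exp_gt0 v (map rho locs) c.
set X := _ ^ c; lia.
Qed.

Lemma exec_sub_loop o v w rho a :
  exec (loop a.+4 (If a.+3 nonempty (dec a) skip)) (st o v w rho)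
    (st o v w (upd (upd rho a (rho a - rho a.+1)) a.+1 0)) (rho a.+1 * 6 + 1).
Proof.
apply: (exec_eq (@exec_loop_env o v w a.+1 _
  (fun j => upd (upd rho a (rho a - j)) a.+1 (rho a.+1 - j)) (rho a.+1) 2 _ _)).
- by move=> j hj; rewrite /upd eqxx.
- move=> j hj; apply: EIf => /=.
  set r := upd (upd _ _ _) _ _.
  have ra : r a = rho a - j by rewrite /r /upd; repeat (case: eqP => //); lia.
  rewrite ra; case: (posnP (rho a - j)) => [z|p].
    rewrite z /=; apply: (exec_eq (exec_skip _)) => //.
    rewrite /r; st_eq.
  have rp : 0 < r a by rewrite ra.
  have -> : nonempty (ohead (nseq (rho a - j) true)) by case: (rho a - j) p.
  apply: (exec_eq (exec_dec o v w rp)) => //.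
  rewrite ra /r; st_eq.
- by rewrite !subn0; st_eq.
- by rewrite subnn; st_eq.
- by lia.
Qed.

Lemma poly_sub e1 e2 : (exists c, poly_ok e1 c) -> (exists c, poly_ok e2 c) ->
  exists c, poly_ok (ESub e1 e2) c.
Proof.
move=> [c1 k1] [c2 k2].
have [h1 h2] := poly_ok_mono (leq_maxl c1 c2) k1.
have [g1 g2] := poly_ok_mono (leq_maxr c1 c2) k2.
set c := maxn c1 c2 in h1 h2 g1 g2.
exists (c + 20); split=> [v s|locs a hl].
  apply: leq_trans (leq_mul_exp _ _ (insize_ge2 _ _)) => /=.
  by have := h1 v s; have := g1 v s; lia.
have [p1 hp1] := h2 locs a hl.
have [p2 hp2] := g2 locs a.+1 (all_lt_weak (leqnSn a) hl).
exists (Seq (Seq p1 p2) (loop a.+4 (If a.+3 nonempty (dec a) skip))) => o v rho h0.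
have h0' x j : a.+1 <= j -> upd rho a x j = 0.
  by move=> hj; rewrite /upd; case: eqP => [e|_]; [lia|apply: h0; lia].
apply: (exec_eq (ESeq (ESeq (hp1 o v rho h0) (hp2 o v _ (h0' _)))
  (exec_sub_loop _ _ _ _ _))) => //.
  rewrite /= !map_upd //; st_eq; rewrite h0 //; lia.
rewrite !map_upd // upd_same.
apply: leq_trans (leq_mul_exp _ _ (insize_ge2 _ _)).
have := g1 v (map rho locs); have := insize_exp_gt0 v (map rho locs) c.
set X := _ ^ c; lia.
Qed.

Lemma insize_cons v s j X : j <= X -> insize v (j :: s) <= insize v s + X.
Proof. by rewrite /insize /=; lia. Qed.

(** With M the size before binding [j], the new size is at most M + M ^ c, hence at most M ^ (c +
    1). *)
Lemma insize_cons_exp v s j c : 0 < c -> j <= insize v s ^ c ->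
  insize v (j :: s) ^ c <= insize v s ^ (c.+1 * c).
Proof.
move=> c0 hj; rewrite expnM leq_exp2r //.
apply: leq_trans (insize_cons _ _ hj) _.
have M2 := insize_ge2 v s.
have : insize v s <= insize v s ^ c by rewrite -{1}[insize v s]expn1 leq_exp_r.
rewrite expnS; move: (insize v s) (_ ^ c) M2 => M X; nia.
Qed.

(** Numeric registers: [a] accumulates the sum, [a.+1] counts the remaining rounds, [a.+2] holds the
    summation index and [a.+3] receives the summand. *)
Definition sum_body pb a := Seq pb (Seq (move_add a.+3 a) (inc a.+2)).

Lemma exec_sum_loop pb locs o v rho a n (f : nat -> nat) T :
  (forall l, l \in locs -> l < a) ->
  (forall j, a <= j -> rho j = 0) ->
  (forall rho', (forall j, a.+3 <= j -> rho' j = 0) ->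
     map rho' locs = map rho locs -> rho' a.+2 < n ->
     exec pb (st o v [::] rho') (st o v [::] (upd rho' a.+3 (f (rho' a.+2)))) T) ->
  (forall j, j < n -> f j <= T) ->
  exec (Seq (loop a.+4 (sum_body pb a)) (loop a.+2.+3 skip))
    (st o v [::] (upd rho a.+1 n))
    (st o v [::] (upd rho a (\sum_(0 <= j < n) f j))) (n * (T * 7 + 20) + 20).
Proof.
move=> hl h0 hpb hT.
pose E j := upd (upd (upd rho a (\sum_(0 <= i < j) f i)) a.+1 (n - j)) a.+2 j.
have z1 := h0 a (leqnn a); have z2 := h0 a.+1 (leqnSn a); have z3 := h0 a.+2 (ltac:(lia)).
apply: (@EWeak _ _ _ ((n * ((T + (T * 6 + 1 + 2).+1).+1 + 4) + 1) + (n * 5 + 1)).+1);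
  last by lia.
apply: ESeq.
  apply: (exec_eq (@exec_loop_env o v [::] a.+1 (sum_body pb a) E n _ _ _)); last exact: leqnn.
  - by move=> j hj; rewrite /E /upd; repeat (case: eqP => ?); lia.
  - move=> j hj.
    have e2 : upd (E j) a.+1 (n - j.+1) a.+2 = j by rewrite /E /upd; repeat (case: eqP => ?); lia.
    apply: ESeq.
      apply: hpb.
      - by move=> i hi; rewrite /E /upd; repeat (case: eqP => ?; try lia); apply: h0; lia.
      - apply/eq_in_map => l /hl hla; rewrite /E /upd; repeat (case: eqP => ?; try lia).
      - by rewrite e2.
    rewrite e2.
    have n1 : a.+3 != a by lia.
    apply: (exec_eq (ESeq (exec_move_add o v [::] _ n1) (exec_inc _ _ _ _ _))) => //.
      rewrite /E; st_eq; rewrite ?big_nat_recr //= ?h0 //; lia.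
    by rewrite upd_same; have := hT j hj; lia.
  - by rewrite /E big_geq // subn0; st_eq.
  - by [].
apply: (exec_eq (exec_clear _ _ _ _ _)) => //.
  rewrite /E subnn; st_eq.
by rewrite /E upd_same.
Qed.

Lemma poly_sum e1 e2 : (exists c, poly_ok e1 c) -> (exists c, poly_ok e2 c) ->
  exists c, poly_ok (ESum e1 e2) c.
Proof.
move=> [c1 k1] [c2 k2].
set c := (maxn c1 c2).+1.
have [h1 h2] : poly_ok e1 c by apply: poly_ok_mono k1; rewrite /c; lia.
have [g1 g2] : poly_ok e2 c by apply: poly_ok_mono k2; rewrite /c; lia.
have c0 : 0 < c by [].
have gb v s j : j < ev e1 v s -> insize v (j :: s) ^ c <= insize v s ^ (c.+1 * c).
  move=> hj; apply: insize_cons_exp => //; apply: leq_trans (h1 v s); exact: ltnW.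
exists (c + c.+1 * c + 60); split=> [v s|locs a hl].
  apply: leq_trans (leq_mul_exp _ _ (insize_ge2 _ _)) => /=.
  rewrite expnD.
  apply: (@leq_trans (ev e1 v s * insize v s ^ (c.+1 * c))); last first.
    have := h1 v s; set X := _ ^ c; set Y := _ ^ _; nia.
  rewrite big_mkord -[X in X * _]card_ord -sum_nat_const.
  by apply: leq_sum => j _; apply: leq_trans (g1 v _) _; apply: gb.
have [p1 hp1] := h2 locs a.+1 (all_lt_weak (leqnSn a) hl).
have [pb hpb] := g2 (a.+2 :: locs) a.+3
  (ltac:(by rewrite /= ltnSn; apply: all_lt_weak hl; lia)).
exists (Seq p1 (Seq (loop a.+4 (sum_body pb a)) (loop a.+2.+3 skip))) => o v rho h0.
set s := map rho locs.
have h0' : forall j, a.+1 <= j -> rho j = 0 by move=> j hj; apply: h0; lia.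
apply: (exec_eq (ESeq (hp1 o v rho h0') (@exec_sum_loop pb locs o v rho a _
  (fun j => ev e2 v (j :: s)) (insize v s ^ (c.+1 * c)) _ h0 _ _))) => //.
- by move=> l hl'; apply: (allP hl).
- move=> rho' z em hj.
  apply: (exec_eq (hpb o v rho' z)) => //; rewrite /= em //.
  exact: gb.
- by move=> j hj; apply: leq_trans (g1 v _) _; apply: gb.
apply: leq_trans (leq_mul_exp _ _ (insize_ge2 _ _)).
rewrite expnD -/s.
have := h1 v s; have := insize_exp_gt0 v s c; have := insize_exp_gt0 v s (c.+1 * c).
set X := _ ^ c; set Y := _ ^ _; nia.
Qed.

(** [a] holds the current iterate, [a.+1] the cap and [a.+3] the next value; [a.+4] records what the
    loop takes from the cap, so that it can be given back. *)
Definition min_prog a :=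
  Seq (loop a.+3 skip)
  (Seq (loop a.+3.+3 (If a.+1.+3 nonempty (Seq (dec a.+1) (Seq (inc a) (inc a.+4))) skip))
       (move_add a.+4 a.+1)).

Lemma exec_min o v w rho a : rho a.+4 = 0 ->
  exec (min_prog a) (st o v w rho)
    (st o v w (upd (upd rho a (minn (rho a.+1) (rho a.+3))) a.+3 0))
    (rho a * 5 + rho a.+3 * 30 + 10).
Proof.
move=> z.
apply: (@EWeak _ _ _ ((rho a * 5 + 1) + ((rho a.+3 * 12 + 1) + (rho a.+3 * 6 + 1)).+1).+1);
  last by lia.
apply: ESeq (exec_clear _ _ _ _ _) _.
pose E j := upd (upd (upd (upd rho a (minn (rho a.+1) j)) a.+3 (rho a.+3 - j))
  a.+1 (rho a.+1 - j)) a.+4 (minn (rho a.+1) j).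
apply: (@ESeq _ _ _ (st o v w (E (rho a.+3)))).
  apply: (exec_eq (@exec_loop_env o v w a.+3 _ E (rho a.+3) 8 _ _)).
  - by move=> j hj; rewrite /E /upd; repeat (case: eqP => ?); lia.
  - move=> j hj; apply: EIf => /=.
    set r := upd _ _ _.
    have ra : r a.+1 = rho a.+1 - j by rewrite /r /E /upd; repeat (case: eqP => ?; try lia).
    rewrite ra; case: (posnP (rho a.+1 - j)) => [y|p].
      rewrite y /=; apply: (exec_eq (exec_skip _)) => //.
      by rewrite /r /E; st_eq.
    have rp : 0 < r a.+1 by rewrite ra.
    have -> : nonempty (ohead (nseq (rho a.+1 - j) true)) by case: (rho a.+1 - j) p.
    apply: (exec_eq (ESeq (exec_dec o v w rp) (ESeq (exec_inc _ _ _ _ _) (exec_inc _ _ _ _ _)))) => //.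
    by rewrite ra /r /E; st_eq.
  - by rewrite /E; st_eq.
  - by [].
  - by lia.
have n1 : a.+4 != a.+1 by lia.
apply: (exec_eq (exec_move_add o v w _ n1)) => //.
  by rewrite /E; st_eq.
by rewrite /E upd_same; lia.
Qed.

(** No iterate exceeds the maximum of the initial value and the cap, so one bound [T] serves all
    rounds. Uncapped iteration, of squaring for instance, would leave polynomial time. *)
Lemma exec_iter_loop pb locs o v rho a n cap (f : nat -> nat) T :
  (forall l, l \in locs -> l < a) ->
  (forall j, a.+1 <= j -> rho j = 0) ->
  (forall rho', (forall j, a.+3 <= j -> rho' j = 0) ->
     map rho' locs = map rho locs -> rho' a <= maxn (rho a) cap ->
     exec pb (st o v [::] rho') (st o v [::] (upd rho' a.+3 (f (rho' a)))) T) ->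
  (forall j, j <= maxn (rho a) cap -> f j <= T) ->
  exec (loop a.+2.+3 (Seq pb (min_prog a)))
    (st o v [::] (upd (upd rho a.+1 cap) a.+2 n))
    (st o v [::] (upd (upd rho a.+1 cap) a (iter n (fun x => minn cap (f x)) (rho a))))
    (n * (T * 40 + maxn (rho a) cap * 5 + 20) + 1).
Proof.
move=> hl h0 hpb hT; set B := maxn (rho a) cap.
set g := fun x => _.
have hB k : iter k g (rho a) <= B.
  by case: k => [|k]; rewrite /= /B ?leq_maxl // /g; lia.
pose E j := upd (upd (upd rho a (iter j g (rho a))) a.+1 cap) a.+2 (n - j).
apply: (exec_eq (@exec_loop_env o v [::] a.+2 _ E n
  (T + (B * 5 + T * 30 + 10)).+1 _ _)); last by lia.
- by move=> j hj; rewrite /E /upd; repeat (case: eqP => ?); lia.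
- move=> j hj; set r := upd _ _ _.
  have ra : r a = iter j g (rho a) by rewrite /r /E /upd; repeat (case: eqP => ?; try lia).
  apply: ESeq.
    apply: hpb.
    - by move=> i hi; rewrite /r /E /upd; repeat (case: eqP => ?; try lia); apply: h0; lia.
    - by apply/eq_in_map => l /hl hla; rewrite /r /E /upd; repeat (case: eqP => ?; try lia).
    - by rewrite ra; exact: hB.
  apply: (exec_eq (@exec_min o v [::] _ a _)) => //.
  - by rewrite /r /E /upd; repeat (case: eqP => ?; try lia); apply: h0; lia.
  - have ra1 : r a.+1 = cap by rewrite /r /E /upd; repeat (case: eqP => ?; try lia).
    rewrite upd_same ra [upd r _ _ a.+1]/upd ifF ?ra1; last by lia.
    by rewrite /r /E /= /g; st_eq; rewrite h0 //; lia.
  - rewrite upd_same [upd r _ _ a]/upd ifF ?ra; last by lia.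
    have := hB j; have := hT _ (hB j); lia.
- by rewrite /E subn0; st_eq.
- by rewrite /E subnn; st_eq; rewrite h0 //; lia.
Qed.

Lemma poly_iter e1 e2 e3 e4 :
  (exists c, poly_ok e1 c) -> (exists c, poly_ok e2 c) ->
  (exists c, poly_ok e3 c) -> (exists c, poly_ok e4 c) ->
  exists c, poly_ok (EIter e1 e2 e3 e4) c.
Proof.
move=> [c1 k1] [c2 k2] [c3 k3] [c4 k4].
set c := (maxn (maxn c1 c2) (maxn c3 c4)).+1.
have [n1 n2] : poly_ok e1 c by apply: poly_ok_mono k1; rewrite /c; lia.
have [m1 m2] : poly_ok e2 c by apply: poly_ok_mono k2; rewrite /c; lia.
have [i1 i2] : poly_ok e3 c by apply: poly_ok_mono k3; rewrite /c; lia.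
have [g1 g2] : poly_ok e4 c by apply: poly_ok_mono k4; rewrite /c; lia.
have c0 : 0 < c by [].
have gb v s j : j <= maxn (ev e3 v s) (ev e2 v s) ->
    insize v (j :: s) ^ c <= insize v s ^ (c.+1 * c).
  move=> hj; apply: insize_cons_exp => //; apply: leq_trans hj _.
  by rewrite geq_max i1 m1.
exists (c + c.+1 * c + 200); split=> [v s|locs a hl].
  apply: (@leq_trans (insize v s ^ c)); last by apply: leq_exp_r (insize_ge2 _ _) _; lia.
  rewrite /=; case: (ev e1 v s) => [|k] /=; first exact: i1.
  by rewrite geq_min m1.
have hl1 := all_lt_weak (leqnSn a) hl.
have hl2 := all_lt_weak (leqnSn a.+1) hl1.
have [p3 hp3] := i2 locs a hl.
have [p2 hp2] := m2 locs a.+1 hl1.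
have [p1 hp1] := n2 locs a.+2 hl2.
have [pb hpb] := g2 (a :: locs) a.+3
  (ltac:(by rewrite /= (_ : a < a.+3) ?(all_lt_weak _ hl) //; lia)).
exists (Seq (Seq p3 (Seq p2 p1)) (Seq (loop a.+2.+3 (Seq pb (min_prog a))) (loop a.+1.+3 skip)))
  => o v rho h0.
set s := map rho locs.
set rho3 := upd rho a (ev e3 v s).
have z3 j : a.+1 <= j -> rho3 j = 0.
  by move=> hj; rewrite /rho3 /upd; case: eqP => [?|_]; [lia|apply: h0; lia].
have es3 : map rho3 locs = s by rewrite /rho3 map_upd.
set rho2 := upd rho3 a.+1 (ev e2 v s).
have z2 j : a.+2 <= j -> rho2 j = 0.
  by move=> hj; rewrite /rho2 /upd; case: eqP => [?|_]; [lia|apply: z3; lia].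
have es2 : map rho2 locs = s by rewrite /rho2 map_upd.
have := hp2 o v rho3 z3; rewrite es3 => x2.
have := hp1 o v rho2 z2; rewrite es2 => x1.
have x3 := hp3 o v rho h0; rewrite -/s -/rho3 in x3.
have ra : rho3 a = ev e3 v s by rewrite /rho3 upd_same.
have xl := @exec_iter_loop pb locs o v rho3 a (ev e1 v s) (ev e2 v s)
  (fun x => ev e4 v (x :: s)) (insize v s ^ (c.+1 * c)) _ z3 _ _.
apply: (exec_eq (ESeq (ESeq x3 (ESeq x2 x1)) (ESeq (xl _ _ _) (exec_clear _ _ _ _ _)))) => //.
- by move=> l hl'; apply: (allP hl).
- move=> rho' z em hj.
  apply: (exec_eq (hpb o v rho' z)) => //; rewrite /= em es3 //.
  by apply: gb; rewrite -ra.
- by move=> j hj; apply: leq_trans (g1 v _) _; apply: gb; rewrite -ra.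
- rewrite ra /= /rho3; st_eq; rewrite h0 //; lia.
apply: leq_trans (leq_mul_exp _ _ (insize_ge2 _ _)).
rewrite expnD -/s ra (_ : upd _ a _ a.+1 = ev e2 v s); last first.
  by rewrite /upd; repeat (case: eqP => ?; try lia).
have := n1 v s; have := m1 v s; have := i1 v s;
have := insize_exp_gt0 v s c; have := insize_exp_gt0 v s (c.+1 * c).
set X := _ ^ c; set Y := _ ^ _ => Y0 X0 le3 le2 le1.
set B := maxn _ _; have lB : B <= X by rewrite /B geq_max le3 le2.
have XY : X * Y >= X by nia.
have XX : X <= Y.
  by rewrite /X /Y leq_exp_r ?insize_ge2 //; nia.
nia.
Qed.

Lemma expr_poly e : exists c, poly_ok e c.
Proof.
elim: e; [exact: poly_const|exact: poly_head|exact: poly_wk|exact: poly_len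
 |exact: poly_bit| | | |] => *.
- exact: poly_add.
- exact: poly_sub.
- exact: poly_sum.
- exact: poly_iter.
Qed.

(** * Polynomial-time word functions *)

Definition load := Seq (While 0 nonempty (shift_bit 0 2)) restore.

Lemma exec_load v :
  exec load (only_word v) (st [::] v [::] (fun _ => 0)) (size v * 14 + 3).
Proof.
have H : forall u w, exec (While 0 nonempty (shift_bit 0 2)) (st u [::] w (fun _ => 0))
    (st [::] [::] (catrev u w) (fun _ => 0)) (size u * 7 + 1).
  elim=> [|b u IH] w; first by apply: EWhileDone.
  apply: (@EWeak _ _ _ (5 + (size u * 7 + 1)).+2); last by rewrite /=; lia.
  apply: EWhileStep => //; last exact: IH.
  apply: (exec_eq (@exec_shift_bit 0 2 (st (b :: u) [::] w (fun _ => 0)) b u erefl)) => //.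
  by apply/funext => -[|[|[|j]]].
apply: (exec_eq (ESeq (H v [::]) (exec_restore _ _ _ _))).
- by apply/funext => -[|[|[|j]]].
- by rewrite -[catrev v [::]]/(rev v) -/(rev (rev v)) revK.
- by rewrite size_rev; lia.
Qed.

(** The output is a stack, so its bits are pushed from the last to the first: the loop counter,
    already decremented when the body runs, is itself the index of the bit. *)
Lemma word_prog (L B : expr) : exists p c, forall v,
  exists2 s', s' 0 = mkseq (fun i => 0 < ev B v [:: i]) (ev L v [::]) &
    exec p (only_word v) s' ((size v + 2) ^ c).
Proof.
have [cL [hL kL]] := expr_poly L; have [cB [hB kB]] := expr_poly B.
have [pL qL] := kL [::] 0 isT; have [pB qB] := kB [:: 0] 1 isT.
pose emit := Seq pB (Seq (If 1.+3 nonempty (Push 0 true) (Push 0 false)) (loop 1.+3 skip)).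
exists (Seq load (Seq pL (loop 0.+3 emit))), ((cL + (cL.+1 * cB.+1)) + 200) => v.
have qL1 := qL [::] v (fun _ => 0) (fun _ _ => erefl).
set n := ev L v [::] in qL1 *.
exists (st (mkseq (fun i => 0 < ev B v [:: i]) n) v [::] (upd (fun _ => 0) 0 0)) => //.
have X1 : insize v [::] = size v + 2 by rewrite /insize /= addn0.
have nX : n <= (size v + 2) ^ cL by rewrite -X1; exact: hL.
set T := (size v + 2) ^ (cL.+1 * cB.+1).
have bT j : j < n -> insize v [:: j] ^ cB <= T.
  move=> hj; rewrite /T expnM.
  apply: (@leq_trans (insize v [:: j] ^ cB.+1)).
    by apply: leq_exp_r => //; exact: insize_ge2.
  rewrite leq_exp2r // /insize /= expnS.
  move: (leq_trans hj nX); rewrite -X1; have := insize_exp_gt0 v [::] cL.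
  rewrite X1; set Y := _ ^ cL; nia.
apply: (@EWeak _ _ _ ((size v * 14 + 3) + ((size v + 2) ^ cL + (n * ((T + (3 + (T * 5 + 1)).+1).+1 + 4) + 1)).+1).+1); last first.
  rewrite -X1; apply: leq_trans (leq_mul_exp _ _ (insize_ge2 _ _)).
  rewrite X1 expnD -/T.
  have V : size v <= T.
    apply: (@leq_trans ((size v + 2) ^ 1)); first by rewrite expn1 leq_addr.
    by apply: leq_exp_r => //; lia.
  have T0 : 0 < T by rewrite /T expn_gt0 addn2.
  have Y0 : 0 < (size v + 2) ^ cL by rewrite expn_gt0 addn2.
  move: nX Y0; set Y := _ ^ cL => nX Y0; nia.
apply: ESeq (exec_load v) _.
apply: ESeq.
  by apply: EWeak qL1 _; rewrite X1.
pose S j := st (drop (n - j) (mkseq (fun i => 0 < ev B v [:: i]) n)) v [::]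
               (upd (fun _ => 0) 0 (n - j)).
apply: (exec_eq (@exec_loop 3 emit S n _ _ _)); last exact: leqnn.
- by move=> j hj.
- move=> j hj; rewrite /S st_upd upd_upd.
  set m := n - j.+1; have em : n - j = m.+1 by rewrite /m; lia.
  set o := drop _ _; set rho := upd _ _ _.
  have := qB o v rho (ltac:(by move=> i hi; rewrite /rho /upd; case: eqP hi => // ->)).
  have -> : map rho [:: 0] = [:: m] by [].
  set r := ev _ _ _ => xb.
  apply: (@ESeq _ _ _ (st o v [::] (upd rho 1 r))).
    by apply: EWeak xb _; apply: bT; rewrite /m; lia.
  apply: (@ESeq _ _ _ (st ((0 < r) :: o) v [::] (upd rho 1 r))).
    apply: (exec_eq (@EIf 4 nonempty _ _ _ (st ((0 < r) :: o) v [::] (upd rho 1 r)) 2 _)) => //=.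
    rewrite /upd /=; case: r {xb} => [|r] /=;
      apply: (exec_eq (EPush _ _ _)) => //; by apply/funext => -[|[|[|i]]].
  apply: (exec_eq (exec_clear _ _ _ _ _)) => //.
    rewrite (_ : _ :: o = drop m (mkseq (fun i => 0 < ev B v [:: i]) n)); last first.
      rewrite (drop_nth false (n := m)) ?size_mkseq; last by rewrite /m; lia.
      rewrite nth_mkseq; last by rewrite /m; lia.
      by rewrite /o em.
    congr (st _ _ _); by apply/funext => -[|[|i]].
  rewrite upd_same.
  have := hB v [:: m]; have := bT m (ltac:(rewrite /m; lia)); rewrite -/r; lia.
- by rewrite /S subn0 drop_oversize ?size_mkseq.
- by rewrite /S subnn drop0.
Qed.

(** From here on polynomial time is shown by closure properties of this class, and machines enter
    only through [word_machine]. *)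
Definition pf (F : seq bool -> seq nat -> nat) : Prop :=
  exists e, forall v s, ev e v s = F v s.

Lemma word_machine (M1 : turing_machine) (L B : seq bool -> seq nat -> nat) :
  pf L -> pf B -> exists M c, forall w t v, tm_computes_within M1 w t v ->
  tm_computes_within M w (t + (size v + 2) ^ c)
    (mkseq (fun i => 0 < B v [:: i]) (L v [::])).
Proof.
move=> [eL hL] [eB hB]; have [p [c hp]] := word_prog eL eB.
have [M hM] := run_after M1 p.
exists M, c.+1 => w t v h.
have [s' e ex] := hp v.
have le : ((size v + 2) ^ c).+1 <= (size v + 2) ^ c.+1.
  have Y : 0 < (size v + 2) ^ c by rewrite expn_gt0 addn2.
  by rewrite expnS; nia.
have := hM w t v h s' _ ex.
rewrite e hL (_ : mkseq _ _ = mkseq (fun i => 0 < B v [:: i]) (L v [::])); last first.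
  by apply: eq_mkseq => i; rewrite hB.
case; set u := (_ + _).+1 => h1 h2.
have lu : u <= t + (size v + 2) ^ c.+1 by rewrite /u; lia.
rewrite /tm_computes_within -(subnK lu) iterD.
set cf := iter u _ _ in h1 h2 *.
have -> : iter (t + (size v + 2) ^ c.+1 - u) (@tm_step M) cf = cf.
  by elim: (_ - u) => //= k ->; rewrite /tm_step h1.
by [].
Qed.

(** * Closure properties of the functions given by expressions *)

Section PfBasic.
Implicit Types F A B C : seq bool -> seq nat -> nat.
Implicit Types P Q : seq bool -> seq nat -> bool.

Lemma pf_ext A B : (forall v s, A v s = B v s) -> pf A -> pf B.
Proof. by move=> h [e he]; exists e => v s; rewrite he h. Qed.

Lemma pf_const n : pf (fun _ _ => n).
Proof. by exists (EConst n). Qed.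

Lemma pf_head : pf (fun _ s => head 0 s).
Proof. by exists EHead. Qed.

Lemma pf_wk F : pf F -> pf (fun v s => F v (behead s)).
Proof. by move=> [e h]; exists (EWk e) => v s; rewrite /= h. Qed.

Lemma pf_size : pf (fun v _ => size v).
Proof. by exists ELen. Qed.

Lemma pf_nth A : pf A -> pf (fun v s => nth false v (A v s)).
Proof. by move=> [e h]; exists (EBit e) => v s; rewrite /= h. Qed.

Lemma pf_add A B : pf A -> pf B -> pf (fun v s => A v s + B v s).
Proof. by move=> [e h] [e' h']; exists (EAdd e e') => v s; rewrite /= h h'. Qed.

Lemma pf_sub A B : pf A -> pf B -> pf (fun v s => A v s - B v s).
Proof. by move=> [e h] [e' h']; exists (ESub e e') => v s; rewrite /= h h'. Qed.

(* In a bound body, [head 0 s] is the bound variable and [behead s] the environment. *)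
Lemma pf_sum C (B : seq bool -> seq nat -> nat -> nat) : pf C ->
  pf (fun v s => B v (behead s) (head 0 s)) ->
  pf (fun v s => \sum_(0 <= j < C v s) B v s j).
Proof.
move=> [e h] [e' h']; exists (ESum e e') => v s; rewrite /= h.
by apply: eq_bigr => j _; rewrite h'.
Qed.

Lemma pf_iter A C D (B : seq bool -> seq nat -> nat -> nat) :
  pf A -> pf C -> pf D -> pf (fun v s => B v (behead s) (head 0 s)) ->
  pf (fun v s => iter (A v s) (fun x => minn (C v s) (B v s x)) (D v s)).
Proof.
move=> [a ha] [c hc] [d hd] [e h]; exists (EIter a c d e) => v s /=.
rewrite ha hd; apply: eq_iter => x; by rewrite hc h.
Qed.

Lemma pf_succ A : pf A -> pf (fun v s => (A v s).+1).
Proof.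
move=> h; apply: (@pf_ext (fun v s => A v s + 1)); first by move=> v s; rewrite addn1.
exact: pf_add h (pf_const 1).
Qed.

Lemma pf_pred A : pf A -> pf (fun v s => (A v s).-1).
Proof.
move=> h; apply: (@pf_ext (fun v s => A v s - 1)); first by move=> v s; rewrite subn1.
exact: pf_sub h (pf_const 1).
Qed.

Lemma pf_mul A B : pf A -> pf B -> pf (fun v s => A v s * B v s).
Proof.
move=> hA hB; apply: (@pf_ext (fun v s => \sum_(0 <= j < A v s) B v s)).
  by move=> v s; rewrite sum_nat_const_nat subn0.
by apply: pf_sum => //; exact: pf_wk.
Qed.

Lemma pf_leq A B : pf A -> pf B -> pf (fun v s => A v s <= B v s).
Proof.
move=> hA hB; apply: (@pf_ext (fun v s => 1 - (A v s - B v s))).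
  by move=> v s; case: leqP => /= h; lia.
exact: pf_sub (pf_const 1) (pf_sub hA hB).
Qed.

Lemma pf_ltn A B : pf A -> pf B -> pf (fun v s => A v s < B v s).
Proof. by move=> hA hB; apply: pf_leq => //; exact: pf_succ. Qed.

Lemma pf_and P Q : pf (fun v s => P v s) -> pf (fun v s => Q v s) ->
  pf (fun v s => P v s && Q v s).
Proof.
move=> hP hQ; apply: pf_ext (pf_mul hP hQ) => v s.
by case: (P v s); case: (Q v s).
Qed.

Lemma pf_neg P : pf (fun v s => P v s) -> pf (fun v s => ~~ P v s).
Proof.
move=> hP; apply: pf_ext (pf_sub (pf_const 1) hP) => v s.
by case: (P v s).
Qed.

Lemma pf_or P Q : pf (fun v s => P v s) -> pf (fun v s => Q v s) ->
  pf (fun v s => P v s || Q v s).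
Proof.
move=> hP hQ; apply: pf_ext (pf_neg (pf_and (pf_neg hP) (pf_neg hQ))) => v s.
by case: (P v s); case: (Q v s).
Qed.

Lemma pf_implb P Q : pf (fun v s => P v s) -> pf (fun v s => Q v s) ->
  pf (fun v s => P v s ==> Q v s).
Proof.
move=> hP hQ; apply: pf_ext (pf_or (pf_neg hP) hQ) => v s.
by case: (P v s); case: (Q v s).
Qed.

Lemma pf_eqn A B : pf A -> pf B -> pf (fun v s => A v s == B v s).
Proof.
move=> hA hB; apply: pf_ext (pf_and (pf_leq hA hB) (pf_leq hB hA)) => v s.
by rewrite eqn_leq.
Qed.

Lemma pf_if P A B : pf (fun v s => P v s) -> pf A -> pf B ->
  pf (fun v s => if P v s then A v s else B v s).
Proof.
move=> hP hA hB.
apply: pf_ext (pf_add (pf_mul hP hA) (pf_mul (pf_neg hP) hB)) => v s.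
by case: (P v s); rewrite ?mul1n ?mul0n ?addn0.
Qed.

Lemma pf_ifb P Q Q' : pf (fun v s => P v s) -> pf (fun v s => Q v s) ->
  pf (fun v s => Q' v s) ->
  pf (fun v s => if P v s then Q v s else Q' v s : bool).
Proof.
move=> hP hQ hQ'; apply: pf_ext (pf_if hP hQ hQ') => v s.
by case: (P v s).
Qed.

(** The quotient of a by b is the number of [i < a] with [i.+1 * b <= a]; the factor [0 < B v s]
    yields the convention that division by 0 gives 0. *)
Lemma pf_div A B : pf A -> pf B -> pf (fun v s => A v s %/ B v s).
Proof.
move=> hA hB.
apply: (@pf_ext (fun v s => (0 < B v s) *
  \sum_(0 <= i < A v s) (i.+1 * B v s <= A v s))).
  move=> v s; case: posnP => [->|p]; first by rewrite divn0.
  rewrite mul1n.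
  move: (A v s) (B v s) p => a b p.
  have ka : a %/ b <= a by exact: leq_div.
  rewrite (big_cat_nat (n := a %/ b)) //= big_nat_cond (eq_bigr (fun _ => 1)); last first.
    move=> i /andP[/andP[_ h] _]; rewrite leq_divRL // in h.
    by rewrite h.
  rewrite -big_nat_cond sum_nat_const_nat subn0 muln1 big_nat_cond big1 ?addn0 // => i.
  move=> /andP[/andP[h _] _]; move: h; rewrite -ltnS ltn_divLR // => h.
  by rewrite leqNgt h.
apply: pf_mul; first exact: pf_ltn (pf_const 0) hB.
apply: pf_sum => //; apply: pf_leq; last exact: pf_wk.
apply: pf_mul; last exact: pf_wk.
exact: pf_succ pf_head.
Qed.

Lemma pf_mod A B : pf A -> pf B -> pf (fun v s => A v s %% B v s).
Proof.
move=> hA hB; apply: pf_ext (pf_sub hA (pf_mul (pf_div hA hB) hB)) => v s.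
by rewrite {1}(divn_eq (A v s) (B v s)) addKn.
Qed.

Lemma pf_exp A n : pf A -> pf (fun v s => A v s ^ n).
Proof.
move=> hA; elim: n => [|n IH]; first exact: pf_const 1.
by apply: pf_ext (pf_mul hA IH) => v s; rewrite expnS.
Qed.

Lemma pf_all C (P : seq bool -> seq nat -> nat -> bool) : pf C ->
  pf (fun v s => P v (behead s) (head 0 s)) ->
  pf (fun v s => all (P v s) (iota 0 (C v s))).
Proof.
move=> hC hP.
apply: (@pf_ext (fun v s => \sum_(0 <= j < C v s) (~~ P v s j) == 0)).
  move=> v s; congr nat_of_bool; rewrite /index_iota subn0.
  by elim: (iota _ _) => [|j l IH]; rewrite ?big_nil // big_cons /= -IH; case: (P v s j).
apply: pf_eqn (pf_const 0); apply: (@pf_sum _ (fun v s j => ~~ P v s j)) => //.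
exact: pf_neg.
Qed.

Lemma pf_has C (P : seq bool -> seq nat -> nat -> bool) : pf C ->
  pf (fun v s => P v (behead s) (head 0 s)) ->
  pf (fun v s => has (P v s) (iota 0 (C v s))).
Proof.
move=> hC hP.
apply: (@pf_ext (fun v s => ~~ all (fun j => ~~ P v s j) (iota 0 (C v s)))).
  by move=> v s; rewrite -has_predC; congr nat_of_bool; apply: eq_has => j /=; rewrite negbK.
apply: pf_neg; apply: (@pf_all _ (fun v s j => ~~ P v s j)) => //; exact: pf_neg.
Qed.

End PfBasic.

Create HintDb pf.
#[local] Hint Constants Opaque : pf.
#[local] Hint Resolve pf_const pf_head pf_wk pf_size pf_nth pf_add pf_sub
  pf_sum pf_iter pf_succ pf_pred pf_mul pf_leq pf_ltn pf_and pf_neg pf_or pf_implb pf_eqn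
  pf_if pf_ifb pf_div pf_mod pf_exp pf_all pf_has : pf.

(* [tok v i] is the number of index [i] when [v] is read as a sequence of unary
   numbers, each closed by a [false]. *)
Definition zeros (v : seq bool) (p : nat) := \sum_(0 <= j < p) (~~ nth false v j).
Definition tok (v : seq bool) (i : nat) :=
  \sum_(0 <= p < size v) (nth false v p && (zeros v p == i)).

Lemma pf_zeros A : pf A -> pf (fun v s => zeros v (A v s)).
Proof. move=> hA; rewrite /zeros; auto 20 with pf nocore. Qed.
#[local] Hint Resolve pf_zeros : pf.

Lemma pf_tok A : pf A -> pf (fun v s => tok v (A v s)).
Proof. move=> hA; rewrite /tok; auto 20 with pf nocore. Qed.
#[local] Hint Resolve pf_tok : pf.

(** * The gadget graph *)

Section Forest.
Variables (V : finType) (g : rel V) (par : V -> V) (rk : V -> nat).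
Hypothesis g_par : forall u v, g u v ->
  (v = par u /\ rk v < rk u) \/ (u = par v /\ rk u < rk v).

(* In a cycle, both neighbours of a vertex of maximal rank would be its parent. *)
Lemma forest_acyclic (c : seq V) : 2 < size c -> ~~ ucycleb g c.
Proof.
move=> hs; apply/negP => /andP[cyc un].
have [x0 xc] : exists x, x \in c by case: c hs {cyc un} => // x c _; exists x; rewrite inE eqxx.
have [x xin xmax] : exists2 x, x \in c & forall y, y \in c -> rk y <= rk x.
  have := @arg_maxnP V x0 (mem c) rk xc; case=> x xin h; by exists x.
have [i s' e] := rot_to xin.
have cyc' : cycle g (x :: s') by rewrite -e rot_cycle.
have un' : uniq (x :: s') by rewrite -e rot_uniq.
have hs' : 2 < size (x :: s') by rewrite -e size_rot.
have max' y : y \in x :: s' -> rk y <= rk x by rewrite -e mem_rot; exact: xmax.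
case: s' {e} cyc' un' hs' max' => [|y [|z s]] //= /andP[gxy cyc'] /and3P[_ yn _] _ max'.
have ey : y = par x.
  case: (g_par gxy) => [[] //|[_ lt]].
  by have := max' y; rewrite !inE eqxx orbT => /(_ isT); lia.
have gl : g (last z s) x.
  by move: cyc' => /andP[_]; rewrite rcons_path => /andP[].
have el : last z s = par x.
  case: (g_par gl) => [[_ lt]|[] //].
  have := max' (last z s); rewrite 2!in_cons mem_last !orbT => /(_ isT); lia.
by move: yn; rewrite ey -el mem_last.
Qed.
End Forest.

Section Gadget.
Variables (N0 L G t : nat) (y : nat -> nat -> nat).

(* The trees are the items [e < N0], an item [N0] balancing those not chosen, and a
   tree [N0.+1] with more leaves than the budget allows. *)
Definition tot i := \sum_(0 <= e < N0) y e i.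
Definition yy e i := if e < N0 then y e i else if e == N0 then (tot i).+1 else 2 * t.
(** Strictly above every [tot i], so that even the balancing item, with [(tot i).+1] leaves joined
    to u_i, has enough leaves. *)
Definition ybound := (\sum_(0 <= i < L) tot i).+1.
(** Room for [G] items and the balancing one, each paying for its centre and for one vertex per
    leaf, with [ybound] leaves in each coordinate. *)
Definition budget := G.+1 * (L * ybound).+1.
(** The first term gives every centre more than [2 * budget] pendant vertices. The second lets the
    tree [N0.+1], which has [2 * t] leaves joined to u_i in each coordinate, keep more than [budget]
    leaves with an end of their own. *)
Definition hmax := 2 * budget + 2 * t + 2.
Definition hh e := if e <= N0 then ybound else hmax.

(* A vertex has a code (kind, tree, coordinate, index).  It is a common vertex u_i,
   the centre of a tree, a leaf, or the end of a leaf not joined to u_i; vertices with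
   any other code are pendant at the centre of their tree. *)
Definition is_u k e (i : nat) h := [&& k == 0, e == 0 & h == 0].
Definition is_c k (e i h : nat) := [&& k == 1, i == 0 & h == 0].
Definition is_leaf k e (i : nat) h := (k == 2) && (h < hh e).
Definition is_end k e i h := [&& k == 3, yy e i <= h & h < hh e].

(** Inside a tree, arcs go from a vertex to its parent: an end to its leaf, a leaf or pendant vertex
    to the centre. The last disjunct joins u_i to leaves. Making every code of the box a vertex
    keeps the numbering of vertices arithmetical, and the spare codes are the pendant vertices that
    the centres need. *)
Definition arc k e i h k' e' i' h' :=
  [|| [&& is_end k e i h, is_leaf k' e' i' h', e == e', i == i' & h == h'],
      [&& ~~ is_u k e i h, ~~ is_c k e i h, ~~ is_end k e i h, is_c k' e' i' h' & e == e']
    | [&& is_u k e i h, is_leaf k' e' i' h', i == i' & h' < yy e' i']].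

Variables (V : finType) (fk fe fi fh : V -> nat) (mk : nat -> nat -> nat -> nat -> V).
Hypothesis L0 : 0 < L.
Hypothesis t0 : 0 < t.
Hypothesis y1 : forall e i, e < N0 -> i < L -> 0 < y e i.
Let N := N0.+2.
Hypothesis mkE : forall a b c d, a < 4 -> b < N -> c < L -> d < hmax ->
  [/\ fk (mk a b c d) = a, fe (mk a b c d) = b, fi (mk a b c d) = c & fh (mk a b c d) = d].
Hypothesis f_lt : forall v, [/\ fk v < 4, fe v < N, fi v < L & fh v < hmax].
Hypothesis mkK : forall v, mk (fk v) (fe v) (fi v) (fh v) = v.

Let isu v := is_u (fk v) (fe v) (fi v) (fh v).
Let isc v := is_c (fk v) (fe v) (fi v) (fh v).
Let isl v := is_leaf (fk v) (fe v) (fi v) (fh v).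
Let isn v := is_end (fk v) (fe v) (fi v) (fh v).
Let dir u v := arc (fk u) (fe u) (fi u) (fh u) (fk v) (fe v) (fi v) (fh v).

Definition gadget_adj u v := dir u v || dir v u.

Lemma gadget_sym : symmetric gadget_adj.
Proof. by move=> u v; rewrite /gadget_adj orbC. Qed.

Lemma gadget_irrefl : irreflexive gadget_adj.
Proof.
move=> v; rewrite /gadget_adj orbb /dir /arc /is_end /is_leaf /is_u /is_c.
by case: (fk v) => [|[|[|[|?]]]]; case: (fi v == 0); case: (fh v == 0); case: (fh v < _) => /=; rewrite ?andbF ?orbF.
Qed.

Definition gadget : sgraph V := SGraph gadget_sym gadget_irrefl.

Lemma gadgetC u v : gadget u v = gadget v u.
Proof. exact: gadget_sym. Qed.

Lemma ybound_le_hmax : ybound <= hmax.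
Proof.
rewrite /hmax /budget; move: ybound => Y.
have : Y <= L * Y by rewrite leq_pmull.
move: (L * Y) => X; nia.
Qed.

Lemma hh_le e : hh e <= hmax.
Proof. by rewrite /hh; case: ifP => // _; exact: ybound_le_hmax. Qed.

Lemma tot_le i : i < L -> tot i < ybound.
Proof.
move=> hi; rewrite /ybound ltnS big_mkord.
by rewrite (bigD1 (Ordinal hi)) //= leq_addr.
Qed.

Lemma yy_le_hh e i : i < L -> yy e i <= hh e.
Proof.
move=> hi; rewrite /yy /hh; case: (ltngtP e N0) => h; rewrite /= ?h.
- apply: leq_trans (ltnW (tot_le hi)).
  by rewrite /tot big_mkord (bigD1 (Ordinal h)) //= leq_addr.
- by rewrite /hmax; lia.
- exact: tot_le.
Qed.

Lemma yy_gt0 e i : i < L -> 0 < yy e i.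
Proof.
move=> hi; rewrite /yy; case: (ltnP e N0) => h; first exact: y1.
by case: eqP => // _; lia.
Qed.

Lemma sumV (F : V -> nat) : \sum_v F v =
  \sum_(0 <= a < 4) \sum_(0 <= b < N) \sum_(0 <= c < L) \sum_(0 <= d < hmax) F (mk a b c d).
Proof.
rewrite big_mkord.
under [RHS]eq_bigr => a _ do rewrite big_mkord.
under [RHS]eq_bigr => a _ do under eq_bigr => b _ do rewrite big_mkord.
under [RHS]eq_bigr => a _ do under eq_bigr => b _ do under eq_bigr => c _ do rewrite big_mkord.
rewrite pair_big pair_big pair_big /=.
pose f (p : 'I_4 * 'I_N * 'I_L * 'I_hmax) := mk p.1.1.1 p.1.1.2 p.1.2 p.2.
pose f' v : 'I_4 * 'I_N * 'I_L * 'I_hmax :=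
  let: And4 h1 h2 h3 h4 := f_lt v in (Ordinal h1, Ordinal h2, Ordinal h3, Ordinal h4).
rewrite (reindex f) //; exists f' => [[[[a b] c] d]|v] _.
  rewrite /f' /f /=; case: (f_lt _) => h1 h2 h3 h4.
  have [e1 e2 e3 e4] := mkE (ltn_ord a) (ltn_ord b) (ltn_ord c) (ltn_ord d).
  by congr (_, _, _, _); apply: val_inj.
by rewrite /f' /f; case: (f_lt v) => h1 h2 h3 h4 /=; rewrite mkK.
Qed.

Lemma card_sumV (P : pred V) : #|[set v | P v]| =
  \sum_(0 <= a < 4) \sum_(0 <= b < N) \sum_(0 <= c < L) \sum_(0 <= d < hmax) P (mk a b c d).
Proof. by rewrite -(sumV (fun v => P v : nat)) -sum1_card big_mkcond /=; apply: eq_bigr => v _; rewrite inE; case: (P v). Qed.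

Lemma mk_inj v a b c d : fk v = a -> fe v = b -> fi v = c -> fh v = d -> v = mk a b c d.
Proof. by move=> <- <- <- <-; rewrite mkK. Qed.

Let C e := mk 1 e 0 0.
Let U i := mk 0 0 i 0.

Lemma hmax_gt0 : 0 < hmax.
Proof. by rewrite /hmax; lia. Qed.

Lemma C_E e : e < N -> [/\ fk (C e) = 1, fe (C e) = e, fi (C e) = 0 & fh (C e) = 0].
Proof. by move=> h; apply: mkE => //; exact: hmax_gt0. Qed.

Lemma U_E i : i < L -> [/\ fk (U i) = 0, fe (U i) = 0, fi (U i) = i & fh (U i) = 0].
Proof. by move=> h; apply: mkE => //; exact: hmax_gt0. Qed.

Lemma isc_eq v : isc v -> v = C (fe v).
Proof. by case/and3P => /eqP ? /eqP ? /eqP ?; apply: mk_inj. Qed.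

Lemma isu_eq v : isu v -> v = U (fi v).
Proof. by case/and3P => /eqP ? /eqP ? /eqP ?; apply: mk_inj. Qed.

Definition isp v := [&& ~~ isu v, ~~ isc v & ~~ isn v].

Lemma adj_C v : isp v -> gadget v (C (fe v)).
Proof.
case/and3P=> p1 p2 p3; have [_ he _ _] := f_lt v; have [e1 e2 e3 e4] := C_E he.
rewrite /gadget /= /gadget_adj /dir /arc -/(isu v) -/(isc v) -/(isn v) p1 p2 p3 /=.
by rewrite e1 e2 e3 e4 /is_c /= eqxx orbT.
Qed.

Lemma isl_isp v : isl v -> isp v.
Proof. by case/andP=> /eqP e _; rewrite /isp /isu /isc /isn /is_u /is_c /is_end e. Qed.

Lemma leaf_facts e i h : e < N -> i < L -> h < hh e ->
  let v := mk 2 e i h in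
  [/\ isl v, fk v = 2, fe v = e, fi v = i & fh v = h].
Proof.
move=> he hi hh'; have hm := leq_trans hh' (hh_le e).
have [e1 e2 e3 e4] := mkE (isT : 2 < 4) he hi hm.
by split=> //; rewrite /isl e1 e2 e3 e4 /is_leaf eqxx.
Qed.

(* The second neighbour of a leaf, besides the centre of its tree. *)
Definition other e i h := if h < yy e i then U i else mk 3 e i h.

Lemma leaf_nbrs e i h : e < N -> i < L -> h < hh e ->
  let v := mk 2 e i h in
  [/\ gadget v (C e), gadget v (other e i h) &
      forall w, gadget v w -> w = C e \/ w = other e i h].
Proof.
move=> he hi hh'; have [hl e1 e2 e3 e4] := leaf_facts he hi hh'; move=> v.
have hm := leq_trans hh' (hh_le e).
have [l1 l2 l3] := and3P (isl_isp hl).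
split.
- by have := adj_C (isl_isp hl); rewrite e2.
- rewrite /other /gadget /= /gadget_adj; apply/orP; right.
  case: ltnP => hy; rewrite /dir /arc.
    have [u1 u2 u3 u4] := U_E hi.
    rewrite u1 u2 u3 u4 /v e1 e2 e3 e4 /is_u /is_leaf /= hh' eqxx hy /= ?orbT //.
  have [u1 u2 u3 u4] := mkE (isT : 3 < 4) he hi hm.
  by rewrite u1 u2 u3 u4 /v e1 e2 e3 e4 /is_end /is_leaf /= hh' hy !eqxx.
move=> w; rewrite /gadget /= /gadget_adj /dir /arc /v.
case/orP.
  rewrite -/(isu _) -/(isc _) -/(isn _) (negbTE l1) (negbTE l2) (negbTE l3) /= ?orbF.
  move=> /andP[wc /eqP ew]; left.
  by rewrite (isc_eq wc) -ew e2.
rewrite e1 e2 e3 e4 /is_leaf hh' /is_c /= andbF andbF andbF /=.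
case/orP.
  case/and4P=> /and3P[/eqP w1 w2 w3] /eqP w4 /eqP w5 /eqP w6; right.
  by rewrite /other -w4 -w5 -w6 ltnNge w2 /=; apply: mk_inj.
case/and3P=> wu /eqP w1 w2; right; rewrite /other w2 -w1.
exact: isu_eq wu.
Qed.

Lemma sum_lt k n : k <= n -> \sum_(0 <= d < n) (d < k) = k.
Proof.
move=> le; rewrite (big_cat_nat (n := k)) //= big_nat_cond (eq_bigr (fun _ => 1)); last first.
  by move=> d /andP[/andP[_ ->]].
rewrite -big_nat_cond sum_nat_const_nat subn0 muln1 big_nat_cond big1 ?addn0 // => d.
by case/andP=> /andP[h _] _; rewrite ltnNge h.
Qed.

Lemma sum_pick n i X : i < n -> \sum_(0 <= c < n) (if c == i then X else 0) = X.
Proof.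
move=> hi; rewrite big_mkord (bigD1 (Ordinal hi)) //= eqxx big1 ?addn0 // => c /negbTE h.
by rewrite -(inj_eq val_inj) /= in h; rewrite h.
Qed.

(** Both the neighbourhood of a common vertex and the alliance built from a choice are counted
    through sets of this shape. *)
Lemma card_coded (R : nat -> bool) k (m : nat -> nat -> nat) : k < 4 ->
  (forall b c, c < L -> m b c <= hmax) ->
  #|[set u | [&& R (fe u), fk u == k & fh u < m (fe u) (fi u)]]| =
  \sum_(0 <= b < N) R b * \sum_(0 <= c < L) m b c.
Proof.
move=> hk hm; rewrite card_sumV.
have E a b c : a < 4 -> b < N -> c < L ->
   \sum_(0 <= d < hmax) [&& R (fe (mk a b c d)), fk (mk a b c d) == k
      & fh (mk a b c d) < m (fe (mk a b c d)) (fi (mk a b c d))] =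
   if a == k then R b * m b c else 0.
  move=> ha hb hc; rewrite big_nat_cond.
  rewrite (eq_bigr (fun d => if a == k then R b * (d < m b c) else 0)); last first.
    move=> d /andP[/andP[_ hd] _]; have [-> -> -> ->] := mkE ha hb hc hd.
    by case: (a == k); case: (R b); rewrite /= ?mul1n ?andbF.
  rewrite -big_nat_cond; case: (a == k); last by rewrite sum_nat_const_nat muln0.
  by rewrite -big_distrr /= sum_lt // hm.
transitivity (\sum_(0 <= a < 4) if a == k then \sum_(0 <= b < N) R b * \sum_(0 <= c < L) m b c else 0);
  last exact: sum_pick.
rewrite big_nat_cond [RHS]big_nat_cond; apply: eq_bigr => a /andP[/andP[_ ha] _].
transitivity (\sum_(0 <= b < N) \sum_(0 <= c < L) if a == k then R b * m b c else 0).
  rewrite big_nat_cond [RHS]big_nat_cond; apply: eq_bigr => b /andP[/andP[_ hb] _].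
  rewrite big_nat_cond [RHS]big_nat_cond; apply: eq_bigr => c /andP[/andP[_ hc] _].
  exact: E.
case: (a == k); first by apply: eq_bigr => b _; rewrite big_distrr.
by rewrite big1 // => b _; rewrite big1.
Qed.

Definition u_nbr i u := (fk u == 2) && (fh u < (if fi u == i then yy (fe u) i else 0)).

Lemma U_nbrs i u : i < L -> gadget (U i) u = u_nbr i u.
Proof.
move=> hi; have [e1 e2 e3 e4] := U_E hi.
rewrite /gadget /= /gadget_adj /dir /arc e1 e2 e3 e4 /is_end /is_u /is_c /is_leaf /= ?andbF ?orbF.
rewrite /u_nbr; case: (fk u == 2) => //=; rewrite [i == _]eq_sym.
case: eqP => [<-|_]; rewrite /= ?andbF // andbC; case: ltnP => hy //=.
by have [_ _ hf _] := f_lt u; apply: leq_trans hy _; apply: yy_le_hh.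
Qed.

Lemma card_u_nbr (R : nat -> bool) i : i < L ->
  #|[set u | R (fe u) && u_nbr i u]| = \sum_(0 <= b < N) R b * yy b i.
Proof.
move=> hi; rewrite (@card_coded R 2 (fun b c => if c == i then yy b i else 0)) //; last first.
  by move=> b c hc; case: eqP => // _; apply: leq_trans (hh_le b); apply: yy_le_hh.
by apply: eq_bigr => b _; rewrite sum_pick.
Qed.

(** * From a small alliance to a choice of items *)

Section Alliance.
Variable S : {set V}.
Hypothesis OA : offensive_alliance gadget S.
Hypothesis S_small : #|S| <= budget.

Lemma deg_split v : deg_in gadget S v + deg_in gadget (~: S) v = #|[set u | gadget v u]|.
Proof.
rewrite /deg_in -(cardsID S [set u | gadget v u]); congr (_ + _);
  apply: eq_card => u; rewrite !inE //.
by rewrite andbC.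
Qed.

Lemma oa_nbr v u : v \notin S -> u \in S -> gadget v u ->
  deg_in gadget (~: S) v + 1 <= deg_in gadget S v.
Proof.
move=> hv hu hvu; case: OA => _; apply; rewrite inE hv /=.
by apply/existsP; exists u; rewrite hu -[X in _ && X]/(gadget u v) gadgetC.
Qed.

Lemma deg_C e : e < N -> 2 * budget < #|[set u | gadget (C e) u]|.
Proof.
move=> he.
pose P u := (fk u == 1) && (fe u == e) && ~~ isc u.
apply: (@leq_trans #|[set u | P u]|); last first.
  apply: subset_leq_card; apply/subsetP => u; rewrite !inE => /andP[/andP[/eqP k1 /eqP e1] nc].
  rewrite gadgetC -e1; apply: adj_C.
  by rewrite /isp nc /isu /isn /is_u /is_end k1.
rewrite card_sumV.
have hN : e < N by [].
apply: (@leq_trans (\sum_(0 <= c < L) \sum_(0 <= d < hmax) P (mk 1 e c d))); last first.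
  rewrite 2!big_mkord (bigD1 (Ordinal (isT : 1 < 4))) //= big_mkord (bigD1 (Ordinal hN)) //= big_mkord.
  by rewrite -addnA leq_addr.
rewrite big_mkord (bigD1 (Ordinal L0)) //=.
apply: leq_trans _ (leq_addr _ _).
apply: (@leq_trans (\sum_(1 <= d < hmax) 1)).
  by rewrite sum_nat_const_nat /hmax; move: budget => B; lia.
rewrite [X in _ <= X](big_cat_nat (n := 1)) //=.
apply: leq_trans _ (leq_addl _ _).
rewrite big_nat_cond [X in _ <= X]big_nat_cond; apply: leq_sum => d /andP[/andP[d1 d2] _].
have [m1 m2 m3 m4] := mkE (isT : 1 < 4) he L0 d2.
by rewrite /P /isc m1 m2 m3 m4 /is_c !eqxx /= -lt0n d1.
Qed.

(** Outside the alliance, the centre would need more than half of its over [2 * budget] neighbours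
    inside, which is more than the alliance has vertices. *)
Lemma center_in e x : e < N -> x \in S -> gadget (C e) x -> C e \in S.
Proof.
move=> he hx hc; apply/negPn/negP => nc.
have := oa_nbr nc hx hc; have := deg_C he; rewrite -deg_split.
have : deg_in gadget S (C e) <= #|S|.
  by apply: subset_leq_card; apply/subsetP => u; rewrite inE => /andP[].
lia.
Qed.

(** If neither [v] nor [b] were in [S], then [v] would have one neighbour inside and one outside,
    short of the required surplus. *)
Lemma two_nbrs v a b : (forall w, gadget v w -> w = a \/ w = b) ->
  gadget v a -> gadget v b -> a \in S -> v \in S \/ b \in S.
Proof.
move=> hw ha hb aS; case vS: (v \in S); first by left.
right; apply/negPn/negP => nb.
have := oa_nbr (negbT vS) aS ha.
have : deg_in gadget S v <= 1.
  rewrite -(cards1 a); apply: subset_leq_card; apply/subsetP => w; rewrite !inE => /andP[wS /hw [->|e]] //.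
  by rewrite -e wS in nb.
have : 0 < deg_in gadget (~: S) v.
  by rewrite card_gt0; apply/set0Pn; exists b; rewrite !inE nb.
lia.
Qed.

(** Only an end is not adjacent to the centre; its leaf has just the end and the centre as
    neighbours, so the leaf or the centre is in the alliance. *)
Lemma touch v : v \in S -> ~~ isu v -> C (fe v) \in S.
Proof.
move=> vS nu; have [_ he hi hm] := f_lt v.
case ic: (isc v); first by rewrite -isc_eq.
case ie: (isn v); last first.
  by apply: center_in vS _ => //; rewrite gadgetC; apply: adj_C; rewrite /isp nu ic ie.
case/and3P: (ie) => /eqP k3 h1 h2.
have [g1 g2 g3] := leaf_nbrs he hi h2.
have ev : other (fe v) (fi v) (fh v) = v by rewrite /other ltnNge h1 /= -k3 mkK.
rewrite ev in g2 g3.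
have [lS|//] := two_nbrs (fun w gw => proj1 (or_comm _ _) (g3 w gw)) g2 g1 vS.
by apply: center_in lS _ => //; rewrite gadgetC.
Qed.

Lemma leaf_or_other e i h : e < N -> i < L -> h < hh e -> C e \in S ->
  mk 2 e i h \in S \/ other e i h \in S.
Proof.
move=> he hi hl cS; have [g1 g2 g3] := leaf_nbrs he hi hl.
exact: two_nbrs g3 g1 g2 cS.
Qed.

Lemma card_S_ge (P : nat -> bool) :
  \sum_(0 <= b < N) P b * ((C b \in S) + \sum_(0 <= c < L) \sum_(0 <= d < hmax)
     ((mk 2 b c d \in S) + (mk 3 b c d \in S))) <= #|S|.
Proof.
have -> : #|S| = #|[set v | v \in S]| by apply: eq_card => v; rewrite inE.
rewrite card_sumV [X in _ <= X]big_mkord !big_ord_recl big_ord0 /=.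
rewrite addn0; apply: leq_trans _ (leq_addl _ _).
rewrite -!big_split /=; apply: leq_sum => b _.
apply: (@leq_trans (1 * ((C b \in S) + \sum_(0 <= c < L) \sum_(0 <= d < hmax)
     ((mk 2 b c d \in S) + (mk 3 b c d \in S))))).
  by rewrite leq_mul2r; apply/orP; right; case: (P b).
rewrite mul1n leq_add //.
  rewrite big_mkord (bigD1 (Ordinal L0)) //= big_mkord (bigD1 (Ordinal hmax_gt0)) //=.
  by rewrite -addnA leq_addr.
rewrite -big_split /=; apply: eq_leq; apply: eq_bigr => c _.
by rewrite big_split.
Qed.

(** Were this centre in the alliance, each leaf of coordinate 0 with index at least [2 * t], or its
    end, would be too: more than [budget] vertices. *)
Lemma delta_out : C N0.+1 \notin S.
Proof.
apply/negP => cS.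
have hd : hh N0.+1 = hmax by rewrite /hh ltnn.
have yd i : yy N0.+1 i = 2 * t by rewrite /yy ltnNge leqnSn /= gtn_eqF.
have := card_S_ge (fun b => b == N0.+1).
rewrite big_mkord (bigD1 (Ordinal (ltnSn N0.+1))) //= eqxx mul1n cS.
rewrite big_mkord (bigD1 (Ordinal L0)) //= (big_cat_nat (n := 2 * t)) //=; last first.
  by rewrite /hmax; lia.
have : hmax - 2 * t <= \sum_(2 * t <= d < hmax) ((mk 2 N0.+1 0 d \in S) + (mk 3 N0.+1 0 d \in S)).
  rewrite -[X in X <= _]muln1 -sum_nat_const_nat big_nat_cond [X in _ <= X]big_nat_cond.
  apply: leq_sum => d /andP[/andP[d1 d2] _].
  have := @leaf_or_other N0.+1 0 d (ltnSn _) L0; rewrite hd => /(_ d2 cS).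
  rewrite /other yd ltnNge d1 /=; case=> ->; first by [].
  by rewrite addn1.
move: (\sum_(2 * t <= _ < _) _) => X hX.
have : budget < hmax - 2 * t by rewrite /hmax; move: budget => B; lia.
lia.
Qed.

(** The tree [N0.+1] is joined to every u_i: a leaf between u_i and its centre would draw that
    unaffordable centre into the alliance. *)
Lemma U_out i : i < L -> U i \notin S.
Proof.
move=> hi; apply/negP => uS.
have y0 : 0 < yy N0.+1 i by apply: yy_gt0.
have h0 : 0 < hh N0.+1 by apply: leq_trans (yy_le_hh _ hi).
have [g1 g2 g3] := leaf_nbrs (ltnSn N0.+1) hi h0.
rewrite /other y0 in g2 g3.
have [lS|cS] := two_nbrs (fun w gw => proj1 (or_comm _ _) (g3 w gw)) g2 g1 uS.
  have [hl e1 e2 e3 e4] := leaf_facts (ltnSn N0.+1) hi h0.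
  have := touch lS; rewrite e2 /isu e1 /is_u /= => /(_ isT) cS.
  by have := delta_out; rewrite cS.
by have := delta_out; rewrite cS.
Qed.

Lemma leaf_mem e i h : e < N -> i < L -> h < yy e i -> (mk 2 e i h \in S) = (C e \in S).
Proof.
move=> he hi hy; have hl := leq_trans hy (yy_le_hh e hi).
apply/idP/idP => [lS|cS].
  have [_ e1 e2 e3 e4] := leaf_facts he hi hl.
  by have := touch lS; rewrite e2 /isu e1; exact.
have := leaf_or_other he hi hl cS; rewrite /other hy; case=> // uS.
by have := U_out hi; rewrite uS.
Qed.

(** Leaf-end pairs, and leaves joined to a u_i, cost at least one vertex each, so a tree of an item
    costs at least [(L * ybound).+1] vertices. *)
Lemma chosen_trees : \sum_(0 <= e < N0.+1) (C e \in S) <= G.+1.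
Proof.
have := card_S_ge (fun b => (b <= N0) && (C b \in S)).
rewrite big_nat_recr //= ltnn /= mul0n addn0 => le.
rewrite -(leq_pmul2r (ltn0Sn (L * ybound))) -/budget; apply: leq_trans S_small; apply: leq_trans le.
rewrite big_distrl /= big_nat_cond [X in _ <= X]big_nat_cond; apply: leq_sum => b /andP[/andP[_ hb] _].
have hb' : b <= N0 by [].
have hbN : b < N by rewrite /N; lia.
rewrite hb' /=; case cS: (C b \in S); rewrite ?mul0n // !mul1n /= add1n ltnS.
rewrite -[L in L * _]subn0 -sum_nat_const_nat.
rewrite big_nat_cond [X in _ <= X]big_nat_cond; apply: leq_sum => c /andP[/andP[_ hc] _].
rewrite (big_cat_nat (n := ybound)) //=; last exact: ybound_le_hmax.
apply: leq_trans _ (leq_addr _ _).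
rewrite -[X in X <= _]subn0 -[X in X <= _]muln1 -sum_nat_const_nat.
rewrite big_nat_cond [X in _ <= X]big_nat_cond; apply: leq_sum => d /andP[/andP[_ hd] _].
have hl : d < hh b by rewrite /hh hb'.
have := leaf_or_other hbN hc hl cS; case=> [-> //|]; rewrite /other; case: ltnP => hy oS.
  by have := U_out hc; rewrite oS.
by rewrite oS addn1.
Qed.

Lemma alliance_sums : exists b : nat -> bool,
  \sum_(0 <= e < N0) b e <= G /\
  forall i, i < L -> t <= \sum_(0 <= e < N0) b e * y e i.
Proof.
pose B e := C e \in S.
have [e eN eB] : exists2 e, e < N & B e.
  case: OA => /set0Pn[v vS] _.
  have nu : ~~ isu v.
    apply/negP => /isu_eq ev; have [_ _ hi _] := f_lt v.
    by have := U_out hi; rewrite -ev vS.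
  by exists (fe v); [case: (f_lt v)|exact: touch].
(* All entries are positive, so the one tree [e] known to be chosen already makes every u_i a
   neighbour of the alliance. *)
have key i : i < L -> \sum_(0 <= b < N) ~~ B b * yy b i + 1 <= \sum_(0 <= b < N) B b * yy b i.
  move=> hi; have hu := U_out hi.
  have lS : mk 2 e i 0 \in S by rewrite leaf_mem // yy_gt0.
  have h0 : 0 < hh e by apply: leq_trans (yy_le_hh _ hi); exact: yy_gt0.
  have gl : gadget (U i) (mk 2 e i 0).
    have [_ gg _] := leaf_nbrs eN hi h0.
    by move: gg; rewrite /other yy_gt0 // gadgetC.
  have := oa_nbr hu lS gl.
  have M u : gadget (U i) u -> (u \in S) = B (fe u).
    rewrite U_nbrs // /u_nbr; case: eqP => //= k2; case: eqP => // ei hy.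
    have [_ he hi' _] := f_lt u.
    have -> : u = mk 2 (fe u) i (fh u) by apply: mk_inj.
    rewrite leaf_mem //.
    by have [_ _ -> _ _] := leaf_facts he hi (leq_trans hy (yy_le_hh _ hi)).
  rewrite -!card_u_nbr // => le; apply: leq_trans (leq_trans _ le) _.
    rewrite leq_add2r subset_leq_card //; apply/subsetP => u; rewrite !inE -U_nbrs //.
    by case gu: (gadget (U i) u); rewrite ?andbF // M.
  apply: subset_leq_card; apply/subsetP => u; rewrite !inE -U_nbrs //.
  by case gu: (gadget (U i) u); rewrite ?andbF // M.
have yf i : yy N0 i = (tot i).+1 by rewrite /yy ltnn eqxx.
have yd i : yy N0.+1 i = 2 * t by rewrite /yy ltnNge leqnSn /= gtn_eqF.
have sy (P : nat -> bool) i : \sum_(0 <= b < N0) P b * yy b i = \sum_(0 <= b < N0) P b * y b i.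
  by rewrite big_nat_cond [RHS]big_nat_cond; apply: eq_bigr => b /andP[/andP[_ h] _]; rewrite /yy h.
have st i : \sum_(0 <= b < N0) ~~ B b * y b i + \sum_(0 <= b < N0) B b * y b i = tot i.
  by rewrite -big_split; apply: eq_bigr => b _; case: (B b); rewrite /= ?mul1n ?mul0n ?addn0.
have BD : B N0.+1 = false by apply/negbTE; exact: delta_out.
(* Let X be the chosen part of T = [tot i]. If the balancing tree were not chosen, it would put T +
   1 on the outer side, while X <= T. Otherwise the condition reads (T - X) + 2t + 1 <= X + T + 1,
   that is t <= X. *)
have kk i : i < L -> B N0 /\ t <= \sum_(0 <= b < N0) B b * y b i.
  move=> hi; have := key i hi; rewrite /N !big_nat_recr //= BD /= !sy yf yd.
  have := st i; case: (B N0) => /=; lia.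
exists B; split=> [|i hi]; last by have [] := kk i hi.
have := chosen_trees; rewrite big_nat_recr //=; have [BN _] := kk 0 L0.
by rewrite -/(B N0) BN addn1 ltnS.
Qed.

End Alliance.

(** * From a choice of items to an alliance *)

Lemma one_nbr (S : {set V}) u v : (forall w, gadget v w -> w = u) -> u \in S ->
  gadget v u -> deg_in gadget (~: S) v + 1 <= deg_in gadget S v.
Proof.
move=> hw uS gu.
have -> : deg_in gadget (~: S) v = 0.
  apply: eq_card0 => w; rewrite !inE; apply/negP => /andP[wS /hw e].
  by rewrite e uS in wS.
by rewrite add0n card_gt0; apply/set0Pn; exists u; rewrite inE uS.
Qed.

Lemma sums_alliance (b : nat -> bool) :
  \sum_(0 <= e < N0) b e <= G ->
  (forall i, i < L -> t <= \sum_(0 <= e < N0) b e * y e i) ->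
  exists2 S : {set V}, offensive_alliance gadget S & 1 <= #|S| <= budget.
Proof.
move=> bG bt; pose A e := (e < N0) && b e || (e == N0).
(* With the centres and all leaves of the chosen trees inside, a neighbour of [S] is an end or a
   pendant vertex, which has a single neighbour, or some u_i, where the sums decide. *)
pose S := [set v | A (fe v) && (isc v || isl v)].
have AN : A N0 by rewrite /A eqxx orbT.
have Ale e : A e -> e <= N0 by case/orP => [/andP[] /ltnW|/eqP ->].
have N0N : N0 < N by [].
have CS : C N0 \in S.
  have [e1 e2 e3 e4] := C_E N0N.
  by rewrite inE /isc e1 e2 e3 e4 AN.
have yf i : yy N0 i = (tot i).+1 by rewrite /yy ltnn eqxx.
have yd i : yy N0.+1 i = 2 * t by rewrite /yy ltnNge leqnSn /= gtn_eqF.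
have AD : A N0.+1 = false by rewrite /A ltnNge leqnSn /= gtn_eqF.
have sA (F : nat -> nat) : \sum_(0 <= e < N0) A e * F e = \sum_(0 <= e < N0) b e * F e.
  rewrite big_nat_cond [RHS]big_nat_cond; apply: eq_bigr => e /andP[/andP[_ h] _].
  by rewrite /A h /= ltn_eqF // orbF.
have Scard : #|S| <= budget.
  apply: (@leq_trans (#|[set u | [&& A (fe u), fk u == 1 & fh u < (if fi u == 0 then 1 else 0)]]| +
    #|[set u | [&& A (fe u), fk u == 2 & fh u < ybound]]|)).
    apply: leq_trans (leq_card_setU _ _); apply: subset_leq_card; apply/subsetP => u.
    rewrite !inE => /andP[Au]; rewrite Au /=; case/orP.
      by case/and3P=> -> /eqP -> /eqP ->.
    case/andP=> ->; rewrite /hh Ale // => ->; exact: orbT.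
  rewrite (@card_coded A 1 (fun b c => if c == 0 then 1 else 0)) //; last first.
    by move=> ? c _; case: (c == 0); rewrite ?hmax_gt0.
  rewrite (@card_coded A 2 (fun b c => ybound)) //; last by move=> *; exact: ybound_le_hmax.
  rewrite sum_nat_const_nat subn0 -big_split /=.
  rewrite (eq_bigr (fun e => A e * (L * ybound).+1)); last first.
    by move=> e _; rewrite sum_pick // -mulnDr add1n.
  rewrite -big_distrl /= /budget leq_mul2r; apply/orP; right.
  rewrite /N !big_nat_recr //= AD AN addn0 addn1 ltnS.
  have := sA (fun=> 1); under eq_bigr => e _ do rewrite muln1.
  by move=> ->; under eq_bigr => e _ do rewrite muln1.
exists S; last by rewrite Scard andbT card_gt0; apply/set0Pn; exists (C N0).
split; first by apply/set0Pn; exists (C N0).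
move=> v; rewrite inE => /andP[vS /existsP[u /andP[uS gvu]]].
have uS' := uS; rewrite inE in uS'; case/andP: uS' => Au ucl.
have nuu : ~~ isu u.
  by case/orP: ucl; rewrite /isc /isl /isu /is_u /is_c /is_leaf; case/andP=> /eqP ->.
have nun : ~~ isn u.
  by case/orP: ucl; rewrite /isc /isl /isn /is_end /is_c /is_leaf; case/andP=> /eqP ->.
case vu: (isu v).
  have [_ _ hi _] := f_lt v; rewrite (isu_eq vu); set i := fi v in hi *.
  have M w : gadget (U i) w -> (w \in S) = A (fe w).
    rewrite U_nbrs // inE /u_nbr; case: eqP => //= k2; case: eqP => // ei hy.
    have -> : isl w by rewrite /isl /is_leaf k2 (leq_trans hy) //; apply: yy_le_hh.
    by rewrite orbT andbT.
  apply: (@leq_trans (#|[set u | ~~ A (fe u) && u_nbr i u]| + 1)).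
    rewrite leq_add2r subset_leq_card //; apply/subsetP => w; rewrite !inE -U_nbrs //.
    by case gw: (gadget (U i) w); rewrite ?andbF //= !andbT; have := M w gw; rewrite inE => ->.
  apply: (@leq_trans #|[set u | A (fe u) && u_nbr i u]|); last first.
    apply: subset_leq_card; apply/subsetP => w; rewrite !inE -U_nbrs //.
    by case gw: (gadget (U i) w); rewrite ?andbF //= !andbT; have := M w gw; rewrite inE => ->.
  rewrite (card_u_nbr (fun e => ~~ A e)) // (card_u_nbr A) //.
  rewrite /N !big_nat_recr //= AD AN /= yf yd.
  have sy (P : nat -> bool) : \sum_(0 <= b < N0) P b * yy b i = \sum_(0 <= b < N0) P b * y b i.
    by rewrite big_nat_cond [RHS]big_nat_cond; apply: eq_bigr => e /andP[/andP[_ h] _]; rewrite /yy h.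
  have st : \sum_(0 <= b < N0) ~~ A b * y b i + \sum_(0 <= b < N0) A b * y b i = tot i.
    by rewrite -big_split; apply: eq_bigr => e _; case: (A e); rewrite /= ?mul1n ?mul0n ?addn0.
  rewrite !sy; have := bt i hi; rewrite -sA; lia.
have nuv := negbT vu.
have [_ hev hiv hhv] := f_lt v.
rewrite gadgetC in gvu; have : dir v u || dir u v by exact: gvu.
rewrite /dir /arc -!/(isu _) -!/(isc _) -!/(isn _) -!/(isl _).
rewrite (negbTE nuu) (negbTE nun) vu /= !orbF => /orP[/orP[]|].
- case/and5P=> nv lu /eqP e1 /eqP e2 /eqP e3.
  apply: one_nbr uS gvu => w gw; have {gw} : dir v w || dir w v by exact: gw.
  rewrite /dir /arc -!/(isu _) -!/(isc _) -!/(isn _) -!/(isl _).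
  have nlv : isl v = false by case/and3P: nv => /eqP k3 _ _; rewrite /isl /is_leaf k3.
  have ncv : isc v = false by case/and3P: nv => /eqP k3 _ _; rewrite /isc /is_c k3.
  rewrite nv vu nlv ncv /= ?andbF ?orbF => /and4P[lw /eqP f2 /eqP f3 /eqP f4].
  rewrite -[w]mkK -[u]mkK -f2 -f3 -f4 -e1 -e2 -e3.
  by case/andP: lw => /eqP -> _; case/andP: lu => /eqP -> _.
- case/and4P=> ncv nnv uc /eqP ee.
  have nlv : isl v = false.
    by apply/negbTE; move: vS; rewrite inE ee Au; apply: contra => ->; rewrite orbT.
  apply: one_nbr uS gvu => w gw; have {gw} : dir v w || dir w v by exact: gw.
  rewrite /dir /arc -!/(isu _) -!/(isc _) -!/(isn _) -!/(isl _).
  rewrite (negbTE ncv) (negbTE nnv) vu nlv /= ?andbF ?orbF => /andP[wc /eqP ew].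
  by rewrite (isc_eq wc) (isc_eq uc) -ew -ee.
case/and3P=> _ vc /eqP ee.
by move: vS; rewrite inE -ee Au vc.
Qed.

Lemma gadget_correct :
  (exists S : {set V}, offensive_alliance gadget S /\ 1 <= #|S| <= budget) <->
  (exists b : nat -> bool, \sum_(0 <= e < N0) b e <= G /\
     forall i, i < L -> t <= \sum_(0 <= e < N0) b e * y e i).
Proof.
split=> [[S [OA /andP[_ small]]]|[b [h1 h2]]]; first exact: alliance_sums OA small.
by have [S h3 h4] := sums_alliance h1 h2; exists S.
Qed.

(** * The common vertices as a deletion set *)

Let D := [set v | isu v].

Lemma card_D : #|D| <= L.
Proof.
apply: (@leq_trans #|[set U (val i) | i : 'I_L]|); last first.
  by apply: leq_trans (leq_imset_card _ _) _; rewrite card_ord.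
apply: subset_leq_card; apply/subsetP => v; rewrite inE => uv.
have [_ _ hi _] := f_lt v; apply/imsetP; exists (Ordinal hi) => //.
exact: isu_eq.
Qed.

Let center v := C (fe v).
Let par v := if isn v then mk 2 (fe v) (fi v) (fh v) else center v.
Let rk v := if isn v then 2 else if isc v then 0 else 1.

Lemma arc_par u v : ~~ isu u -> dir u v -> v = par u /\ rk v < rk u.
Proof.
move=> nu; rewrite /dir /arc -/(isu u) (negbTE nu) -!/(isc _) -!/(isn _) -!/(isl _) /= orbF.
case/orP.
  case/and5P=> nn lv /eqP e1 /eqP e2 /eqP e3; rewrite /par /rk nn.
  case/andP: (lv) => /eqP k2 _; rewrite /isn /is_end /isc /is_c k2 /=; split=> //.
  by apply: mk_inj.
case/and4P=> nc nn vc /eqP ee; rewrite /par /rk (negbTE nn) (negbTE nc) vc.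
have -> : isn v = false by case/and3P: vc => /eqP k _ _; rewrite /isn /is_end k.
by split=> //; rewrite (isc_eq vc) /center ee.
Qed.

Lemma dir_fe u v : ~~ isu u -> dir u v -> fe u = fe v.
Proof.
move=> nu; rewrite /dir /arc -/(isu u) (negbTE nu) /= orbF.
by case/orP=> [/and5P[_ _ /eqP]|/and4P[_ _ _ /eqP]].
Qed.

Lemma induced_fe u v : connect (induced gadget (~: D)) u v -> fe v = fe u.
Proof.
case/connectP=> p; elim: p u => [|w p IH] u /=; first by move=> _ ->.
case/andP=> /and3P[]; rewrite !inE => nu nw g pw e.
rewrite (IH w pw e); move: g; rewrite /gadget /= /gadget_adj.
by case/orP=> /dir_fe ->.
Qed.

Lemma induced_sym A : symmetric (induced gadget A).
Proof.
move=> u v; have g : gadget u v = gadget v u by exact: gadgetC.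
by rewrite /induced /=; case: (u \in A); case: (v \in A) => //=; exact: g.
Qed.

Lemma center_path v : ~~ isu v -> exists p,
  [/\ path (induced gadget (~: D)) (center v) p, last (center v) p = v & size p <= 2].
Proof.
move=> nu; have [hk he hi hm] := f_lt v.
have step a b : ~~ isu a -> ~~ isu b -> gadget a b -> induced gadget (~: D) a b.
  by move=> na nb g; apply/and3P; split; rewrite // !inE.
have hC : ~~ isu (center v) by have [e1 _ _ _] := C_E he; rewrite /isu e1.
case cv: (isc v); first by exists [::]; split=> //=; rewrite /center -isc_eq.
case nv: (isn v); last first.
  exists [:: v]; split=> //; apply/andP; split=> //; apply: step => //.
  by rewrite gadgetC adj_C ?/isp ?nu ?cv ?nv.
case/and3P: (nv) => /eqP k3 h1 h2.
have [g1 g2 _] := leaf_nbrs he hi h2.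
have [hl e1 _ _ _] := leaf_facts he hi h2.
have nl : ~~ isu (mk 2 (fe v) (fi v) (fh v)) by rewrite /isu e1.
have ev : other (fe v) (fi v) (fh v) = v by rewrite /other ltnNge h1 /= -k3 mkK.
rewrite ev in g2; rewrite gadgetC in g1.
exists [:: mk 2 (fe v) (fi v) (fh v); v]; split=> //.
by rewrite /path !step.
Qed.

Lemma center_connect v : ~~ isu v -> connect (induced gadget (~: D)) (center v) v.
Proof. by move=> /center_path[p [h1 h2 _]]; apply/connectP; exists p. Qed.

Lemma gadget_tree_deletion h : 2 <= h -> tree_deletion_set gadget h D.
Proof.
move=> h2 v; rewrite !inE => nv.
set K := component gadget (~: D) v.
have sc : connect_sym (induced gadget (~: D)).
  by apply: sym_connect_sym; exact: induced_sym.
have Ku u : u \in K -> ~~ isu u /\ fe u = fe v.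
  rewrite inE => c; split; last exact: induced_fe c.
  case/connectP: c => p pp ->.
  elim: p (v) nv pp => [|w p IH] x nx //= /andP[/and3P[_ hw _] pw].
  by apply: IH pw; move: hw; rewrite !inE.
have cK : center v \in K by rewrite inE sc center_connect.
have inK p x : x \in K -> path (induced gadget (~: D)) x p -> path (induced gadget K) x p.
  elim: p x => [|w p IH] x xK //= /andP[g pw].
  have wK : w \in K.
    move: xK; rewrite !inE => c; apply: connect_trans c (connect1 g).
  apply/andP; split; last exact: IH.
  by apply/and3P; split=> //; case/and3P: g.
split; last first.
  exists (center v) => // u uK; have [nu eu] := Ku u uK.
  have [p [p1 p2 p3]] := center_path nu.
  have ce : center u = center v by rewrite /center eu.
  rewrite ce in p1 p2.
  by exists p; split; [exact: inK|by []|exact: leq_trans h2].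
split.
- by apply/set0Pn; exists (center v).
- move=> x z xK zK.
  have H w : w \in K -> connect (induced gadget K) (center v) w.
    move=> wK; have [nw ew] := Ku w wK.
    have [p [p1 p2 p3]] := center_path nw.
    have ce : center w = center v by rewrite /center ew.
    rewrite ce in p1 p2; apply/connectP; exists p => //; exact: inK.
  apply: connect_trans (H z zK).
  rewrite sym_connect_sym; [exact: H|exact: induced_sym].
(* The rank is 0 for centres, 1 for leaves and pendant vertices, 2 for ends, and every remaining
   edge joins a vertex to its parent, of smaller rank. *)
apply: (@forest_acyclic _ _ par rk) => x z /and3P[xK zK].
have [nx _] := Ku x xK; have [nz _] := Ku z zK.
by rewrite /gadget /= /gadget_adj => /orP[/(arc_par nx)|/(arc_par nz)]; [left|right].
Qed.

Lemma gadget_deletion_number h : 2 <= h -> tree_deletion_number gadget h <= L.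
Proof.
move=> h2; apply: leq_trans card_D; rewrite /tree_deletion_number.
case: arg_minnP => [|D' _ hD']; last by apply: hD'; apply/asboolP; exact: gadget_tree_deletion.
by apply/asboolP => v; rewrite !inE.
Qed.

End Gadget.

(** * Newton expansion of Boolean functions *)

(** Tuples are coded by numbers, least significant digit first, so that sums over tuples are bounded
    sums of the expression language. *)
Fixpoint digits (M q x : nat) : seq nat :=
  if q is q'.+1 then x %% M :: digits M q' (x %/ M) else [::].

Fixpoint undigits (M : nat) (l : seq nat) : nat :=
  if l is x :: l' then x + M * undigits M l' else 0.

Lemma size_digits M q x : size (digits M q x) = q.
Proof. by elim: q x => //= q IH x; rewrite IH. Qed.

Lemma digits_lt M q x y : 0 < M -> y \in digits M q x -> y < M.
Proof.
move=> M0; elim: q x => //= q IH x; rewrite inE => /orP[/eqP ->|]; last exact: IH.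
by rewrite ltn_mod.
Qed.

Lemma nth_digits_lt M q x j : 0 < M -> nth 0 (digits M q x) j < M.
Proof.
move=> M0; case: (ltnP j q) => h; last by rewrite nth_default ?size_digits.
by apply: (@digits_lt M q x) => //; rewrite mem_nth ?size_digits.
Qed.

Lemma digits_cons M q x y : x < M -> digits M q.+1 (x + M * y) = x :: digits M q y.
Proof.
move=> hx /=; have M0 : 0 < M by lia.
by rewrite addnC mulnC modnMDl modn_small // divnMDl // divn_small // addn0.
Qed.

Lemma undigitsK M q l : size l = q -> all (fun x => x < M) l ->
  digits M q (undigits M l) = l.
Proof.
elim: l q => [|x l IH] [|q] //= [hs] /andP[hx hl].
by rewrite -/(digits M q.+1 (x + M * undigits M l)) digits_cons // IH.
Qed.

Lemma undigits_lt M l : all (fun x => x < M) l -> undigits M l < M ^ size l.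
Proof.
elim: l => [|x l IH] //= /andP[hx /IH h].
rewrite expnS; move: (M ^ size l) (undigits M l) h => A B h; nia.
Qed.

Lemma digits0 M q : digits M q 0 = nseq q 0.
Proof. by elim: q => //= q IH; rewrite mod0n div0n IH. Qed.

Section Newton.
Local Open Scope ring_scope.
Import GRing.Theory.

Lemma sum_mul (V : nmodType) M K (Phi : nat -> V) :
  \sum_(0 <= x < M * K) Phi x =
  \sum_(0 <= x < M) \sum_(0 <= y < K) Phi (x + M * y)%N.
Proof.
rewrite exchange_big_nat /=; elim: K => [|K IH]; first by rewrite muln0 !big_geq.
rewrite big_nat_recr //= -IH mulnS addnC.
rewrite (big_cat_nat (n := (M * K)%N)) ?leq_addr //=; congr (_ + _).
rewrite -{1}[(M * K)%N]add0n big_addn addKn.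
by apply: eq_bigr => x _; rewrite addnC.
Qed.

Lemma sum_digits (V : nmodType) M q (Phi : seq nat -> V) :
  \sum_(0 <= x < M ^ q.+1) Phi (digits M q.+1 x) =
  \sum_(0 <= x < M) \sum_(0 <= y < M ^ q) Phi (x :: digits M q y).
Proof.
rewrite expnS sum_mul big_nat_cond [RHS]big_nat_cond; apply: eq_bigr => x /andP[/andP[_ hx] _].
by apply: eq_bigr => y _; rewrite digits_cons.
Qed.

Definition delta (a : nat) (F : (nat -> bool) -> int) : (nat -> bool) -> int :=
  fun al => F (upd al a true) - F (upd al a false).

(** Degree at most [q], through iterated differences instead of an explicit polynomial. The base
    case asks for constancy, which vanishing differences do not give on infinitely many
    variables. *)
Fixpoint pdeg (q : nat) (F : (nat -> bool) -> int) : Prop :=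
  if q is q'.+1 then forall a, pdeg q' (delta a F) else forall al be, F al = F be.

Lemma pdeg_cst q F : (forall al be, F al = F be) -> pdeg q F.
Proof.
elim: q F => [|q IH] F h //= a; apply: IH => al be; rewrite /delta.
by rewrite (h (upd al a true) (upd al a false)) (h (upd be a true) (upd be a false)) !subrr.
Qed.

Lemma pdeg_add q F H : pdeg q F -> pdeg q H -> pdeg q (fun al => F al + H al).
Proof.
elim: q F H => [|q IH] F H /= hF hH; first by move=> al be; rewrite (hF al be) (hH al be).
move=> a; have := IH _ _ (hF a) (hH a).
congr (pdeg q _); apply/funext => al; rewrite /delta opprD.
by rewrite addrACA.
Qed.

Lemma pdeg_sum q n (F : nat -> (nat -> bool) -> int) : (forall j, (j < n)%N -> pdeg q (F j)) ->
  pdeg q (fun al => \sum_(0 <= j < n) F j al).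
Proof.
elim: n => [|n IH] h; first by apply: pdeg_cst => al be; rewrite !big_geq.
have := pdeg_add (IH (fun j hj => h j (ltnW hj))) (h n (ltnSn n)).
by congr (pdeg q _); apply/funext => al; rewrite big_nat_recr.
Qed.

Definition junta (T : Type) (V : seq nat) (F : (nat -> bool) -> T) : Prop :=
  forall al be, {in V, al =1 be} -> F al = F be.

(** A difference in a variable of [V] no longer depends on that variable, and a difference in any
    other variable vanishes. *)
Lemma junta_pdeg q V F : junta V F -> (size V <= q)%N -> pdeg q F.
Proof.
elim: q V F => [|q IH] V F h hs /=.
  by move=> al be; apply: h => v; move: hs; rewrite leqn0 => /nilP ->.
move=> a; case: (boolP (a \in V)) => aV; last first.
  apply: pdeg_cst => al be; rewrite /delta.
  suff E ga : F (upd ga a true) = F (upd ga a false) by rewrite !E !subrr.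
  by apply: h => v vV; rewrite /upd; case: eqP => // e; rewrite -e vV in aV.
apply: (IH (filter (predC1 a) V)).
  move=> al be e; rewrite /delta; congr (_ - _); apply: h => v vV; rewrite /upd;
  by case: eqP => // /eqP va; apply: e; rewrite mem_filter /= va.
rewrite size_filter -ltnS; apply: leq_trans hs.
by rewrite -(count_predC (predC1 a) V) -[X in (X < _)%N]addn0 ltn_add2l -has_count;
  apply/hasP; exists a => //=; rewrite negbK.
Qed.

(* The coefficient, in the Newton expansion, of the monomial with index set [bs];
   entries are shifted by one, [0] standing for no index. *)
Fixpoint newton (F : (nat -> bool) -> int) (bs : seq nat) (al : (nat -> bool)) : int :=
  match bs with
  | [::] => F al
  | b :: bs' => if b == 0%N then newton F bs' al
                else newton F bs' (upd al b.-1 true) - newton F bs' al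
  end.

Lemma updC (T : Type) (f : nat -> T) a b x y : a != b ->
  upd (upd f a x) b y = upd (upd f b y) a x.
Proof.
move=> /eqP n; apply/funext => j; rewrite /upd.
by case: eqP => // ->; case: eqP => // e; case: n.
Qed.

(** Updates at distinct places commute; the hypothesis, with the shift of the entries, says that [a]
    differs from all indices in [bs]. *)
Lemma newton_delta F a bs al : a.+1 \notin bs ->
  newton (delta a F) bs al = newton F bs (upd al a true) - newton F bs (upd al a false).
Proof.
elim: bs al => [|b bs IH] al //=; rewrite inE negb_or => /andP[ab hb].
rewrite !IH //; case: eqP => // /eqP b0.
have n : a != b.-1 by apply: contraNneq ab => ->; rewrite prednK // lt0n.
rewrite !(updC _ _ _ n).
move: (newton _ _ _) (newton _ _ _) (newton _ _ _) (newton _ _ _) => A B C E; lia.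
Qed.

Lemma newton_nseq0 F q al : newton F (nseq q 0%N) al = F al.
Proof. by elim: q. Qed.

(** Increasing entries above [lo], then zeros only: the unique representative of an index set, so
    that each monomial occurs once in the expansion. *)
Fixpoint canon (lo : nat) (t : seq nat) : bool :=
  if t is x :: t' then if x == 0%N then all (pred1 0%N) t' else (lo < x)%N && canon x t'
  else true.

Lemma canon_gt lo t x : canon lo t -> x \in t -> x != 0%N -> (lo < x)%N.
Proof.
elim: t lo => //= z t IH lo; case: eqP => [->|_].
  move=> /allP h; rewrite inE => /orP[/eqP ->|/h /eqP ->] //.
case/andP=> lz cz; rewrite inE => /orP[/eqP -> //|xt] x0.
by apply: ltn_trans lz _; apply: IH.
Qed.

Lemma sum_all0 M q (Phi : seq nat -> int) : (0 < M)%N ->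
  \sum_(0 <= x < M ^ q) (if all (pred1 0%N) (digits M q x) then Phi (digits M q x) else 0) =
  Phi (nseq q 0%N).
Proof.
move=> M0; elim: q Phi => [|q IH] Phi; first by rewrite expn0 big_nat1.
rewrite (sum_digits M q (fun t => if all (pred1 0%N) t then Phi t else 0)).
rewrite big_ltn // [X in _ + X](_ : _ = 0) ?addr0; last first.
  rewrite big_nat_cond big1 // => x /andP[/andP[hx _] _].
  by apply: big1 => y _; rewrite /= gtn_eqF.
exact: (IH (fun t => Phi (0%N :: t))).
Qed.

(** * Newton expansion along an increasing sequence *)

Section Expansion.
Variables (k : nat) (a : nat -> nat).
Hypothesis a0 : a 0%N = 0%N.
Hypothesis a_mono : forall i, (0 < i < k)%N -> (a i < a i.+1)%N.
Hypothesis a_pos : forall i, (0 < i <= k)%N -> (0 < a i)%N.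

Lemma a_lt i j : (0 < i)%N -> (i < j)%N -> (j <= k)%N -> (a i < a j)%N.
Proof.
move=> i0; elim: j => // j IH; rewrite ltnS leq_eqVlt => /orP[/eqP <-|ij] jk.
  by apply: a_mono; lia.
by apply: ltn_trans (IH ij (ltnW jk)) _; apply: a_mono; lia.
Qed.

Definition adds (lo : nat) (al : (nat -> bool)) : (nat -> bool) :=
  fun v => al v || has (fun i => (lo < i)%N && (a i == v.+1)) (iota 1 k).

Lemma adds_k al : adds k al = al.
Proof.
apply/funext => v; rewrite /adds; case: hasP => [[i]|_]; last by rewrite orbF.
by rewrite mem_iota => ? /andP[]; lia.
Qed.

Lemma adds_at lo al : (forall i, (lo < i <= k)%N -> al (a i).-1 = false) ->
  (lo < k)%N -> upd (adds lo.+1 al) (a lo.+1).-1 true = adds lo al /\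
  upd (adds lo.+1 al) (a lo.+1).-1 false = adds lo.+1 al.
Proof.
move=> h lk; have p := a_pos (ltac:(lia) : (0 < lo.+1 <= k)%N).
split; apply/funext => v; rewrite /upd /adds; case: eqP => // e.
- apply/esym/orP; right; apply/hasP; exists lo.+1; first by rewrite mem_iota; lia.
  by rewrite ltnSn e prednK //=.
- case: (al v) => //=; apply: eq_in_has => i; rewrite mem_iota => ik.
  case: (ltngtP lo.+1 i) => [//|//|<-] /=.
  by apply/esym/eqP => e'; apply: e; rewrite e'.
- rewrite e h ?ltnSn //=; apply/esym/negbTE/hasP => -[i]; rewrite mem_iota => ik /andP[li /eqP e'].
  by have := @a_lt lo.+1 i isT li (ltac:(lia)); rewrite e' prednK // ltnn.
Qed.

(** Turning on the elements from [a m] down to [a lo.+1], the step for [x] changes [F] by its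
    difference in [a x], taken where only larger indices are on. *)
Lemma telescope_adds F al lo m : (forall i, (lo < i <= k)%N -> al (a i).-1 = false) ->
  (lo <= m)%N -> (m <= k)%N ->
  \sum_(0 <= x < m.+1) (if (lo < x)%N then delta (a x).-1 F (adds x al) else 0) =
  F (adds lo al) - F (adds m al).
Proof.
move=> h; elim: m => [|m IH] lm mk.
  by rewrite big_nat1 ltn0; move: lm; rewrite leqn0 => /eqP ->; rewrite subrr.
rewrite big_nat_recr //=; move: lm; rewrite leq_eqVlt => /orP[/eqP <-|lm].
  rewrite ltnn addr0 subrr big_nat_cond big1 // => x /andP[/andP[_ hx] _].
  by rewrite ltnNge (ltnW hx).
rewrite IH ?lm //; try lia.
have [e1 e2] := @adds_at m al (fun i hi => h i (ltac:(lia))) mk.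
by rewrite /delta e1 e2 addrA subrK.
Qed.

(** Tuples are sorted by their least index [x]. The zero tuple gives [F al]; by telescoping, the
    rest is a sum of differences in [a x], of degree one less, which the induction expands over the
    indices above [x]. *)
Lemma newton_expansion q F al lo : pdeg q F -> (lo <= k)%N ->
  (forall i, (lo < i <= k)%N -> al (a i).-1 = false) ->
  F (adds lo al) = \sum_(0 <= x < k.+1 ^ q)
    (if canon lo (digits k.+1 q x) then newton F (map a (digits k.+1 q x)) al else 0).
Proof.
elim: q F al lo => [|q IH] F al lo hF lk h.
  by rewrite expn0 big_nat1 /=; exact: hF.
rewrite (sum_digits k.+1 q (fun t => if canon lo t then newton F (map a t) al else 0)).
rewrite big_ltn //=.
rewrite (sum_all0 q (fun t => newton F (map a (0%N :: t)) al)) //=.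
rewrite a0 eqxx map_nseq a0 newton_nseq0.
have := telescope_adds F h lk (leqnn k); rewrite adds_k => T.
rewrite -[F (adds lo al)](subrK (F al)) -T addrC; congr (_ + _).
rewrite [LHS]big_ltn // ltn0 add0r big_nat_cond [RHS]big_nat_cond.
apply: eq_bigr => x /andP[/andP[x0 xk] _]; rewrite gtn_eqF //.
case lx: (lo < x)%N; last by rewrite big1.
have hx i : (x < i <= k)%N -> al (a i).-1 = false by move=> ?; apply: h; lia.
rewrite (IH _ _ _ (hF (a x).-1) (xk : (x <= k)%N) hx); apply: eq_bigr => y _ /=.
case cy: (canon x _) => //.
have ax := a_pos (ltac:(lia) : (0 < x <= k)%N).
rewrite gtn_eqF // newton_delta; last first.
  rewrite prednK //; apply/mapP => -[z zy e].
  case: (posnP z) => z0; first by move: ax; rewrite e z0 a0.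
  have zk : (z < k.+1)%N by apply: (@digits_lt k.+1 q y).
  have xz := canon_gt cy zy (ltac:(by rewrite -lt0n)).
  by have := a_lt x0 xz zk; rewrite e ltnn.
(* [al] is false at this element, so the update to [false] made by the difference changes
   nothing. *)
congr (_ - newton _ _ _); apply/funext => v; rewrite /upd; case: eqP => // ->.
by rewrite h // lx -ltnS.
Qed.

End Expansion.

End Newton.

(** * Atoms of a circuit of weft one *)

(* The set listed by [Us], whose entries are shifted by one; zeros are ignored. *)
Definition listed (Us : seq nat) : nat -> bool := fun v => has (fun U => U == v.+1) Us.

(** The positive and negative parts of a Newton coefficient, kept apart so that only natural numbers
    occur: they go to opposite sides of an equation. [Us] collects the indices turned on. *)
Fixpoint signed (f : seq nat -> nat) (sg : bool) (bs Us : seq nat) : nat :=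
  match bs with
  | [::] => if sg then f Us else 0
  | b :: bs' => if b == 0 then signed f sg bs' Us
                else signed f sg bs' (b :: Us) + signed f (~~ sg) bs' Us
  end.

Lemma listed_cons b Us : 0 < b -> listed (b :: Us) = upd (listed Us) b.-1 true.
Proof.
move=> b0; apply/funext => v; rewrite /listed /upd /=.
have -> : (b == v.+1) = (v == b.-1) by apply/eqP/eqP; lia.
by case: eqP.
Qed.

Lemma newton_signed (F : (nat -> bool) -> int) (f : seq nat -> nat) bs Us :
  (forall Us, F (listed Us) = f Us) ->
  newton F bs (listed Us) = (Posz (signed f true bs Us) - Posz (signed f false bs Us))%R.
Proof.
move=> h; elim: bs Us => [|b bs IH] Us /=; first by rewrite h GRing.subr0.
case: eqP => [//|/eqP b0]; rewrite -listed_cons ?lt0n // !IH; lia.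
Qed.

Lemma signed_le f m sg bs Us : (forall Us, f Us <= m) ->
  signed f sg bs Us <= 2 ^ size bs * m.
Proof.
move=> h; elim: bs sg Us => [|b bs IH] sg Us /=.
  by rewrite expn0 mul1n; case: sg.
rewrite expnS; case: (b == 0).
  by apply: leq_trans (IH _ _) _; rewrite leq_mul2r leq_pmull ?orbT.
have := IH sg (b :: Us); have := IH (~~ sg) Us; move: (2 ^ _) => X; nia.
Qed.

Lemma sum_all_iota (P : nat -> bool) m :
  (m <= \sum_(0 <= j < m) P j) = all P (iota 0 m).
Proof.
have le : forall m, \sum_(0 <= j < m) P j <= m.
  elim=> [|k IH]; first by rewrite big_geq.
  by rewrite big_nat_recr //=; case: (P k); lia.
elim: m => [|m IH]; first by rewrite big_geq.
rewrite big_nat_recr // -(addn1 m) iotaD all_cat -IH /= add0n andbT.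
by have := le m; case: (P m); rewrite ?andbT ?andbF; lia.
Qed.

Lemma sum_has_iota (P : nat -> bool) m :
  (0 < \sum_(0 <= j < m) P j) = has P (iota 0 m).
Proof.
elim: m => [|m IH]; first by rewrite big_geq.
rewrite big_nat_recr // -(addn1 m) iotaD has_cat -IH /= add0n orbF.
by case: (P m); rewrite ?orbT ?orbF; lia.
Qed.

Section Gates.
Variables (n d : nat) (tag na : nat -> nat) (arg : nat -> nat -> nat).

(** Recursion on a depth bound rather than on the node: since the depth is a constant, it unrolls
    into a fixed expression. *)
Fixpoint evf (e : nat) (al : nat -> bool) (v : nat) : bool :=
  if e is e'.+1 then
    if tag v == 0 then al v
    else if tag v == 1 then ~~ evf e' al (arg v 0)
    else if tag v == 2 then all (fun j => evf e' al (arg v j)) (iota 0 (na v))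
    else has (fun j => evf e' al (arg v j)) (iota 0 (na v))
  else (tag v == 0) && al v.

(** The value 0 outside the circuit serves the dummy node [n] that [atom_at] returns where there is
    no atom. *)
Definition cnt (al : nat -> bool) (w : nat) : nat :=
  if w < n then
    if tag w == 0 then nat_of_bool (al w) else \sum_(0 <= j < na w) evf d al (arg w j)
  else 0.

Definition thr (w : nat) := if tag w == 2 then na w else 1.

Definition atom (w : nat) := (tag w == 0) || (2 < na w).

(* The atom reached from [v] along the path of small gates coded by [p < 2 ^ e]. *)
Fixpoint atom_at (e v p : nat) : nat :=
  if atom v then (if p == 0 then v else n)
  else if e is e'.+1 then
    if p < 2 ^ e' then atom_at e' (arg v 0) p
    else if 1 < na v then atom_at e' (arg v 1) (p - 2 ^ e') else n
  else n.

(* The value of [v], given the counts [c] of the atoms below it. *)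
Fixpoint top (e v off : nat) (c : nat -> nat) : bool :=
  if atom v then thr v <= c off
  else if e is e'.+1 then
    if tag v == 1 then ~~ top e' (arg v 0) off c
    else if tag v == 2 then
      top e' (arg v 0) off c && ((na v == 1) || top e' (arg v 1) (off + 2 ^ e') c)
    else top e' (arg v 0) off c || ((1 < na v) && top e' (arg v 1) (off + 2 ^ e') c)
  else false.

Variables (dp wf : nat -> nat).
Hypothesis na1 : forall v, v < n -> tag v = 1 -> na v = 1.
Hypothesis na0 : forall v, v < n -> tag v != 0 -> 0 < na v.
Hypothesis arg_lt : forall v j, v < n -> j < na v -> arg v j < v.
Hypothesis na_le : forall v, v < n -> na v <= n.
Hypothesis dp_lt : forall v j, v < n -> j < na v -> dp (arg v j) < dp v.
Hypothesis wf_le : forall v j, v < n -> j < na v -> (2 < na v) + wf (arg v j) <= wf v.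

Lemma arg_ltn v j : v < n -> j < na v -> arg v j < n.
Proof. by move=> h1 h2; apply: ltn_trans (arg_lt h1 h2) h1. Qed.

Lemma dp0_tag v : v < n -> dp v = 0 -> tag v = 0.
Proof.
move=> h e; apply/eqP/negPn/negP => t.
by have := dp_lt h (na0 h t); rewrite e.
Qed.

Lemma evf_dp e e' al v : v < n -> dp v <= e -> dp v <= e' -> evf e al v = evf e' al v.
Proof.
elim: e e' v => [|e IH] [|e'] v vn //=.
- by rewrite leqn0 => /eqP /(dp0_tag vn) ->.
- by move=> _; rewrite leqn0 => /eqP /(dp0_tag vn) ->.
move=> h h'; case: eqP => // /eqP t.
have A j : j < na v -> evf e al (arg v j) = evf e' al (arg v j).
  by move=> hj; have := dp_lt vn hj => lt; apply: IH; [exact: arg_ltn|lia|lia].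
rewrite (A 0 (na0 vn t)); case: (tag v == 1) => //; case: (tag v == 2).
  by apply: eq_in_all => j; rewrite mem_iota => hj; apply: A; lia.
by apply: eq_in_has => j; rewrite mem_iota => hj; apply: A; lia.
Qed.

Lemma evf_eq e al v : v < n -> dp v <= e -> evf e al v =
    if tag v == 0 then al v
    else if tag v == 1 then ~~ evf e al (arg v 0)
    else if tag v == 2 then all (fun j => evf e al (arg v j)) (iota 0 (na v))
    else has (fun j => evf e al (arg v j)) (iota 0 (na v)).
Proof.
move=> vn h; by rewrite (@evf_dp e e.+1) //; exact: leqW.
Qed.

Lemma evf_ext e al be v : v < n -> (forall u, u < n -> tag u = 0 -> al u = be u) ->
  evf e al v = evf e be v.
Proof.
move=> vn h; elim: e v vn => [|e IH] v vn /=.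
  by case: eqP => // t; rewrite h.
case: eqP => [t|/eqP t]; first by rewrite h.
rewrite IH; last exact: arg_ltn vn (na0 vn t).
case: (tag v == 1) => //; case: (tag v == 2).
  by apply: eq_in_all => j; rewrite mem_iota => hj; apply: IH; apply: arg_ltn => //; lia.
by apply: eq_in_has => j; rewrite mem_iota => hj; apply: IH; apply: arg_ltn => //; lia.
Qed.

Lemma cnt_ext al be w : (forall u, u < n -> tag u = 0 -> al u = be u) ->
  cnt al w = cnt be w.
Proof.
move=> h; rewrite /cnt; case: ltnP => // wn; case: eqP => [t|_]; first by rewrite h.
rewrite big_nat_cond [RHS]big_nat_cond; apply: eq_bigr => j /andP[/andP[_ hj] _].
by congr nat_of_bool; apply: evf_ext h; apply: arg_ltn.
Qed.

(** Weft 0 means fan-in at most 2 all the way down, so the number of relevant inputs at most doubles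
    with each level. *)
Lemma evf_junta e v : v < n -> wf v = 0 ->
  exists2 V, size V <= 2 ^ e & junta V (fun al => evf e al v).
Proof.
elim: e v => [|e IH] v vn w0.
  by exists [:: v] => // al be h /=; rewrite h // inE eqxx.
case t0: (tag v == 0).
  exists [:: v]; first by rewrite expn_gt0.
  by move=> al be h /=; rewrite t0 h // inE eqxx.
have na2 : na v <= 2 by have := wf_le vn (na0 vn (negbT t0)); rewrite w0; case: ltnP.
have A j : j < na v -> exists2 V, size V <= 2 ^ e & junta V (fun al => evf e al (arg v j)).
  move=> hj; apply: IH; first exact: arg_ltn.
  by have := wf_le vn hj; lia.
have [V0 s0 j0] := A 0 (na0 vn (negbT t0)).
case na1': (1 < na v).
  have [V1 s1 j1] := A 1 na1'.
  exists (V0 ++ V1); first by rewrite size_cat expnS; lia.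
  move=> al be h /=.
  have e0 : evf e al (arg v 0) = evf e be (arg v 0).
    by apply: j0 => u hu; apply: h; rewrite mem_cat hu.
  have e1 : evf e al (arg v 1) = evf e be (arg v 1).
    by apply: j1 => u hu; apply: h; rewrite mem_cat hu orbT.
  have -> : na v = 2 by lia.
  by rewrite t0 /= e0 e1.
exists V0; first by rewrite expnS; lia.
move=> al be h /=.
have -> : na v = 1 by have := na0 vn (negbT t0); lia.
by rewrite t0 /= (j0 al be h).
Qed.

(** The large gate uses up the weft, so its arguments have weft 0 and its count is a sum of
    functions of at most [2 ^ d] inputs. *)
Lemma cnt_pdeg q w : 2 ^ d <= q -> (w < n -> wf w <= 1 /\ atom w) ->
  pdeg q (fun al => cnt al w : int).
Proof.
move=> hq h; rewrite /cnt; case: ltnP => wn; last exact: pdeg_cst.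
have [w1 aw] := h wn.
case t0: (tag w == 0).
  apply: (@junta_pdeg _ [:: w]); last by apply: leq_trans hq; rewrite expn_gt0.
  by move=> al be e; rewrite e // inE eqxx.
move: aw; rewrite /atom t0 /= => na3.
have -> : (fun al => (\sum_(0 <= j < na w) evf d al (arg w j) : nat) : int) =
          (fun al => \sum_(0 <= j < na w) ((evf d al (arg w j) : nat) : int))%R.
  by apply/funext => al; rewrite (big_morph Posz PoszD (erefl _)).
apply: pdeg_sum => j hj.
have [|V sV jV] := @evf_junta d (arg w j) (arg_ltn wn hj).
  by have := wf_le wn hj; rewrite na3; lia.
by apply: (@junta_pdeg _ V); [move=> al be e; rewrite (jV al be e)|apply: leq_trans hq].
Qed.

Lemma atom_atP e v p : v < n -> wf v <= 1 ->
  atom_at e v p < n -> wf (atom_at e v p) <= 1 /\ atom (atom_at e v p).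
Proof.
elim: e v p => [|e IH] v p vn w1 /=; case av: (atom v);
  do ?[by case: eqP => // _; rewrite ?ltnn]; first by rewrite ltnn.
have n0 : 0 < na v by apply: na0 => //; move/negbT: av; rewrite negb_or => /andP[].
have A j : j < na v -> wf (arg v j) <= 1 by move=> hj; have := wf_le vn hj; lia.
case: (ltnP p (2 ^ e)) => _; first by apply: IH; [exact: arg_ltn|exact: A].
case: (ltnP 1 (na v)) => n1; last by rewrite ltnn.
by apply: IH; [exact: arg_ltn|exact: A].
Qed.

Lemma cnt_le al w : cnt al w <= n.+1.
Proof.
rewrite /cnt; case: ltnP => // wn; case: (tag w == 0); first by case: (al w).
apply: (@leq_trans (\sum_(0 <= j < na w) 1)).
  by apply: leq_sum => j _; case: (evf _ _ _).
by rewrite sum_nat_const_nat subn0 muln1; apply: leqW; exact: na_le.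
Qed.

Lemma top_correct e v off (c : nat -> nat) al : v < n -> dp v <= e -> dp v <= d ->
  (forall p, p < 2 ^ e -> c (off + p) = cnt al (atom_at e v p)) ->
  top e v off c = evf d al v.
Proof.
(* An atom other than an input has more than two arguments, so it is no negation, and its value is a
   threshold on its count. *)
have at_atom e' u off' : u < n -> dp u <= d -> atom u ->
    (forall p, p < 2 ^ e' -> c (off' + p) = cnt al (atom_at e' u p)) ->
    (thr u <= c off') = evf d al u.
  move=> un du au h; have p0 : 0 < 2 ^ e' by rewrite expn_gt0.
  have := h 0 p0; rewrite addn0 => ->.
  have -> : atom_at e' u 0 = u by case: (e') => [|?] /=; rewrite au.
  rewrite evf_eq // /cnt un /thr; case: (tag u =P 0) => [->|/eqP t0] /=; first by case: (al u).
  have n3 : 2 < na u by move: au; rewrite /atom (negbTE t0).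
  case: (tag u =P 1) => [t1|_]; first by rewrite na1 in n3.
  by case: eqP => _; rewrite ?sum_all_iota ?sum_has_iota.
elim: e v off => [|e IH] v off vn dv dv' h /=; case av: (atom v).
- exact: (at_atom 0).
- by rewrite leqn0 in dv; rewrite /atom (dp0_tag vn (eqP dv)) in av.
- exact: (at_atom e.+1).
have [t0 n3] : tag v != 0 /\ na v <= 2.
  by move/negbT: av; rewrite negb_or -leqNgt => /andP[].
have n0 := na0 vn t0.
rewrite evf_eq // (negbTE t0).
have e0 : top e (arg v 0) off c = evf d al (arg v 0).
  have dl := dp_lt vn n0; apply: IH; [exact: arg_ltn|lia|lia|] => p hp.
  rewrite h /= ?av ?hp //; by apply: leq_trans hp _; rewrite leq_exp2l.
have e1 : 1 < na v -> top e (arg v 1) (off + 2 ^ e) c = evf d al (arg v 1).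
  move=> n1; have dl := dp_lt vn n1; apply: IH; [exact: arg_ltn|lia|lia|] => p hp.
  rewrite -addnA h /= ?av; last by rewrite expnS; lia.
  by rewrite ltnNge leq_addr n1 /= addKn.
case: (tag v =P 1) => t1; first by rewrite e0.
case: (ltnP 1 (na v)) => n1.
  rewrite e0 (e1 n1); have -> : na v = 2 by lia.
  by case: eqP => _ /=; rewrite ?andbT ?orbF.
rewrite e0; have -> : na v = 1 by lia.
by case: eqP => _ /=; rewrite ?andbT ?orbF.
Qed.

End Gates.

(** * Choosing one item per group *)

Section Choice.
Variables (G J B q : nat) (valid : nat -> nat -> bool).
Variables (zp zn : nat -> nat -> nat -> nat -> nat).

(* Item [e] is the pair (group tau, element b).  Coordinates [i < G] force one valid
   item per group; the others state the equations zp = zn, as two inequalities each. *)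
Definition item_coord (e i : nat) : nat :=
  let tau := e %/ J in let b := e %% J in
  let s := i %/ G in let tau' := i %% G in
  if s == 0 then B.-1 + (valid tau b && (tau == tau')) * G
  else if s %% 2 == 1 then B + zp tau' (s.-1 %/ 2) tau b - zn tau' (s.-1 %/ 2) tau b
  else B + zn tau' (s.-1 %/ 2) tau b - zp tau' (s.-1 %/ 2) tau b.

Hypothesis G0 : 0 < G.
Hypothesis J0 : 0 < J.
Hypothesis B2 : 1 < B.
Hypothesis zp_lt : forall tau' j tau b, zp tau' j tau b < B.
Hypothesis zn_lt : forall tau' j tau b, zn tau' j tau b < B.

Lemma item_coord_gt0 e i : 0 < item_coord e i.
Proof.
clear G0 J0.
rewrite /item_coord; case: ifP => _; first by lia.
by case: ifP => _; have := zp_lt (i %% G) ((i %/ G).-1 %/ 2) (e %/ J) (e %% J);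
  have := zn_lt (i %% G) ((i %/ G).-1 %/ 2) (e %/ J) (e %% J); lia.
Qed.

Lemma sum_items (Phi : nat -> nat) :
  \sum_(0 <= e < G * J) Phi e = \sum_(0 <= g < G) \sum_(0 <= b < J) Phi (b + J * g).
Proof. by rewrite mulnC (sum_mul J G Phi) exchange_big_nat. Qed.

Lemma item_div b g : b < J -> (b + J * g) %/ J = g.
Proof. by move=> h; rewrite addnC mulnC divnMDl // divn_small // addn0. Qed.

Lemma item_mod b g : b < J -> (b + J * g) %% J = b.
Proof. by move=> h; rewrite addnC mulnC modnMDl modn_small. Qed.

Lemma sum_single (P : nat -> bool) (W : nat -> nat) m b0 : b0 < m -> P b0 ->
  \sum_(0 <= b < m) P b = 1 -> \sum_(0 <= b < m) P b * W b = W b0.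
Proof.
move=> hb pb; rewrite !big_mkord (bigD1 (Ordinal hb)) //= pb => s1.
rewrite (bigD1 (Ordinal hb)) //= pb mul1n big1 ?addn0 // => b nb.
by move: s1; rewrite add1n => -[/eqP]; rewrite sum_nat_eq0 => /forallP /(_ b); rewrite nb /= => /eqP ->.
Qed.

Lemma all_one (r : nat -> nat) m : (forall g, g < m -> 0 < r g) ->
  \sum_(0 <= g < m) r g <= m -> forall g, g < m -> r g = 1.
Proof.
move=> h; rewrite big_mkord => le g hg; apply/eqP; rewrite eqn_leq h // andbT.
move: le; rewrite (bigD1 (Ordinal hg)) //=.
have : m.-1 <= \sum_(i < m | i != Ordinal hg) r i.
  apply: (@leq_trans (\sum_(i < m | i != Ordinal hg) 1)).
    by rewrite sum1_card cardC1 card_ord.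
  by apply: leq_sum => i _; apply: h.
by move: (\sum_(i < m | _) _) => X; lia.
Qed.

Lemma coord_group e g : g < G ->
  item_coord e g = B.-1 + (valid (e %/ J) (e %% J) && (e %/ J == g)) * G.
Proof. by move=> h; rewrite /item_coord (divn_small h) (modn_small h) /=. Qed.

Lemma coord_pos e tau' j : tau' < G -> item_coord e (tau' + G * (2 * j).+1) =
  B + zp tau' j (e %/ J) (e %% J) - zn tau' j (e %/ J) (e %% J).
Proof.
move=> h; rewrite /item_coord addnC mulnC modnMDl divnMDl // (modn_small h) (divn_small h) addn0 /=.
by rewrite mulKn // -(addn1 (2 * j)) mulnC modnMDl.
Qed.

Lemma coord_neg e tau' j : tau' < G -> item_coord e (tau' + G * (2 * j).+2) =
  B + zn tau' j (e %/ J) (e %% J) - zp tau' j (e %/ J) (e %% J).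
Proof.
move=> h; rewrite /item_coord addnC mulnC modnMDl divnMDl // (modn_small h) (divn_small h) addn0 /=.
have -> : (2 * j).+2 %% 2 = 0 by lia.
by have -> : (2 * j).+1 %/ 2 = j by lia.
Qed.

(** Once exactly one item per group is taken, the offsets add up to [G * B], and the two
    inequalities for an equation leave zp >= zn and zn >= zp. *)
Lemma choice_correct :
  (exists b : nat -> bool, \sum_(0 <= e < G * J) b e <= G /\
     forall i, i < (2 * q).+1 * G -> G * B <= \sum_(0 <= e < G * J) b e * item_coord e i) <->
  (exists bt : nat -> nat, (forall tau, tau < G -> bt tau < J /\ valid tau (bt tau)) /\
     forall tau' j, tau' < G -> j < q ->
       \sum_(0 <= tau < G) zp tau' j tau (bt tau) = \sum_(0 <= tau < G) zn tau' j tau (bt tau)).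
Proof.
have bnd tau' s : tau' < G -> s <= 2 * q -> tau' + G * s < (2 * q).+1 * G.
  by move=> h1 h2; rewrite mulnC; nia.
have sum_BG (p m : nat -> nat) : (forall x, m x < B) ->
    \sum_(0 <= x < G) (B + p x - m x) + \sum_(0 <= x < G) m x =
    G * B + \sum_(0 <= x < G) p x.
  move=> h; rewrite -big_split /= (eq_bigr (fun x => B + p x)); last first.
    by move=> x _; rewrite subnK //; have := h x; lia.
  by rewrite big_split /= sum_nat_const_nat subn0.
split=> [[b [bG bi]]|[bt [hb eqs]]].
(* Without a valid item of group [g], its coordinate would add up to at most G (B - 1), below the
   threshold [G * B]. *)
- have ex g : exists x, g < G -> [/\ x < J, b (x + J * g) & valid g x].
    case: (ltnP g G) => hg; last by exists 0.
    have hL : g < (2 * q).+1 * G by have := @bnd g 0 hg isT; rewrite muln0 addn0.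
    have := bi g hL.
    rewrite (eq_bigr (fun e => b e * B.-1 + (b e && (valid (e %/ J) (e %% J) && (e %/ J == g))) * G));
      last by move=> e _; rewrite coord_group // mulnDr; case: (b e); rewrite ?mul1n ?mul0n.
    rewrite big_split /= -!big_distrl /= => le.
    have : 0 < \sum_(0 <= e < G * J) (b e && (valid (e %/ J) (e %% J) && (e %/ J == g))).
      move: le; case: (\sum_(0 <= e < G * J) (b e && _)) => // .
      rewrite mul0n addn0 => le.
      have : (\sum_(0 <= e < G * J) b e) * B.-1 <= G * B.-1 by rewrite leq_mul2r bG orbT.
      by move: le; case: (B) B2 => // B' _ /=; rewrite mulnS; lia.
    rewrite lt0n big_mkord sum_nat_eq0 negb_forall => /existsP[e /=].
    case be: (b e) => //=; case ve: (valid _ _) => //=; case: (e %/ J =P g) => //= eg _.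
    exists (e %% J) => _; split; first by rewrite ltn_mod.
      have -> : e %% J + J * g = e :> nat by rewrite -eg addnC mulnC -(divn_eq (val e) J).
      by [].
    by rewrite -eg.
  have [bt hbt] := boolp.choice ex.
  (* At least one item in each of the [G] groups and at most [G] items in all. *)
  have r1 g : g < G -> \sum_(0 <= x < J) b (x + J * g) = 1.
    apply: (@all_one (fun g => \sum_(0 <= x < J) b (x + J * g)) G) => [g' hg|]; last by rewrite -(sum_items (fun e => nat_of_bool (b e))).
    have [h1 h2 _] := hbt g' hg.
    by rewrite big_mkord (bigD1 (Ordinal h1)) //= h2.
  have S W : \sum_(0 <= e < G * J) b e * W e = \sum_(0 <= g < G) W (bt g + J * g).
    rewrite sum_items big_nat_cond [RHS]big_nat_cond; apply: eq_bigr => g /andP[/andP[_ hg] _].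
    have [h1 h2 _] := hbt g hg.
    exact: (@sum_single (fun x => b (x + J * g)) (fun x => W (x + J * g)) _ _ h1 h2 (r1 g hg)).
  exists bt; split=> [tau ht|tau' j ht hj]; first by have [? _ ?] := hbt tau ht.
  have E1 : \sum_(0 <= g < G) item_coord (bt g + J * g) (tau' + G * (2 * j).+1) =
     \sum_(0 <= g < G) (B + zp tau' j g (bt g) - zn tau' j g (bt g)).
    rewrite big_nat_cond [RHS]big_nat_cond; apply: eq_bigr => g /andP[/andP[_ hg] _].
    by have [h1 _ _] := hbt g hg; rewrite coord_pos // item_div // item_mod.
  have E2 : \sum_(0 <= g < G) item_coord (bt g + J * g) (tau' + G * (2 * j).+2) =
     \sum_(0 <= g < G) (B + zn tau' j g (bt g) - zp tau' j g (bt g)).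
    rewrite big_nat_cond [RHS]big_nat_cond; apply: eq_bigr => g /andP[/andP[_ hg] _].
    by have [h1 _ _] := hbt g hg; rewrite coord_neg // item_div // item_mod.
  have := bi _ (@bnd tau' (2 * j).+1 ht (ltac:(lia))); rewrite S E1 => le1.
  have := bi _ (@bnd tau' (2 * j).+2 ht (ltac:(lia))); rewrite S E2 => le2.
  have := sum_BG (fun g => zp tau' j g (bt g)) (fun g => zn tau' j g (bt g)) (fun g => zn_lt _ _ _ _).
  have := sum_BG (fun g => zn tau' j g (bt g)) (fun g => zp tau' j g (bt g)) (fun g => zp_lt _ _ _ _).
  lia.
pose b e := e %% J == bt (e %/ J).
have S W : \sum_(0 <= e < G * J) b e * W e = \sum_(0 <= g < G) W (bt g + J * g).
  rewrite sum_items big_nat_cond [RHS]big_nat_cond; apply: eq_bigr => g /andP[/andP[_ hg] _].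
  have [h1 h2] := hb g hg.
  have bE x : x < J -> b (x + J * g) = (x == bt g) by move=> hx; rewrite /b item_mod // item_div.
  apply: (@sum_single (fun x => b (x + J * g)) (fun x => W (x + J * g)) _ _ h1).
    by rewrite bE.
  rewrite big_mkord (bigD1 (Ordinal h1)) //= bE // eqxx big1 ?addn0 // => x nx.
  by rewrite bE // -[bt g]/(val (Ordinal h1)) (inj_eq val_inj) (negbTE nx).
exists b; split.
  have := S (fun=> 1); under eq_bigr => e _ do rewrite muln1.
  by move=> ->; rewrite sum_nat_const_nat subn0 muln1.
move=> i hi; rewrite S.
have tG : i %% G < G by rewrite ltn_mod.
have hs : i %/ G <= 2 * q by rewrite -ltnS ltn_divLR.
have ei : i = i %% G + G * (i %/ G) by rewrite addnC mulnC -divn_eq.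
rewrite ei; move: (i %% G) tG => tau' tG.
case: (posnP (i %/ G)) hs => [-> _|s0 hs].
  rewrite muln0 addn0.
  rewrite (eq_big_nat _ _ (F2 := fun g => B.-1 + (g == tau') * G)); last first.
    move=> g /andP[_ hg]; have [h1 h2] := hb g hg.
    by rewrite coord_group // item_div // item_mod // h2.
  rewrite big_split /= sum_nat_const_nat subn0 -big_distrl /=.
  rewrite (_ : \sum_(0 <= g < G) (g == tau') = 1).
    by rewrite mul1n; case: (B) B2 => // B' _ /=; rewrite mulnS; lia.
  rewrite big_mkord (bigD1 (Ordinal tG)) //= eqxx big1 // => g ng.
  by rewrite -[tau']/(val (Ordinal tG)) (inj_eq val_inj) (negbTE ng).
have [j] : exists2 j, j < q & (i %/ G = (2 * j).+1) \/ (i %/ G = (2 * j).+2).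
  exists ((i %/ G).-1 %/ 2); first by move: (i %/ G) hs s0 => s hs s0; lia.
  by move: (i %/ G) s0 => s s0; lia.
move=> hj; have eq := eqs tau' j tG hj; case=> ->.
  rewrite (eq_big_nat _ _ (F2 := fun g => B + zp tau' j g (bt g) - zn tau' j g (bt g))); last first.
    by move=> g /andP[_ hg]; have [h1 h2] := hb g hg; rewrite coord_pos // item_div // item_mod.
  have := sum_BG (fun g => zp tau' j g (bt g)) (fun g => zn tau' j g (bt g)) (fun g => zn_lt _ _ _ _).
  lia.
rewrite (eq_big_nat _ _ (F2 := fun g => B + zn tau' j g (bt g) - zp tau' j g (bt g))); last first.
  by move=> g /andP[_ hg]; have [h1 h2] := hb g hg; rewrite coord_neg // item_div // item_mod.
have := sum_BG (fun g => zn tau' j g (bt g)) (fun g => zp tau' j g (bt g)) (fun g => zp_lt _ _ _ _).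
lia.
Qed.

End Choice.

(** * Choices encoding circuit assignments *)

Section Encoding.
Variables (n d k q : nat) (tag na : nat -> nat) (arg : nat -> nat -> nat).

Let root := n.-1.
Definition dgb b j := nth 0 (digits n.+2 q b) j.
Definition dgt tau j := nth 0 (digits k.+1 q tau) j.
Definition ngroups := k.+1 ^ q.
Definition nitems := n.+2 ^ q.
(** Above both sides of every equation: a Newton coefficient has at most [2 ^ q] terms, each at most
    [n.+1], and a digit of an element is at most [n.+1]. *)
Definition offset := 2 ^ q * n.+1 + n.+3.

(* Groups are numbers with digits in [0, k], the indices of a tuple; elements have
   digits in [0, n + 1], inputs shifted by one.  The digits of the element of group 0
   are instead the guessed numbers of true arguments of the atoms. *)
Definition valid_item tau b :=
  if tau == 0 then top tag na arg d root 0 (dgb b)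
  else ((tau <= k) ==> [&& 0 < dgb b 0, dgb b 0 <= n & tag (dgb b 0).-1 == 0]) &&
       ((0 < dgt tau 0) && (dgt tau 0 < dgt tau 1) ==> (dgb b 0 < dgb b 1)).

Definition atom_count j Us :=
  cnt n d tag na arg (listed Us) (atom_at n tag na arg d root j).

(** Group 0 stands for the empty tuple; the digits of its item are counts and must not be read as
    inputs. *)
Definition tuple_of tau b := if tau == 0 then nseq q 0 else digits n.+2 q b.

(** For [tau' != 0] the equation is consistency: entry [j] of the item of [tau'] is the element
    chosen by the group of the single index [dgt tau' j]. For [tau' = 0] it is the Newton expansion
    for atom [j], with the negative terms and the guessed count on the other side. *)
Definition eq_pos tau' j tau b :=
  if tau' == 0 then
    canon 0 (digits k.+1 q tau) * signed (atom_count j) true (tuple_of tau b) [::]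
  else (tau == tau') * dgb b j.

Definition eq_neg tau' j tau b :=
  if tau' == 0 then
    canon 0 (digits k.+1 q tau) * signed (atom_count j) false (tuple_of tau b) [::]
      + (tau == 0) * dgb b j
  else ((tau == dgt tau' j) && (tau != 0)) * dgb b 0.

Variables (dp wf : nat -> nat).
Hypothesis na1 : forall v, v < n -> tag v = 1 -> na v = 1.
Hypothesis na0 : forall v, v < n -> tag v != 0 -> 0 < na v.
Hypothesis arg_lt : forall v j, v < n -> j < na v -> arg v j < v.
Hypothesis na_le : forall v, v < n -> na v <= n.
Hypothesis dp_lt : forall v j, v < n -> j < na v -> dp (arg v j) < dp v.
Hypothesis wf_le : forall v j, v < n -> j < na v -> (2 < na v) + wf (arg v j) <= wf v.
Hypothesis n0 : 0 < n.
Hypothesis root_dp : dp root <= d.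
Hypothesis root_wf : wf root <= 1.
Hypothesis q2 : 1 < q.
Hypothesis dq : 2 ^ d <= q.

Lemma root_lt : root < n.
Proof. by rewrite /root prednK. Qed.

Lemma dgb_lt b j : dgb b j < n.+2.
Proof. exact: nth_digits_lt. Qed.

Lemma dgt_lt tau j : dgt tau j < k.+1.
Proof. exact: nth_digits_lt. Qed.

Lemma signed_count_le sg j tau b : signed (atom_count j) sg (tuple_of tau b) [::] <= 2 ^ q * n.+1.
Proof.
have -> : q = size (tuple_of tau b) by rewrite /tuple_of; case: eqP; rewrite ?size_nseq ?size_digits.
by apply: signed_le => Us; apply: cnt_le.
Qed.

Lemma eq_pos_lt tau' j tau b : eq_pos tau' j tau b < offset.
Proof.
clear n0 root_dp root_wf q2 dq.
have := signed_count_le true j tau b; have := dgb_lt b j.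
rewrite /eq_pos /offset; move: (signed _ _ _ _) (dgb b j) (2 ^ q * n.+1) => X Y Z h1 h2.
by case: (tau' == 0); [case: (canon _ _)|case: (tau == tau')]; lia.
Qed.

Lemma eq_neg_lt tau' j tau b : eq_neg tau' j tau b < offset.
Proof.
clear n0 root_dp root_wf q2 dq.
have := signed_count_le false j tau b; have := dgb_lt b j; have := dgb_lt b 0.
rewrite /eq_neg /offset; move: (signed _ _ _ _) (dgb b j) (dgb b 0) (2 ^ q * n.+1) => X Y Y' Z h0 h1 h2.
by case: (tau' == 0); [case: (canon _ _); case: (tau == 0)|case: (_ && _)]; lia.
Qed.

Lemma small_digits x : x <= k -> digits k.+1 q x = x :: nseq q.-1 0.
Proof.
case: q q2 => // q' _ hx /=.
by rewrite modn_small // divn_small // digits0.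
Qed.

Lemma small_lt x : x <= k -> x < ngroups.
Proof.
move=> hx; apply: (@leq_trans (k.+1 ^ 1)); first by rewrite expn1.
by rewrite /ngroups; case: k => [|k']; rewrite ?exp1n // leq_exp2l // ltnW.
Qed.

Lemma dgt_small x : x <= k -> dgt x 0 = x.
Proof. by move=> hx; rewrite /dgt small_digits. Qed.

(** * The assignment described by an increasing sequence *)

Section Sequence.
Variable a : nat -> nat.
Hypothesis a0 : a 0 = 0.
Hypothesis a_mono : forall i, 0 < i < k -> a i < a i.+1.
Hypothesis a_pos : forall i, 0 < i <= k -> 0 < a i.

Definition chosen : nat -> bool := adds k a 0 (listed [::]).

Lemma chosenE v : chosen v = has (fun i => a i == v.+1) (iota 1 k).
Proof.
rewrite /chosen /adds /=; apply: eq_in_has => i; rewrite mem_iota => /andP[-> _] //.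
Qed.

(** The Newton expansion at the empty assignment, with its negative terms moved to the other
    side. *)
Lemma count_identity j :
  \sum_(0 <= x < ngroups) canon 0 (digits k.+1 q x) *
     signed (atom_count j) true (map a (digits k.+1 q x)) [::] =
  \sum_(0 <= x < ngroups) canon 0 (digits k.+1 q x) *
     signed (atom_count j) false (map a (digits k.+1 q x)) [::] +
  cnt n d tag na arg chosen (atom_at n tag na arg d root j).
Proof.
set w := atom_at _ _ _ _ _ _ _.
have deg : pdeg q (fun al => cnt n d tag na arg al w : int).
  apply: (cnt_pdeg na0 arg_lt wf_le dq) => wn.
  by apply: (atom_atP na0 arg_lt wf_le root_lt root_wf wn).
have := newton_expansion a0 a_mono a_pos deg (leq0n k) (fun i _ => erefl false : listed [::] (a i).-1 = false).
rewrite -/chosen => E.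
suff : (Posz (\sum_(0 <= x < ngroups) canon 0 (digits k.+1 q x) *
     signed (atom_count j) true (map a (digits k.+1 q x)) [::]) =
  Posz (\sum_(0 <= x < ngroups) canon 0 (digits k.+1 q x) *
     signed (atom_count j) false (map a (digits k.+1 q x)) [::]) +
  Posz (cnt n d tag na arg chosen w))%R.
  by move/eqP; rewrite -PoszD eqz_nat => /eqP.
rewrite E !(big_morph Posz PoszD (erefl _)) -big_split /=; apply: eq_bigr => x _.
case: (canon _ _); last by [].
by rewrite !mul1n (newton_signed (f := atom_count j)) // GRing.addrC GRing.subrK.
Qed.

End Sequence.

Definition circuit_sat := exists al : nat -> bool,
  evf tag na arg d al root /\ #|[set v : 'I_n | (tag v == 0) && al v]| = k.

Definition choice_sat := exists bt : nat -> nat,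
  (forall tau, tau < ngroups -> bt tau < nitems /\ valid_item tau (bt tau)) /\
  forall tau' j, tau' < ngroups -> j < q ->
    \sum_(0 <= tau < ngroups) eq_pos tau' j tau (bt tau) =
    \sum_(0 <= tau < ngroups) eq_neg tau' j tau (bt tau).

Lemma sum_indicator m x (W : nat -> nat) : x < m ->
  \sum_(0 <= i < m) (i == x) * W i = W x.
Proof.
move=> hx; rewrite big_mkord (bigD1 (Ordinal hx)) //= eqxx mul1n big1 ?addn0 // => i ni.
by rewrite -[x]/(val (Ordinal hx)) (inj_eq val_inj) (negbTE ni).
Qed.

Lemma sum_pos_tuple tau' j (bt : nat -> nat) : tau' != 0 -> tau' < ngroups ->
  \sum_(0 <= tau < ngroups) eq_pos tau' j tau (bt tau) = dgb (bt tau') j.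
Proof.
move=> h0 ht; rewrite /eq_pos (negbTE h0).
exact: (sum_indicator (fun i => dgb (bt i) j)).
Qed.

Lemma sum_neg_tuple tau' j (bt : nat -> nat) : tau' != 0 ->
  \sum_(0 <= tau < ngroups) eq_neg tau' j tau (bt tau) =
  if dgt tau' j == 0 then 0 else dgb (bt (dgt tau' j)) 0.
Proof.
move=> h0; rewrite /eq_neg (negbTE h0).
have hx : dgt tau' j < ngroups by apply: small_lt; have := dgt_lt tau' j.
rewrite -(sum_indicator (fun i => if i == 0 then 0 else dgb (bt i) 0) hx).
apply: eq_bigr => i _; case: (i == dgt tau' j) => //=.
by case: (i == 0); rewrite ?mul0n ?mul1n.
Qed.

Lemma choice_to_circuit : choice_sat -> circuit_sat.
Proof.
move=> [bt [hb eqs]].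
pose a i := if i == 0 then 0 else dgb (bt i) 0.
have cons tau j : tau != 0 -> tau < ngroups -> j < q -> dgb (bt tau) j = a (dgt tau j).
  move=> t0 ht hj; have := eqs tau j ht hj.
  by rewrite sum_pos_tuple // sum_neg_tuple.
have av i : 0 < i <= k -> [/\ 0 < a i, a i <= n & tag (a i).-1 = 0].
  move=> /andP[i0 ik]; have [_] := hb i (small_lt ik).
  rewrite /valid_item /a gtn_eqF // ik /= => /andP[/and3P[h1 h2 /eqP h3] _].
  by [].
have a0 : a 0 = 0 by [].
have a_pos i : 0 < i <= k -> 0 < a i by case/av.
have q0 : 0 < q by lia.
have a_mono i : 0 < i < k -> a i < a i.+1.
  move=> /andP[i0 ik].
  (* The code of the pair formed by [i] and [i.+1], available because [q] is at least 2. Validity of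
     its item compares the two elements, and consistency identifies them. *)
  pose tau := i + k.+1 * i.+1.
  have D : digits k.+1 q tau = i :: i.+1 :: nseq q.-2 0.
    case: (q) q2 => [|[|q']] // _.
    rewrite /tau digits_cons; last by lia.
    rewrite -[i.+1 in X in _ :: X]addn0 -[X in i.+1 + X](muln0 k.+1) digits_cons //.
    by rewrite digits0.
  have tl : tau < ngroups.
    rewrite /ngroups; apply: (@leq_trans (k.+1 ^ 2)).
      by rewrite /tau -mulnn; nia.
    by rewrite leq_exp2l //; lia.
  have t0 : tau != 0 by rewrite /tau; lia.
  have [_] := hb tau tl.
  rewrite /valid_item (negbTE t0) => /andP[_].
  rewrite /dgt D /= i0 ltnSn /= (cons tau 0) // (cons tau 1) // /dgt D //=.
pose al := chosen a.
have mapa tau : tau < ngroups -> map a (digits k.+1 q tau) = tuple_of tau (bt tau).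
  move=> ht; rewrite /tuple_of; case: eqP => [->|/eqP t0].
    by rewrite digits0 map_nseq a0.
  apply: (@eq_from_nth _ 0); first by rewrite size_map !size_digits.
  rewrite size_map size_digits => j hj.
  rewrite (nth_map 0) ?size_digits //; apply/esym; exact: cons.
have G0 : 0 < ngroups by apply: small_lt.
(* By consistency the items carry exactly the tuples of [a], so the signed sums cancel against
   [count_identity] and the guessed count is the true one. *)
have cnts j : j < q -> dgb (bt 0) j = cnt n d tag na arg al (atom_at n tag na arg d root j).
  move=> hj; have := eqs 0 j G0 hj; have := count_identity a0 a_mono a_pos j.
  rewrite /eq_pos /eq_neg /= big_split /=.
  have E sg : \sum_(0 <= tau < ngroups) canon 0 (digits k.+1 q tau) *
      signed (atom_count j) sg (tuple_of tau (bt tau)) [::] =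
     \sum_(0 <= tau < ngroups) canon 0 (digits k.+1 q tau) *
      signed (atom_count j) sg (map a (digits k.+1 q tau)) [::].
    by apply: eq_big_nat => tau /andP[_ ht]; rewrite mapa.
  rewrite !E -[chosen a]/al => ->.
  rewrite (sum_indicator (fun i => dgb (bt i) j) G0) => /addnI.
  by [].
exists al; split.
  have [_] := hb 0 G0; rewrite /valid_item /=.
  rewrite (top_correct na1 na0 arg_lt dp_lt (al := al) root_lt root_dp root_dp) // => p hp.
  by rewrite add0n; apply: cnts; apply: leq_trans hp dq.
have inj_a i j : 0 < i <= k -> 0 < j <= k -> a i = a j -> i = j.
  move=> hi hj e; case: (ltngtP i j) => // lt.
    have := a_lt a0 a_mono (ltac:(lia) : 0 < i) lt (ltac:(lia)); by rewrite e ltnn.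
  have := a_lt a0 a_mono (ltac:(lia) : 0 < j) lt (ltac:(lia)); by rewrite e ltnn.
have bd (i : 'I_k) : (a i.+1).-1 < n.
  have [h1 h2 _] := av i.+1 (ltn_ord i); by case: (a i.+1) h1 h2.
rewrite -[RHS]card_ord -cardsT -(card_in_imset (f := fun i : 'I_k => Ordinal (bd i))); last first.
  move=> i j _ _ [e]; apply: val_inj; apply/succn_inj; apply: inj_a; rewrite ?ltn_ord //.
  have [h1 _ _] := av i.+1 (ltn_ord i); have [h2 _ _] := av j.+1 (ltn_ord j).
  by rewrite -(prednK h1) -(prednK h2) e.
apply: eq_card => v; rewrite inE; apply/andP/imsetP => [[/eqP tv]|[i _ ->]] /=.
  rewrite /al chosenE => /hasP[i]; rewrite mem_iota => hi /eqP e.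
  have hi' : i.-1 < k by lia.
  exists (Ordinal hi') => //; apply: val_inj => /=.
  by rewrite prednK ?e //; lia.
have [h1 h2 h3] := av i.+1 (ltn_ord i); rewrite h3 eqxx; split=> //.
rewrite /al chosenE; apply/hasP; exists i.+1; last by rewrite prednK.
by rewrite mem_iota; have := ltn_ord i; lia.
Qed.

(** The sequence [a] lists the true inputs in increasing order, shifted by one; each group receives
    the tuple it stands for, and group 0 the actual counts. *)
Lemma circuit_to_choice : circuit_sat -> choice_sat.
Proof.
move=> [al [val_al card_al]].
pose s := [seq v <- iota 0 n | (tag v == 0) && al v].
have s_size : size s = k.
  rewrite -card_al /s size_filter -sum1_count -sum1_card.
  rewrite (eq_bigl (fun v : 'I_n => (tag v == 0) && al v)); last by move=> v; rewrite inE.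
  by rewrite -[n in iota 0 n]subn0 -/(index_iota 0 n) big_mkord.
have s_sorted : sorted ltn s.
  by apply: sorted_filter; [exact: ltn_trans|exact: iota_ltn_sorted].
have s_mem v : (v \in s) = [&& tag v == 0, al v & v < n].
  by rewrite mem_filter mem_iota add0n leq0n /= andbA.
pose a i := if i == 0 then 0 else (nth 0 s i.-1).+1.
have a0 : a 0 = 0 by [].
have a_mono i : 0 < i < k -> a i < a i.+1.
  case: i => // i /= hi; rewrite /a /= ltnS.
  apply: (sorted_ltn_nth ltn_trans 0 s_sorted) => //; rewrite inE s_size //; exact: ltnW.
have a_pos i : 0 < i <= k -> 0 < a i by rewrite /a; case: i.
have a_in i : 0 < i <= k -> (a i).-1 \in s.
  by case: i => // i /= hi; rewrite /a /= mem_nth // s_size.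
have a_le i : i <= k -> a i <= n.
  case: i => // i hi; have := a_in i.+1 hi; rewrite s_mem => /and3P[_ _]; rewrite /a /=; lia.
have chosen_al v : v < n -> tag v = 0 -> chosen a v = al v.
  move=> vn tv; rewrite chosenE; apply/hasP/idP => [[i]|av].
    rewrite mem_iota => hi /eqP e; have := a_in i (ltac:(lia)).
    by rewrite e s_mem => /and3P[].
  have vs : v \in s by rewrite s_mem tv av vn.
  exists (index v s).+1; first by rewrite mem_iota add1n !ltnS -s_size index_mem.
  by rewrite /a /= nth_index.
pose bt tau := if tau == 0 then
    undigits n.+2 (mkseq (fun j => cnt n d tag na arg al (atom_at n tag na arg d root j)) q)
  else undigits n.+2 (map a (digits k.+1 q tau)).
have lt0 : all (fun x => x < n.+2) (mkseq (fun j => cnt n d tag na arg al (atom_at n tag na arg d root j)) q).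
  apply/allP => x /mapP[j _ ->]; rewrite ltnS; exact: cnt_le.
have lta tau : all (fun x => x < n.+2) (map a (digits k.+1 q tau)).
  apply/allP => x /mapP[z zd ->]; have := digits_lt (ltn0Sn k) zd; rewrite ltnS => /a_le.
  by rewrite ltnS => /leqW.
have dg0 : digits n.+2 q (bt 0) = mkseq (fun j => cnt n d tag na arg al (atom_at n tag na arg d root j)) q.
  by rewrite /bt /= undigitsK // size_mkseq.
have dgS tau : tau != 0 -> digits n.+2 q (bt tau) = map a (digits k.+1 q tau).
  by move=> t0; rewrite /bt (negbTE t0) undigitsK // size_map size_digits.
have dgbS tau j : tau != 0 -> j < q -> dgb (bt tau) j = a (dgt tau j).
  by move=> t0 hj; rewrite /dgb dgS // (nth_map 0) // size_digits.
have q0 : 0 < q by lia.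
have mapa tau : map a (digits k.+1 q tau) = tuple_of tau (bt tau).
  by rewrite /tuple_of; case: eqP => [->|/eqP t0]; rewrite ?digits0 ?map_nseq ?dgS.
exists bt; split=> [tau ht|tau' j ht hj].
  split.
    rewrite /bt /nitems; case: (tau == 0).
      by have := undigits_lt lt0; rewrite size_mkseq.
    by have := undigits_lt (lta tau); rewrite size_map size_digits.
  rewrite /valid_item; case: eqP => [->|/eqP t0].
    rewrite (top_correct na1 na0 arg_lt dp_lt (al := al) root_lt root_dp root_dp) // => p hp.
    by rewrite /dgb dg0 nth_mkseq ?add0n //; apply: leq_trans hp dq.
  rewrite !dgbS //; apply/andP; split; apply/implyP.
    move=> tk; rewrite dgt_small //; have tk' : 0 < tau <= k by rewrite lt0n t0.
    rewrite a_pos // a_le //=; by have := a_in tau tk'; rewrite s_mem => /andP[].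
  case/andP=> h1 h2; apply: (a_lt a0 a_mono h1 h2); have := dgt_lt tau 1; by rewrite ltnS.
case: (tau' =P 0) => [->|/eqP t0]; last first.
  rewrite sum_pos_tuple // sum_neg_tuple // dgbS //; case: eqP => [->//|/eqP h].
  by rewrite dgbS // dgt_small //; have := dgt_lt tau' j; rewrite ltnS.
have G0 : 0 < ngroups by apply: small_lt.
rewrite /eq_pos /eq_neg /= big_split /= (sum_indicator (fun i => dgb (bt i) j) G0).
rewrite /dgb dg0 nth_mkseq //.
under eq_bigr => tau _ do rewrite -mapa.
under [X in _ = X + _]eq_bigr => tau _ do rewrite -mapa.
rewrite (count_identity a0 a_mono a_pos); congr (_ + _).
(* [chosen a] and [al] are compared on input nodes only, on which alone the counts depend. *)
by apply: (cnt_ext _ na0 arg_lt) => u; exact: chosen_al.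
Qed.

Lemma choice_circuit : choice_sat <-> circuit_sat.
Proof. by split; [exact: choice_to_circuit|exact: circuit_to_choice]. Qed.

End Encoding.

(** * Reading the encoding of a circuit *)

Lemma zeros_cons b v p : zeros (b :: v) p.+1 = ~~ b + zeros v p.
Proof. by rewrite /zeros big_nat_recl. Qed.

Lemma tok_true v i : tok (true :: v) i = (i == 0) + tok v i.
Proof.
rewrite /tok [size _]/= big_nat_recl //= /zeros big_geq // eq_sym; congr (_ + _).
by apply: eq_bigr => p _; rewrite -/(zeros (true :: v) p.+1) zeros_cons.
Qed.

Lemma tok_false v i : tok (false :: v) i = if i is i'.+1 then tok v i' else 0.
Proof.
rewrite /tok [size _]/= big_nat_recl //= add0n.
case: i => [|i]; first by rewrite big1 // => p _; rewrite zeros_cons /= andbF.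
by apply: eq_bigr => p _; rewrite zeros_cons.
Qed.

Lemma tok_encode_nat t v i :
  tok (encode_nat t ++ v) i = if i is i'.+1 then tok v i' else t.
Proof.
elim: t => [|t IH] /=; first by rewrite tok_false.
by rewrite tok_true -/(encode_nat t) IH; case: (i).
Qed.

Definition encode_toks (T : seq nat) := flatten (map encode_nat T).

Lemma tok_encode T i : tok (encode_toks T) i = nth 0 T i.
Proof.
elim: T i => [|t T IH] i /=; last by rewrite tok_encode_nat; case: i => //= i; rewrite -IH.
by rewrite /tok big_geq // nth_nil.
Qed.

Lemma size_encode_toks T : size T <= size (encode_toks T).
Proof.
elim: T => //= t T IH; rewrite /encode_toks /= size_cat size_rcons size_nseq.
by rewrite -/(encode_toks T); lia.
Qed.

Lemma encode_toks_cat S T : encode_toks (S ++ T) = encode_toks S ++ encode_toks T.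
Proof. by rewrite /encode_toks map_cat flatten_cat. Qed.

Definition gate_toks (g : gate) : seq nat :=
  match g with
  | Input => [:: 0]
  | Not i => [:: 1; i]
  | And l => 2 :: size l :: l
  | Or l => 3 :: size l :: l
  end.

Lemma encode_gateE g : encode_gate g = encode_toks (gate_toks g).
Proof. by case: g => [|i|l|l]; rewrite /encode_toks /= ?cats0 // /encode_seq_nat catA. Qed.

Definition wcs_toks (k : nat) (C : circuit) : seq nat :=
  k :: size C :: flatten (map gate_toks C).

Lemma encode_wcs k C :
  encode_nat k ++ encode_circuit C = encode_toks (wcs_toks k C).
Proof.
rewrite /wcs_toks /encode_toks /= -/(encode_toks _); congr (_ ++ (_ ++ _)).
by elim: C => //= g C IH; rewrite encode_toks_cat -IH encode_gateE.
Qed.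

Definition pk w := tok w 0.
Definition pn w := tok w 1.
Definition gate_next w x :=
  x + (if tok w x == 0 then 1 else if tok w x == 1 then 2 else (tok w x.+1).+2).
(** The start 2 skips the weight and the number of gates. The cap is imposed by [EIter]; on the
    encoding of a circuit it never bites, because each number takes at least one bit. *)
Definition gate_start w i := iter i (fun x => minn (size w) (gate_next w x)) 2.
Definition ptag w i := tok w (gate_start w i).
Definition pna w i :=
  if ptag w i == 0 then 0 else if ptag w i == 1 then 1 else tok w (gate_start w i).+1.
Definition parg w i j :=
  if ptag w i == 1 then tok w (gate_start w i).+1 else tok w ((gate_start w i).+2 + j).

Definition gate_tag (g : gate) :=
  match g with Input => 0 | Not _ => 1 | And _ => 2 | Or _ => 3 end.

Section Parse.
Variables (k : nat) (C : circuit).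
Let T := wcs_toks k C.
Let w := encode_toks T.
Let prefix i := size (flatten (map gate_toks (take i C))).

Lemma pkE : pk w = k.
Proof. by rewrite /pk tok_encode. Qed.

Lemma pnE : pn w = size C.
Proof. by rewrite /pn tok_encode. Qed.

Lemma prefixS i : i < size C -> prefix i.+1 = prefix i + size (gate_toks (nth Input C i)).
Proof.
by move=> h; rewrite /prefix (take_nth Input) // map_rcons flatten_rcons size_cat.
Qed.

Lemma tok_at i r : i < size C -> r < size (gate_toks (nth Input C i)) ->
  tok w (2 + prefix i + r) = nth 0 (gate_toks (nth Input C i)) r.
Proof.
move=> h hr; rewrite tok_encode /T /wcs_toks /= -[in LHS](cat_take_drop i C).
rewrite map_cat flatten_cat nth_cat ltnNge leq_addr /= addKn.
by rewrite (drop_nth Input) //= nth_cat hr.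
Qed.

Lemma prefix_le i : i <= size C -> 2 + prefix i <= size w.
Proof.
move=> h; apply: leq_trans (size_encode_toks T); rewrite /T /wcs_toks /=.
rewrite -[in X in _ <= X](cat_take_drop i C) map_cat flatten_cat size_cat /prefix; lia.
Qed.

Lemma gate_toks_gt0 g : 0 < size (gate_toks g).
Proof. by case: g. Qed.

Lemma gate_startE i : i <= size C -> gate_start w i = 2 + prefix i.
Proof.
elim: i => [|i IH] hi; first by rewrite /prefix take0.
rewrite /gate_start iterS -/(gate_start w i) IH; last exact: ltnW.
have g0 := gate_toks_gt0 (nth Input C i).
have -> : gate_next w (2 + prefix i) = 2 + prefix i.+1.
  rewrite /gate_next prefixS // -addnA; congr (2 + (_ + _)).
  have t0 := tok_at hi g0; rewrite addn0 in t0; rewrite t0.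
  have t1 := @tok_at i 1 hi; rewrite addn1 in t1.
  by case: (nth Input C i) t1 => //= l -> //.
by apply/minn_idPr; apply: prefix_le.
Qed.

Lemma ptagE i : i < size C -> ptag w i = gate_tag (nth Input C i).
Proof.
move=> h; rewrite /ptag gate_startE; last exact: ltnW.
by rewrite -[2 + _]addn0 tok_at ?gate_toks_gt0 //; case: (nth Input C i).
Qed.

Lemma pnaE i : i < size C -> pna w i = size (gate_args (nth Input C i)).
Proof.
move=> h; rewrite /pna ptagE // gate_startE; last exact: ltnW.
have t1 := @tok_at i 1 h; rewrite addn1 in t1.
by case: (nth Input C i) t1 => //= l -> //.
Qed.

Lemma pargE i j : i < size C -> j < size (gate_args (nth Input C i)) ->
  parg w i j = nth 0 (gate_args (nth Input C i)) j.
Proof.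
move=> h hj; rewrite /parg ptagE // gate_startE; last exact: ltnW.
have t1 := @tok_at i 1 h; rewrite addn1 in t1.
have e2 : (2 + prefix i).+2 + j = 2 + prefix i + j.+2 by lia.
have t2 := @tok_at i j.+2 h; rewrite -e2 in t2.
case: (nth Input C i) t1 t2 hj => [|a|l|l] //= t1 t2 hj; rewrite ?t2 //.
by rewrite t1 //; case: (j) hj.
Qed.

End Parse.

Lemma pf_pk : pf (fun w _ => pk w).
Proof. rewrite /pk; auto 20 with pf nocore. Qed.
Lemma pf_pn : pf (fun w _ => pn w).
Proof. rewrite /pn; auto 20 with pf nocore. Qed.
#[local] Hint Resolve pf_pk pf_pn : pf.

Lemma pf_gate_next A : pf A -> pf (fun w s => gate_next w (A w s)).
Proof. move=> hA; rewrite /gate_next; auto 20 with pf nocore. Qed.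
#[local] Hint Resolve pf_gate_next : pf.

Lemma pf_gate_start A : pf A -> pf (fun w s => gate_start w (A w s)).
Proof.
move=> hA; rewrite /gate_start.
apply: (@pf_iter A (fun w _ => size w) (fun _ _ => 2) (fun w _ x => gate_next w x));
  auto 20 with pf nocore.
Qed.
#[local] Hint Resolve pf_gate_start : pf.

Lemma pf_ptag A : pf A -> pf (fun w s => ptag w (A w s)).
Proof. move=> hA; rewrite /ptag; auto 20 with pf nocore. Qed.
#[local] Hint Resolve pf_ptag : pf.

Lemma pf_pna A : pf A -> pf (fun w s => pna w (A w s)).
Proof. move=> hA; rewrite /pna; auto 20 with pf nocore. Qed.

Lemma pf_parg A B : pf A -> pf B -> pf (fun w s => parg w (A w s) (B w s)).
Proof. move=> hA hB; rewrite /parg; auto 20 with pf nocore. Qed.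
#[local] Hint Resolve pf_pna pf_parg : pf.

(** * Tabulated values of a circuit and their recursive form *)

Section CircuitValues.
Variables (A : Type) (a0 : A) (F : seq A -> gate -> A).

Lemma circuit_values_rcons C g :
  circuit_values F (rcons C g) = rcons (circuit_values F C) (F (circuit_values F C) g).
Proof. by rewrite /circuit_values foldl_rcons. Qed.

Lemma size_circuit_values C : size (circuit_values F C) = size C.
Proof.
elim/last_ind: C => // C g IH; by rewrite circuit_values_rcons !size_rcons IH.
Qed.

Lemma take_circuit_values C v : take v (circuit_values F C) = circuit_values F (take v C).
Proof.
elim/last_ind: C => // C g IH.
case: (leqP v (size C)) => h.
  by rewrite circuit_values_rcons -!cats1 !takel_cat ?size_circuit_values.
by rewrite !take_oversize ?size_circuit_values ?size_rcons.
Qed.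

Lemma nth_circuit_values C v : v < size C ->
  nth a0 (circuit_values F C) v = F (take v (circuit_values F C)) (nth Input C v).
Proof.
move=> h; have h' : v < size (circuit_values F C) by rewrite size_circuit_values.
rewrite -[LHS](last_rcons a0 (take v (circuit_values F C))) -take_nth //.
rewrite take_circuit_values (take_nth Input) // circuit_values_rcons last_rcons.
by rewrite take_circuit_values.
Qed.

Lemma last_circuit_values C : 0 < size C ->
  last a0 (circuit_values F C) = nth a0 (circuit_values F C) (size C).-1.
Proof. by move=> h; rewrite -nth_last size_circuit_values. Qed.

End CircuitValues.

Section CircuitFacts.
Variables (C : circuit).
Hypothesis C_wf : circuit_wf C.
Let n := size C.
Let args v := gate_args (nth Input C v).
Let dp v := nth 0 (circuit_values gate_depth C) v.
Let wf v := nth 0 (circuit_values gate_weft C) v.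

Lemma circuit_size_gt0 : 0 < n.
Proof. by case/and3P: C_wf. Qed.

Lemma circuit_args v : v < n ->
  [/\ all (fun j => j < v) (args v), uniq (args v)
    & is_input (nth Input C v) || (args v != [::])].
Proof.
by move=> h; case/and3P: C_wf => _ /forallP /(_ (Ordinal h)) /= /and3P[].
Qed.

Lemma circuit_arg_lt v j : v < n -> j < size (args v) -> nth 0 (args v) j < v.
Proof. by move=> /circuit_args [/allP h _ _] hj; apply: h; rewrite mem_nth. Qed.

Lemma circuit_args_le v : v < n -> size (args v) <= n.
Proof.
move=> h; have [/allP h1 h2 _] := circuit_args h.
apply: (@leq_trans v); last exact: ltnW.
rewrite -[X in _ <= X](size_iota 0); apply: uniq_leq_size => // x /h1.
by rewrite mem_iota.
Qed.

Lemma max_take_ge (s : seq nat) v j : v < n -> j < size (args v) ->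
  nth 0 s (nth 0 (args v) j) <= \max_(i <- args v) nth 0 (take v s) i.
Proof.
move=> h hj; have lt := circuit_arg_lt h hj.
rewrite -(nth_take 0 lt); apply: (leq_bigmax_seq (F := fun i => nth 0 (take v s) i)) => //.
exact: mem_nth.
Qed.

Lemma circuit_dp_lt v j : v < n -> j < size (args v) -> dp (nth 0 (args v) j) < dp v.
Proof.
move=> h hj; rewrite [dp v]/dp nth_circuit_values // /gate_depth.
have -> : is_input (nth Input C v) = false by move: hj; rewrite /args; case: (nth Input C v).
by rewrite ltnS; apply: max_take_ge.
Qed.

Lemma circuit_wf_le v j : v < n -> j < size (args v) ->
  (2 < size (args v)) + wf (nth 0 (args v) j) <= wf v.
Proof.
move=> h hj; rewrite [wf v]/wf nth_circuit_values // /gate_weft leq_add2l.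
exact: max_take_ge.
Qed.

Lemma circuit_evalE d al (tag na : nat -> nat) (arg : nat -> nat -> nat) :
  (forall v, v < n -> tag v = gate_tag (nth Input C v)) ->
  (forall v, v < n -> na v = size (args v)) ->
  (forall v j, v < n -> j < size (args v) -> arg v j = nth 0 (args v) j) ->
  dp n.-1 <= d ->
  circuit_eval al C = evf tag na arg d al n.-1.
Proof.
move=> htag hna harg hd; rewrite /circuit_eval last_circuit_values ?circuit_size_gt0 //.
have : n.-1 < n by rewrite prednK // circuit_size_gt0.
move: (n.-1) hd => v; elim/ltn_ind: v d => v IH d hd vn.
rewrite nth_circuit_values //.
set s := take v _.
have A d' j : j < size (args v) -> dp (nth 0 (args v) j) <= d' ->
   nth false s (nth 0 (args v) j) = evf tag na arg d' al (arg v j).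
  move=> hj hd'; have lt := circuit_arg_lt vn hj.
  rewrite /s nth_take // harg //; apply: IH => //.
  by apply: ltn_trans lt vn.
have hs : size s = v by rewrite /s size_takel // size_circuit_values ltnW.
have E (l : seq nat) : l = map (nth 0 l) (iota 0 (size l)) by rewrite -/(mkseq _ _) mkseq_nth.
(* A node of depth 0 has no arguments, so by well-formedness it is an input. *)
case: d hd A => [|d] hd A.
  rewrite /= htag //.
  have dl j : j < size (args v) -> False.
    by move=> hj; have := circuit_dp_lt vn hj; rewrite ltnNge (leq_trans hd).
  have [_ _] := circuit_args vn; move: dl; rewrite /args.
  case: (nth Input C v) => [|i|l|l] /=; rewrite ?hs //; first by move=> /(_ 0 isT).
  - by case: l => // x l /(_ 0 isT).
  - by case: l => // x l /(_ 0 isT).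
have A' j : j < size (args v) -> nth false s (nth 0 (args v) j) = evf tag na arg d al (arg v j).
  by move=> hj; apply: A => //; have := circuit_dp_lt vn hj; lia.
rewrite /= htag // hna //; move: A'; rewrite /args.
case: (nth Input C v) => [|i|l|l] A' /=; rewrite ?hs //.
- by rewrite -A'.
- rewrite [in LHS](E l) all_map; apply: eq_in_all => j; rewrite mem_iota => hj /=; exact: A'.
- rewrite [in LHS](E l) has_map; apply: eq_in_has => j; rewrite mem_iota => hj /=; exact: A'.
Qed.

End CircuitFacts.

Lemma wcs_choice d q (x : wcs_instance 1 d) : 1 < q -> 2 ^ d <= q ->
  let w := encode (p := weighted_circuit_sat 1 d) x in
  choice_sat (pn w) d (pk w) q (ptag w) (pna w) (parg w) <->
  yes (p := weighted_circuit_sat 1 d) x.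
Proof.
move=> q2 dq w; case: x @w => C k C_wf C_weft C_depth w.
have ew : w = encode_toks (wcs_toks k C) by exact: encode_wcs.
have en : pn w = size C by rewrite ew pnE.
have ek : pk w = k by rewrite ew pkE.
have n0 := circuit_size_gt0 C_wf.
have htag v : v < size C -> ptag w v = gate_tag (nth Input C v) by rewrite ew; exact: ptagE.
have hna v : v < size C -> pna w v = size (gate_args (nth Input C v)) by rewrite ew; exact: pnaE.
have harg v j : v < size C -> j < size (gate_args (nth Input C v)) ->
  parg w v j = nth 0 (gate_args (nth Input C v)) j by rewrite ew; exact: pargE.
pose dp v := nth 0 (circuit_values gate_depth C) v.
pose wf v := nth 0 (circuit_values gate_weft C) v.
have rd : dp (size C).-1 <= d by rewrite /dp -last_circuit_values.
have rw : wf (size C).-1 <= 1 by rewrite /wf -last_circuit_values.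
rewrite en ek.
have H := @choice_circuit (size C) d k q (ptag w) (pna w) (parg w) dp wf.
have {H} -> : choice_sat (size C) d k q (ptag w) (pna w) (parg w) <->
  circuit_sat (size C) d k (ptag w) (pna w) (parg w).
  apply: H => //.
  - by move=> v vn; rewrite htag // hna //; case: (nth Input C v).
  - move=> v vn; rewrite htag // hna //; have [_ _] := circuit_args C_wf vn.
    by case: (nth Input C v) => [|i|[|? l]|[|? l]].
  - by move=> v j vn; rewrite hna // => hj; rewrite harg //; apply: circuit_arg_lt.
  - by move=> v vn; rewrite hna //; apply: circuit_args_le.
  - by move=> v j vn; rewrite hna // => hj; rewrite harg //; apply: circuit_dp_lt.
  - by move=> v j vn; rewrite hna // => hj; rewrite harg //; apply: circuit_wf_le.
have card (al : nat -> bool) : #|[set v : 'I_(size C) | (ptag w v == 0) && al v]| = assignment_weight al C.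
  apply: eq_card => v; rewrite !inE htag //.
  by case: (nth Input C v).
rewrite /circuit_sat /=; split=> -[al [h1 h2]]; exists al; split.
- by rewrite (circuit_evalE C_wf al htag hna harg rd).
- by rewrite -card.
- by rewrite -(circuit_evalE C_wf al htag hna harg rd).
- by rewrite card.
Qed.

(** * The reduction is polynomial-time *)

Notation fn := (seq bool -> seq nat -> nat).

(** Expressions only denote numbers. Tuples have a length fixed by [d] and [q], so they are handled
    outside the language, as lists of number-valued functions. *)
Definition evals (w : seq bool) (s : seq nat) (Us : seq fn) : seq nat :=
  map (fun U => U w s) Us.

Definition pfs (Us : seq fn) : Prop := List.Forall pf Us.

Definition weak (U : fn) : fn := fun w s => U w (behead s).

Lemma pfs_weak Us : pfs Us -> pfs (map weak Us).
Proof. by elim=> [|U l hU _ IH] /=; constructor => //; exact: pf_wk. Qed.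

Lemma evals_weak w s Us : evals w s (map weak Us) = evals w (behead s) Us.
Proof. by rewrite /evals -map_comp. Qed.

Lemma pf_listed Us V : pfs Us -> pf V -> pf (fun w s => listed (evals w s Us) (V w s)).
Proof.
move=> hU hV; elim: hU => [|U l pU _ IH]; first exact: pf_const 0.
apply: (@pf_or (fun w s => U w s == (V w s).+1)) => //.
auto with pf nocore.
Qed.

Lemma pf_nthl Us J : pfs Us -> pf J -> pf (fun w s => nth 0 (evals w s Us) (J w s)).
Proof.
move=> hU; elim: hU J => [|U l pU _ IH] J pJ.
  by apply: pf_ext (pf_const 0) => w s; rewrite nth_nil.
apply: (@pf_ext (fun w s => if J w s == 0 then U w s else nth 0 (evals w s l) (J w s).-1)).
  by move=> w s /=; case: (J w s).
apply: pf_if => //; first by auto with pf nocore.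
by apply: IH; auto with pf nocore.
Qed.

Fixpoint digl (M : fn) (q : nat) (A : fn) : seq fn :=
  if q is q'.+1 then (fun w s => A w s %% M w s) :: digl M q' (fun w s => A w s %/ M w s)
  else [::].

Lemma diglE M q A w s : evals w s (digl M q A) = digits (M w s) q (A w s).
Proof.
elim: q A => //= q IH A; congr (_ :: _).
exact: (IH (fun w s => A w s %/ M w s)).
Qed.

Lemma pfs_digl M q A : pf M -> pf A -> pfs (digl M q A).
Proof.
move=> hM; elim: q A => [|q IH] A hA /=; constructor; first by auto with pf nocore.
by apply: IH; auto with pf nocore.
Qed.

Lemma pf_digit M q A J : pf M -> pf A -> pf J ->
  pf (fun w s => nth 0 (digits (M w s) q (A w s)) (J w s)).
Proof.
move=> hM hA hJ; apply: pf_ext (pf_nthl (pfs_digl q hM hA) hJ) => w s.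
by rewrite diglE.
Qed.

Lemma pf_canon_list lo Us : pf lo -> pfs Us -> pf (fun w s => canon (lo w s) (evals w s Us)).
Proof.
have zero l : pfs l -> pf (fun w s => all (pred1 0) (evals w s l)).
  elim=> [|V l' hV _ IH] /=; first exact: pf_const 1.
  by apply: pf_and => //; auto with pf nocore.
move=> hlo hU; elim: hU lo hlo => [|U l pU hl IH] lo hlo /=; first exact: pf_const 1.
apply: pf_ifb; [by auto with pf nocore|exact: zero|].
by apply: pf_and; [auto with pf nocore|exact: IH].
Qed.

Lemma pf_canon M q A : pf M -> pf A -> pf (fun w s => canon 0 (digits (M w s) q (A w s))).
Proof.
move=> hM hA; apply: pf_ext (pf_canon_list (pf_const 0) (pfs_digl q hM hA)) => w s.
by rewrite diglE.
Qed.

Lemma pf_signed (f : seq bool -> seq nat -> seq nat -> nat) sg Bs Us :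
  (forall Us, pfs Us -> pf (fun w s => f w s (evals w s Us))) -> pfs Bs -> pfs Us ->
  pf (fun w s => signed (f w s) sg (evals w s Bs) (evals w s Us)).
Proof.
move=> hf hB; elim: hB sg Us => [|B l pB _ IH] sg Us hU /=.
  by case: sg; [exact: hf|exact: pf_const 0].
apply: pf_if; [by auto with pf nocore|exact: IH|].
apply: pf_add; last exact: IH.
exact: (IH sg (B :: Us) (List.Forall_cons B pB hU)).
Qed.

(** The expression is built by recursion on the constant depth bound; below a quantifier over
    arguments, the list has to be weakened past the new variable. *)
Lemma pf_evf e Us V : pfs Us -> pf V ->
  pf (fun w s => evf (ptag w) (pna w) (parg w) e (listed (evals w s Us)) (V w s)).
Proof.
elim: e Us V => [|e IH] Us V hU hV /=.
  by apply: pf_and; [auto with pf nocore|exact: pf_listed].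
have rec : pf (fun w s => evf (ptag w) (pna w) (parg w) e (listed (evals w (behead s) Us))
    (parg w (V w (behead s)) (head 0 s))).
  have := IH (map weak Us) (fun w s => parg w (V w (behead s)) (head 0 s)) (pfs_weak hU).
  move=> h; apply: pf_ext (h _); last by auto with pf nocore.
  by move=> w s; rewrite evals_weak.
apply: pf_ifb; [by auto with pf nocore|exact: pf_listed|].
apply: pf_ifb; first by auto with pf nocore.
  by apply: pf_neg; apply: IH => //; auto with pf nocore.
apply: pf_ifb; first by auto with pf nocore.
  apply: (@pf_all _ (fun w s j => evf (ptag w) (pna w) (parg w) e (listed (evals w s Us))
    (parg w (V w s) j))) => //; by auto with pf nocore.
apply: (@pf_has _ (fun w s j => evf (ptag w) (pna w) (parg w) e (listed (evals w s Us))
    (parg w (V w s) j))) => //; by auto with pf nocore.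
Qed.

Lemma pf_cnt d Us W : pfs Us -> pf W ->
  pf (fun w s => cnt (pn w) d (ptag w) (pna w) (parg w) (listed (evals w s Us)) (W w s)).
Proof.
move=> hU hW; apply: pf_if; [by auto with pf nocore| |exact: pf_const 0].
apply: pf_if; [by auto with pf nocore|exact: pf_listed|].
apply: (@pf_sum _ (fun w s j => evf (ptag w) (pna w) (parg w) d (listed (evals w s Us))
    (parg w (W w s) j))); first by auto with pf nocore.
have h := @pf_evf d (map weak Us) (fun w s => parg w (W w (behead s)) (head 0 s)) (pfs_weak hU).
apply: pf_ext (h _); last by auto with pf nocore.
by move=> w s; rewrite evals_weak.
Qed.

Lemma pf_atom V : pf V -> pf (fun w s => atom (ptag w) (pna w) (V w s)).
Proof. by move=> hV; rewrite /atom; auto with pf nocore. Qed.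

Lemma pf_thr V : pf V -> pf (fun w s => thr (ptag w) (pna w) (V w s)).
Proof. by move=> hV; rewrite /thr; auto with pf nocore. Qed.
#[local] Hint Resolve pf_atom pf_thr : pf.

Lemma pf_atom_at e V P : pf V -> pf P ->
  pf (fun w s => atom_at (pn w) (ptag w) (pna w) (parg w) e (V w s) (P w s)).
Proof.
elim: e V P => [|e IH] V P hV hP /=; first by auto 20 with pf nocore.
apply: pf_if; [by auto with pf nocore|by auto with pf nocore|].
apply: pf_if; [by auto with pf nocore|by apply: IH; auto with pf nocore|].
by apply: pf_if; [auto with pf nocore|apply: IH; auto with pf nocore|auto with pf nocore].
Qed.

Lemma pf_top e V off Cs : pf V -> pfs Cs ->
  pf (fun w s => top (ptag w) (pna w) (parg w) e (V w s) off (nth 0 (evals w s Cs))).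
Proof.
move=> hV hC; have hc o : pf (fun w s => nth 0 (evals w s Cs) o) by apply: pf_nthl => //; exact: pf_const.
elim: e V off hV => [|e IH] V off hV /=.
  by apply: pf_ifb; [auto with pf nocore|auto with pf nocore|exact: pf_const 0].
have h0 := IH (fun w s => parg w (V w s) 0) off (ltac:(by auto with pf nocore)).
have h1 := IH (fun w s => parg w (V w s) 1) (off + 2 ^ e) (ltac:(by auto with pf nocore)).
apply: pf_ifb; [by auto with pf nocore|by auto with pf nocore|].
apply: pf_ifb; [by auto with pf nocore|exact: pf_neg h0|].
apply: pf_ifb; first by auto with pf nocore.
  by apply: pf_and => //; apply: pf_or => //; auto with pf nocore.
by apply: pf_or => //; apply: pf_and => //; auto with pf nocore.
Qed.

(** * The constructed instance and the bits of its encoding *)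

Section Instance.
Variables (d q : nat).

Definition wG w := ngroups (pk w) q.
Definition wJ w := nitems (pn w) q.
Definition wB w := offset (pn w) q.
Definition wvalid w := valid_item (pn w) d (pk w) q (ptag w) (pna w) (parg w).
Definition wpos w := eq_pos (pn w) d (pk w) q (ptag w) (pna w) (parg w).
Definition wneg w := eq_neg (pn w) d (pk w) q (ptag w) (pna w) (parg w).
Definition wy w := item_coord (wG w) (wJ w) (wB w) (wvalid w) (wpos w) (wneg w).
Definition wN w := wG w * wJ w.
Definition wL w := (2 * q).+1 * wG w.
Definition wt w := wG w * wB w.

Lemma pf_dgb B J : pf B -> pf J -> pf (fun w s => dgb (pn w) q (B w s) (J w s)).
Proof. by move=> hB hJ; apply: (@pf_digit (fun w _ => (pn w).+2)); auto with pf nocore. Qed.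

Lemma pf_dgt B J : pf B -> pf J -> pf (fun w s => dgt (pk w) q (B w s) (J w s)).
Proof. by move=> hB hJ; apply: (@pf_digit (fun w _ => (pk w).+1)); auto with pf nocore. Qed.
#[local] Hint Resolve pf_dgb pf_dgt : pf.

Lemma pf_wG : pf (fun w _ => wG w).
Proof. by apply: pf_exp; auto with pf nocore. Qed.
Lemma pf_wJ : pf (fun w _ => wJ w).
Proof. by apply: pf_exp; auto with pf nocore. Qed.
Lemma pf_wB : pf (fun w _ => wB w).
Proof. by rewrite /wB /offset; auto with pf nocore. Qed.
#[local] Hint Resolve pf_wG pf_wJ pf_wB : pf.

Lemma pf_wvalid T B : pf T -> pf B -> pf (fun w s => wvalid w (T w s) (B w s)).
Proof.
move=> hT hB; rewrite /wvalid /valid_item.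
apply: pf_ifb; first by auto with pf nocore.
  have h := @pf_top d (fun w _ => (pn w).-1) 0 (digl (fun w _ => (pn w).+2) q B).
  apply: pf_ext (h _ _); [|by auto with pf nocore|by apply: pfs_digl; auto with pf nocore].
  by move=> w s; rewrite diglE.
by auto 30 with pf nocore.
Qed.

Lemma pf_atom_count J Us : pf J -> pfs Us ->
  pf (fun w s => atom_count (pn w) d (ptag w) (pna w) (parg w) (J w s) (evals w s Us)).
Proof.
by move=> hJ hU; apply: pf_cnt => //; apply: pf_atom_at; auto with pf nocore.
Qed.

Lemma pf_signed_count sg J T B : pf J -> pf T -> pf B ->
  pf (fun w s => signed (atom_count (pn w) d (ptag w) (pna w) (parg w) (J w s)) sg
                   (tuple_of (pn w) q (T w s) (B w s)) [::]).
Proof.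
move=> hJ hT hB.
(* Multiplying every digit by the test on the group turns the list into the zero tuple for group 0
   without changing its length. *)
pose Bs := map (fun (D : fn) w s => (T w s != 0) * D w s) (digl (fun w _ => (pn w).+2) q B).
have hBs : pfs Bs.
  have : pfs (digl (fun w _ => (pn w).+2) q B) by apply: pfs_digl; auto with pf nocore.
  by rewrite /Bs; elim=> [|D l hD _ IH] /=; constructor => //; auto with pf nocore.
have h := @pf_signed (fun w s => atom_count (pn w) d (ptag w) (pna w) (parg w) (J w s)) sg Bs [::].
apply: pf_ext (h (fun Us hU => pf_atom_count hJ hU) hBs (List.Forall_nil _)) => w s.
congr (signed _ _ _ _).
rewrite /Bs /evals -map_comp /tuple_of -(diglE (fun w _ => (pn w).+2) q B w s) /evals.
case t0: (T w s == 0); last by apply: eq_map => D /=; rewrite t0 mul1n.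
have sz : size (digl (fun w _ => (pn w).+2) q B) = q by elim: (q) (B) => //= q' IH B'; rewrite IH.
transitivity (nseq (size (digl (fun w _ => (pn w).+2) q B)) 0); last by rewrite sz.
by elim: (digl _ _ _) => //= D l ->; rewrite t0.
Qed.
#[local] Hint Resolve pf_signed_count : pf.

Lemma pf_wpos T' J T B : pf T' -> pf J -> pf T -> pf B ->
  pf (fun w s => wpos w (T' w s) (J w s) (T w s) (B w s)).
Proof.
move=> h1 h2 h3 h4; rewrite /wpos /eq_pos.
have hc : pf (fun w s => canon 0 (digits (pk w).+1 q (T w s))).
  by apply: (@pf_canon (fun w _ => (pk w).+1)); auto with pf nocore.
by auto 20 with pf nocore.
Qed.

Lemma pf_wneg T' J T B : pf T' -> pf J -> pf T -> pf B ->
  pf (fun w s => wneg w (T' w s) (J w s) (T w s) (B w s)).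
Proof.
move=> h1 h2 h3 h4; rewrite /wneg /eq_neg.
have hc : pf (fun w s => canon 0 (digits (pk w).+1 q (T w s))).
  by apply: (@pf_canon (fun w _ => (pk w).+1)); auto with pf nocore.
by auto 20 with pf nocore.
Qed.
#[local] Hint Resolve pf_wvalid pf_wpos pf_wneg : pf.

Lemma pf_wy E I : pf E -> pf I -> pf (fun w s => wy w (E w s) (I w s)).
Proof.
move=> hE hI; rewrite /wy /item_coord; cbv zeta.
by auto 30 with pf nocore.
Qed.

Lemma pf_wN : pf (fun w _ => wN w).
Proof. by rewrite /wN; auto with pf nocore. Qed.
Lemma pf_wL : pf (fun w _ => wL w).
Proof. by rewrite /wL; auto with pf nocore. Qed.
Lemma pf_wt : pf (fun w _ => wt w).
Proof. by rewrite /wt; auto with pf nocore. Qed.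
#[local] Hint Resolve pf_wy pf_wN pf_wL pf_wt : pf.

Definition wbudget w := budget (wN w) (wL w) (wG w) (wy w).
Definition whmax w := hmax (wN w) (wL w) (wG w) (wt w) (wy w).
Definition warc w := arc (wN w) (wL w) (wG w) (wt w) (wy w).

Lemma pf_tot I : pf I -> pf (fun w s => tot (wN w) (wy w) (I w s)).
Proof. by move=> hI; rewrite /tot; auto with pf nocore. Qed.
#[local] Hint Resolve pf_tot : pf.

Lemma pf_wyy E I : pf E -> pf I -> pf (fun w s => yy (wN w) (wt w) (wy w) (E w s) (I w s)).
Proof. by move=> hE hI; rewrite /yy; auto 20 with pf nocore. Qed.

Lemma pf_wybound : pf (fun w _ => ybound (wN w) (wL w) (wy w)).
Proof. by rewrite /ybound; auto 20 with pf nocore. Qed.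
#[local] Hint Resolve pf_wyy pf_wybound : pf.

Lemma pf_wbudget : pf (fun w _ => wbudget w).
Proof. by rewrite /wbudget /budget; auto 20 with pf nocore. Qed.
#[local] Hint Resolve pf_wbudget : pf.

Lemma pf_whmax : pf (fun w _ => whmax w).
Proof. by rewrite /whmax /hmax; auto 20 with pf nocore. Qed.
#[local] Hint Resolve pf_whmax : pf.

Lemma pf_whh E : pf E -> pf (fun w s => hh (wN w) (wL w) (wG w) (wt w) (wy w) (E w s)).
Proof. by move=> hE; rewrite /hh; auto 20 with pf nocore. Qed.
#[local] Hint Resolve pf_whh : pf.

Lemma pf_warc K E I H K' E' I' H' :
  pf K -> pf E -> pf I -> pf H -> pf K' -> pf E' -> pf I' -> pf H' ->
  pf (fun w s => warc w (K w s) (E w s) (I w s) (H w s) (K' w s) (E' w s) (I' w s) (H' w s)).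
Proof.
move=> h1 h2 h3 h4 h5 h6 h7 h8; rewrite /warc /arc /is_end /is_leaf /is_u /is_c.
apply: pf_or; last apply: pf_or.
- by auto 20 with pf nocore.
- by auto 20 with pf nocore.
- by auto 20 with pf nocore.
Qed.
#[local] Hint Resolve pf_warc : pf.

(** Mixed-radix digits of a vertex number; every number below [worder] is a vertex. *)
Definition code_h w u := u %% whmax w.
Definition code_i w u := u %/ whmax w %% wL w.
Definition code_e w u := u %/ whmax w %/ wL w %% (wN w).+2.
Definition code_k w u := u %/ whmax w %/ wL w %/ (wN w).+2.
Definition worder w := 4 * ((wN w).+2 * (wL w * whmax w)).

Definition wadj w u v :=
  warc w (code_k w u) (code_e w u) (code_i w u) (code_h w u)
         (code_k w v) (code_e w v) (code_i w v) (code_h w v) ||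
  warc w (code_k w v) (code_e w v) (code_i w v) (code_h w v)
         (code_k w u) (code_e w u) (code_i w u) (code_h w u).

Lemma pf_wadj U V : pf U -> pf V -> pf (fun w s => wadj w (U w s) (V w s)).
Proof.
move=> hU hV; rewrite /wadj /code_k /code_e /code_i /code_h.
by apply: pf_or; apply: pf_warc; auto 20 with pf nocore.
Qed.

Lemma pf_worder : pf (fun w _ => worder w).
Proof. by rewrite /worder; auto 20 with pf nocore. Qed.
#[local] Hint Resolve pf_wadj pf_worder : pf.

Definition out_len w := (wbudget w).+1 + ((worder w).+1 + worder w * worder w).

(** Three blocks: the unary budget, the unary order, and the adjacency matrix row by row. *)
Definition out_bit w i :=
  if i < (wbudget w).+1 then i < wbudget w
  else let j := i - (wbudget w).+1 in
    if j < (worder w).+1 then j < worder w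
    else let p := j - (worder w).+1 in wadj w (p %/ worder w) (p %% worder w).

Lemma pf_out_len : pf (fun w _ => out_len w).
Proof. by rewrite /out_len; auto 20 with pf nocore. Qed.

Lemma pf_out_bit I : pf I -> pf (fun w s => out_bit w (I w s)).
Proof.
move=> hI; rewrite /out_bit; cbv zeta.
apply: pf_ifb; [by auto with pf nocore|by auto with pf nocore|].
apply: pf_ifb; [by auto 20 with pf nocore|by auto 20 with pf nocore|].
by apply: pf_wadj; auto 20 with pf nocore.
Qed.

End Instance.

(** * The reduction *)

Lemma mkseqD (T : Type) (f : nat -> T) a b :
  mkseq f (a + b) = mkseq f a ++ mkseq (fun i => f (a + i)) b.
Proof.
rewrite /mkseq iotaD map_cat add0n; congr (_ ++ _).
by rewrite -[a in iota a b]addn0 iotaDl -map_comp.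
Qed.

Lemma encode_nat_mkseq n : encode_nat n = mkseq (fun i => i < n) n.+1.
Proof.
apply: (@eq_from_nth _ false); rewrite size_rcons size_nseq ?size_mkseq // => i hi.
rewrite nth_mkseq // nth_rcons size_nseq nth_nseq.
by case: (ltngtP i n) hi => // h; lia.
Qed.

Lemma allpairs_mkseq (f : nat -> nat -> bool) m n :
  [seq f u v | u <- iota 0 m, v <- iota 0 n] = mkseq (fun p => f (p %/ n) (p %% n)) (m * n).
Proof.
elim: m => [|m IH] //.
rewrite -addn1 iotaD allpairs_cat IH mulnDl mkseqD /= cats0 add0n; congr (_ ++ _).
rewrite mul1n /mkseq; apply/eq_in_map => i; rewrite mem_iota add0n => /andP[_ hi].
have n0 : 0 < n by apply: leq_ltn_trans hi.
by rewrite divnMDl // divn_small // addn0 modnMDl modn_small.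
Qed.

Lemma encode_graphE n (g : sgraph 'I_n) (f : nat -> nat -> bool) :
  (forall u v : 'I_n, g u v = f u v) ->
  encode_graph g = mkseq (fun i => i < n) n.+1 ++ mkseq (fun p => f (p %/ n) (p %% n)) (n * n).
Proof.
move=> h; rewrite /encode_graph encode_nat_mkseq -allpairs_mkseq -!val_enum_ord.
rewrite allpairs_mapl allpairs_mapr; congr (_ ++ _).
apply: eq_allpairs => u v; exact: h.
Qed.

Section Reduction.
Variables (d q : nat).

Definition oa_graph_of (w : seq bool) : sgraph 'I_(worder d q w) :=
  gadget (wN q w) (wL q w) (wG q w) (wt q w) (wy d q w)
    (fun u : 'I_(worder d q w) => code_k d q w u) (fun u => code_e d q w u)
    (fun u => code_i d q w u) (fun u => code_h d q w u).

Lemma wbudget_gt0 w : 0 < wbudget d q w.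
Proof. by []. Qed.

Definition oa_instance_of (w : seq bool) : alliance_instance :=
  AllianceInstance (oa_graph_of w) (wbudget_gt0 w).

Lemma encode_oa w : encode (p := offensive_alliance_problem 7) (oa_instance_of w) =
  mkseq (fun i => 0 < out_bit d q w i) (out_len d q w).
Proof.
have -> : encode (p := offensive_alliance_problem 7) (oa_instance_of w) =
  encode_nat (wbudget d q w) ++ encode_graph (oa_graph_of w) by [].
rewrite (@encode_graphE _ _ (wadj d q w)) // encode_nat_mkseq /out_len !mkseqD.
have lt_add a b : (a + b < a) = false by lia.
congr (_ ++ (_ ++ _)); apply/eq_in_map => i; rewrite mem_iota /out_bit => /andP[_ hi].
- by rewrite hi; case: (_ < _).
- by rewrite lt_add addKn hi; case: (_ < _).
by rewrite lt_add addKn lt_add addKn; case: (wadj _ _ _ _ _).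
Qed.

Hypothesis q2 : 1 < q.
Hypothesis dq : 2 ^ d <= q.

Section Correct.
Variable x : wcs_instance 1 d.
Let w := encode (p := weighted_circuit_sat 1 d) x.

Lemma wcs_na_le v : v < pn w -> pna w v <= pn w.
Proof.
rewrite /w; case: x => C k C_wf C_weft C_depth /=.
rewrite encode_wcs pnE => vn; rewrite pnaE //; exact: circuit_args_le.
Qed.

Lemma wG_gt0 : 0 < wG q w.
Proof. by rewrite /wG /ngroups expn_gt0. Qed.

Lemma wJ_gt0 : 0 < wJ q w.
Proof. by rewrite /wJ /nitems expn_gt0. Qed.

Lemma wB_gt1 : 1 < wB q w.
Proof. by rewrite /wB /offset; lia. Qed.

Lemma wpos_lt tau' j tau b : wpos d q w tau' j tau b < wB q w.
Proof. by apply: eq_pos_lt; exact: wcs_na_le. Qed.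

Lemma wneg_lt tau' j tau b : wneg d q w tau' j tau b < wB q w.
Proof. by apply: eq_neg_lt; exact: wcs_na_le. Qed.

Lemma wL_gt0 : 0 < wL q w.
Proof. by rewrite /wL muln_gt0 wG_gt0. Qed.

Lemma wt_gt0 : 0 < wt q w.
Proof. by rewrite /wt muln_gt0 wG_gt0 ltnW // wB_gt1. Qed.

Lemma wy_gt0 e i : e < wN q w -> i < wL q w -> 0 < wy d q w e i.
Proof.
by move=> _ _; apply: item_coord_gt0; [exact: wB_gt1|exact: wpos_lt|exact: wneg_lt].
Qed.

Let L := wL q w.
Let H := whmax d q w.
Let N := (wN q w).+2.

Lemma H_gt0 : 0 < H.
Proof. by rewrite /H /whmax /hmax; lia. Qed.

Lemma worder_gt0 : 0 < worder d q w.
Proof. by rewrite /worder 3!muln_gt0 wL_gt0 H_gt0. Qed.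

Definition code (a b c e : nat) : nat := e + H * (c + L * (b + N * a)).

Lemma code_lt a b c e : a < 4 -> b < N -> c < L -> e < H -> code a b c e < worder d q w.
Proof.
move=> ha hb hc he; rewrite /code /worder -/H -/L -/N.
have h1 : b + N * a < N * 4 by nia.
have h2 : c + L * (b + N * a) < L * (N * 4).
  by move: (b + N * a) (N * 4) h1 => X Y; nia.
have : e + H * (c + L * (b + N * a)) < H * (L * (N * 4)).
  by move: (c + _) (L * (N * 4)) h2 => X Y; nia.
have -> : H * (L * (N * 4)) = 4 * (N * (L * H)) by clear; move: N L H => X Y Z; lia.
by [].
Qed.

Definition vertex (a b c e : nat) : 'I_(worder d q w) :=
  insubd (Ordinal worder_gt0) (code a b c e).

Lemma code_parts a b c e : b < N -> c < L -> e < H ->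
  [/\ code_k d q w (code a b c e) = a, code_e d q w (code a b c e) = b,
      code_i d q w (code a b c e) = c & code_h d q w (code a b c e) = e].
Proof.
move=> hb hc he; rewrite /code_k /code_e /code_i /code_h -/H -/L -/N /code.
have dv z y m : z < m -> (z + m * y) %/ m = y.
  by move=> h; rewrite addnC mulnC divnMDl ?divn_small ?addn0 //; lia.
have md z y m : z < m -> (z + m * y) %% m = z.
  by move=> h; rewrite addnC mulnC modnMDl modn_small.
by rewrite !dv // !md.
Qed.

Lemma vertexE a b c e : a < 4 -> b < N -> c < L -> e < H ->
  [/\ code_k d q w (vertex a b c e) = a, code_e d q w (vertex a b c e) = b,
      code_i d q w (vertex a b c e) = c & code_h d q w (vertex a b c e) = e].
Proof.
move=> ha hb hc he; rewrite /vertex val_insubd code_lt //; exact: code_parts.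
Qed.

Lemma parts_lt (u : 'I_(worder d q w)) :
  [/\ code_k d q w u < 4, code_e d q w u < N, code_i d q w u < L & code_h d q w u < H].
Proof.
have := ltn_ord u; rewrite /worder -/H -/L -/N => hu.
rewrite /code_k /code_e /code_i /code_h -/H -/L -/N !ltn_mod wL_gt0 H_gt0; split=> //.
rewrite !ltn_divLR ?wL_gt0 ?H_gt0 //.
by move: hu; rewrite -!mulnA.
Qed.

Lemma vertexK (u : 'I_(worder d q w)) :
  vertex (code_k d q w u) (code_e d q w u) (code_i d q w u) (code_h d q w u) = u.
Proof.
have [h1 h2 h3 h4] := parts_lt u.
apply: val_inj; rewrite /vertex val_insubd code_lt //.
rewrite /code /code_k /code_e /code_i /code_h -/H -/L -/N.
have dm m y : y %% m + m * (y %/ m) = y by rewrite addnC mulnC -divn_eq.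
by rewrite !dm.
Qed.

Lemma oa_instance_yes :
  yes (p := offensive_alliance_problem 7) (oa_instance_of w) <->
  yes (p := weighted_circuit_sat 1 d) x.
Proof.
rewrite -(wcs_choice x q2 dq) -/w.
have GC := gadget_correct wL_gt0 wt_gt0 wy_gt0 vertexE parts_lt vertexK.
have CC := @choice_correct _ _ _ q (wvalid d q w) _ _ wG_gt0 wJ_gt0 wB_gt1 wpos_lt wneg_lt.
exact: iff_trans GC CC.
Qed.

Lemma oa_instance_param : param (p := offensive_alliance_problem 7) (oa_instance_of w) <= wL q w.
Proof.
exact: (gadget_deletion_number wL_gt0 wt_gt0 vertexE parts_lt vertexK).
Qed.

End Correct.
End Reduction.

(** In unary only the length of the output matters, so it suffices to print that many constant bits
    after a machine for [f]. *)
Lemma computable_poly (f : nat -> nat) a b e :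
  computable f -> computable (fun n => b * (f n + a) ^ e).
Proof.
move=> [M hM].
have pL : pf (fun v _ => b * (size v + a) ^ e) by auto 20 with pf nocore.
have [M' [c hM']] := word_machine M pL (pf_const 1).
exists M' => n; have [t ht] := hM n.
have := hM' _ _ _ ht; rewrite size_nseq => h.
exists (t + (f n + 2) ^ c); move: h; congr tm_computes_within.
apply: (@eq_from_nth _ false); rewrite size_mkseq ?size_nseq // => i hi.
by rewrite nth_mkseq // nth_nseq hi.
Qed.

Lemma time_bound F S c1 c t1 sv : t1 <= F * S.+1 ^ c1 -> sv <= S + t1 + 1 ->
  t1 + (sv + 2) ^ c <= (F + 3) ^ c.+2 * S.+1 ^ (c1.+1 * c.+2).
Proof.
move=> h1 h2; rewrite expnM -expnMn.
(* [X] bounds both the time of the given reduction and the length of the intermediate word plus 2,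
   so the total is at most X + X ^ c, hence at most X ^ (c + 2). *)
set X := (F + 3) * S.+1 ^ c1.+1.
have P : 0 < S.+1 ^ c1 by rewrite expn_gt0.
have X3 : sv + 2 <= X.
  by rewrite /X expnS; move: (S.+1 ^ c1) P h1 => Y P h1; nia.
have Xt : t1 <= X.
  by rewrite /X expnS; move: (S.+1 ^ c1) P h1 => Y P h1; nia.
have X2 : 2 <= X by lia.
have le1 : (sv + 2) ^ c <= X ^ c by case: (c) => // c'; rewrite leq_exp2r.
have c0 : 0 < X ^ c by rewrite expn_gt0; lia.
rewrite !expnS; move: (X ^ c) ((sv + 2) ^ c) le1 c0 => Y Z le1 c0.
clearbody X; apply: (@leq_trans (X + Y)); first exact: leq_add.
by apply: (@leq_trans (X * Y + X * Y)); nia.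
Qed.

Theorem theorem1 : W_hard 1 (offensive_alliance_problem 7).
Proof.
move=> Q [d [R [yesR [M1 [f [c1 [comp_f run_f]]]] [g comp_g param_g]]]].
(* The successor ensures [1 < q] even for [d = 0]: tuples of length two are what forces the chosen
   inputs to be increasing. *)
pose q := (2 ^ d).+1.
have q2 : 1 < q by rewrite ltnS expn_gt0.
have dq : 2 ^ d <= q by exact: leqnSn.
have [M [c hM]] := word_machine M1 (pf_out_len d q) (pf_out_bit d q pf_head).
exists (fun x => oa_instance_of d q (encode (R x))); split.
- by move=> x; rewrite yesR oa_instance_yes.
- exists M, (fun n => 1 * (f n + 3) ^ c.+2), (c1.+1 * c.+2); split.
    exact: computable_poly.
  move=> x; have [t1 ht1 run1] := run_f x.
  exists (t1 + (size (encode (R x)) + 2) ^ c); last first.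
    by rewrite encode_oa; exact: hM run1.
  rewrite mul1n; apply: time_bound ht1 (computes_size run1).
exists (fun n => (2 * q).+1 * (g n + 1) ^ q); first exact: computable_poly.
move=> x; apply: leq_trans (oa_instance_param q2 dq (R x)) _.
rewrite /wL leq_mul2l /wG /ngroups; apply/orP; right.
rewrite leq_exp2r; last exact: ltnW.
rewrite addn1 ltnS; apply: leq_trans (param_g x).
by case: (R x) => C k C_wf C_weft C_depth; rewrite /= encode_wcs pkE.
Qed.
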